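(* Let $r\geqslant3$, let $\mathcal L_2$ be the class of $r$th order linear ODEs in the Laguerre--Forsyth form $x^{(r)}+a_{r-3}(t)x^{(r-3)}+\dots+a_1(t)x'+a_0(t)x=b(t)$ with arbitrary smooth functions $a_{r-3},\dots,a_0,b$ of $t$, and let $\widehat{\mathcal L}_2$ be its subclass of homogeneous equations ($b=0$). Consider transformations of the form $$\tilde t=\frac{\alpha t+\beta}{\gamma t+\delta},\quad \tilde x=\frac C{(\gamma t+\delta)^{r-1}}x+X_0(t),\qquad( * )$$ where $\alpha,\beta,\gamma,\delta,C$ are constants with $\alpha\delta-\beta\gamma\ne0$ and $C\ne0$, and $X_0$ is a smooth function of $t$. The equivalence group $\widehat G^\sim_2$ of $\widehat{\mathcal L}_2$ is derived from the equivalence group $G^\sim_2$ of $\mathcal L_2$ (which consists of the transformations whose projections to the $(t,x)$-space are the transformations $( * )$) by setting $X_0=0$ and neglecting the transformation component for $b$. The class $\widehat{\mathcal L}_2$ is uniformly semi-normalized with respect to linear superposition of solutions. More precisely, the equivalence groupoid of $\widehat{\mathcal L}_2$ is constituted by the triples $(\mathcal E,\tilde{\mathcal E},\mathcal T)$, where the equation-source $\mathcal E$ runs through the entire class $\widehat{\mathcal L}_2$, the transformational part $\mathcal T$ is of the form $( * )$ with the product $(\gamma t+\delta)^{r-1}X_0$ being an arbitrary solution of $\mathcal E$, and the equation-target is defined by $\tilde{\mathcal E}=\mathcal T(\mathcal E)$.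
   Context: The underlying field $\mathbb F$ is $\mathbb R$ or $\mathbb C$; all variables, functions and constants are real or complex, respectively. $x=x(t)$ is the unknown function, $x^{(k)}=d^kx/dt^k$. Everything is local: functions and transformations are smooth and considered on suitable open domains. A point transformation is a transformation $\tilde t=T(t,x)$, $\tilde x=X(t,x)$ with nonvanishing Jacobian $\partial(T,X)/\partial(t,x)$; it acts on ODEs via prolongation to derivatives. An admissible transformation of a class of ODEs is a triple $(\mathcal E,\tilde{\mathcal E},\mathcal T)$, where $\mathcal E$ and $\tilde{\mathcal E}$ are equations of the class and $\mathcal T$ (the transformational part) is a point transformation mapping $\mathcal E$ to $\tilde{\mathcal E}$. The equivalence groupoid of the class is the set of all its admissible transformations with composition. The (usual) equivalence (pseudo)group of the class consists of the point transformations in the joint space of $t$, $x$, the derivatives of $x$ and the arbitrary elements (the coefficients and right-hand side parameterizing the class) that are consistent with the contact structure (the components for derivatives are obtained by prolongation), are projectable to the $(t,x)$-space (the components for $t$ and $x$ depend only on $(t,x)$), and map every equation of the class to an equation of the class. A class of homogeneous linear ODEs of order $r$ is called uniformly semi-normalized with respect to linear superposition of solutions if the transformational part of any admissible transformation of the class can be represented as the composition of a linear superposition symmetry transformation $\tilde t=t$, $\tilde x=x+\varphi(t)$ of the source equation $\mathcal E$ ($\varphi$ a solution of $\mathcal E$) with the projection of an element of the equivalence group of the class to the $(t,x)$-space; the linear superposition symmetry groups of all the equations are of the same structure (commutative and $r$-dimensional). *)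

(* Defs.v *)
From HB Require Import structures.
From mathcomp Require Import all_boot all_order all_algebra.
From mathcomp Require Import all_classical all_reals all_analysis.
From mathcomp Require Import complex.

Set Implicit Arguments.
Unset Strict Implicit.
Unset Printing Implicit Defensive.

Import Order.TTheory GRing.Theory Num.Theory.
Import numFieldNormedType.Exports.

Local Open Scope classical_set_scope.
Local Open Scope ring_scope.
Local Open Scope complex_scope.

Inductive real_or_complex (R : realType) : numFieldType -> Prop :=
| ground_real : real_or_complex R R
| ground_complex : real_or_complex R R[i].

(* Differentiability is over K: for K = R the following is C^oo on the open
   set A, for K = R[i] it is holomorphy. *)
Fixpoint differentiable_upto (K : numFieldType) (V W : normedModType K)
    (n : nat) (A : set V) (f : V -> W) : Prop :=
  if n is m.+1 then
    (forall z, A z -> differentiable f z) /\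
    (forall v, differentiable_upto m A ('D_v f))
  else True.

Definition smooth_on (K : numFieldType) (V W : normedModType K)
    (A : set V) (f : V -> W) : Prop :=
  forall n, differentiable_upto n A f.

Section JetSpace.
Variable K : numFieldType.

(* A point (t, x, x', x'', ...) of the jet space is given by t : K and
   u : nat -> K with u k the coordinate x^(k); a function of order n depends
   on u 0, ..., u n only. *)
Definition jet_function := K -> (nat -> K) -> K.

Definition set_coord (u : nat -> K) (i : nat) (s : K) : nat -> K :=
  fun j => if j == i then s else u j.

Definition partial_t (F : jet_function) : jet_function :=
  fun t u => derive1 (fun s => F s u) t.

Definition partial_u (i : nat) (F : jet_function) : jet_function :=
  fun t u => derive1 (fun s => F t (set_coord u i s)) (u i).

(* D_t F, for F of order n. *)
Definition total_derivative (n : nat) (F : jet_function) : jet_function :=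
  fun t u =>
    partial_t F t u + \sum_(i < n.+1) u i.+1 * partial_u i F t u.

Definition lift_jet (f : K * K -> K) : jet_function := fun t u => f (t, u 0%N).

(* The component for x^(k) of the prolongation of (T, X):
   X^(0) = X,  X^(k+1) = D_t X^(k) / D_t T. *)
Fixpoint prolong (T X : K * K -> K) (k : nat) : jet_function :=
  if k is m.+1 then
    fun t u => total_derivative m (prolong T X m) t u /
               total_derivative 0 (lift_jet T) t u
  else lift_jet X.

(* Domains in the (t, x)-space.  Connectedness of the sections at constant t
   makes a function on the domain that is locally independent of x a function
   of t on the projection. *)
Definition local_domain (A : set (K * K)) : Prop :=
  [/\ A !=set0, open A, connected A &
      forall t, connected [set x | A (t, x)]].

Record transformation := Transformation {
  tr_dom : set (K * K);
  tr_t : K * K -> K;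
  tr_x : K * K -> K;
  tr_domP : local_domain tr_dom }.

Definition t_range (tau : transformation) : set K := fst @` tr_dom tau.

Definition jacobian (T X : K * K -> K) (z : K * K) : K :=
  'D_(1, 0) T z * 'D_(0, 1) X z - 'D_(0, 1) T z * 'D_(1, 0) X z.

Definition point_transformation (tau : transformation) : Prop :=
  [/\ smooth_on (tr_dom tau) (tr_t tau),
      smooth_on (tr_dom tau) (tr_x tau) &
      forall z, tr_dom tau z -> jacobian (tr_t tau) (tr_x tau) z != 0].

Definition regular_jet (tau : transformation) (t : K) (u : nat -> K) : Prop :=
  tr_dom tau (t, u 0%N) /\ total_derivative 0 (lift_jet (tr_t tau)) t u != 0.

End JetSpace.

(* A class of ODEs of order r is given by res : (nat -> K) -> P -> K: the
   equation with arbitrary elements p = p(t) is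
   res (x, x', x'', ...) (p t) = 0, where res u depends on u 0, ..., u r only
   and P is the space of values of the arbitrary elements. *)
Section Classes.
Variables (K : numFieldType) (P : normedModType K).

Record equation := Equation {
  eq_dom : set K;
  eq_par : K -> P;
  eq_dom_open : open eq_dom;
  eq_par_smooth : smooth_on eq_dom eq_par }.

Variables (r : nat) (res : (nat -> K) -> P -> K).

Definition solution (E : equation) (W : set K) (phi : K -> K) : Prop :=
  smooth_on W phi /\
  forall t, W t -> res (fun k => derive1n k phi t) (eq_par E t) = 0.

(* Over the part of its domain where E is defined, the prolongation of tau maps
   the manifold of E in the r-th order jet space to the manifold of E'. *)
Definition maps_equation (tau : transformation K) (E E' : equation) : Prop :=
  forall t u, eq_dom E t -> regular_jet tau t u ->
    eq_dom E' (tr_t tau (t, u 0%N)) /\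
    (res u (eq_par E t) = 0 <->
     res (fun k => prolong (tr_t tau) (tr_x tau) k t u)
         (eq_par E' (tr_t tau (t, u 0%N))) = 0).

Definition over_domain (tau : transformation K) (E : equation) : Prop :=
  t_range tau `<=` eq_dom E.

(* (E, E', tau) belongs to the equivalence groupoid of the class. *)
Definition admissible (E E' : equation) (tau : transformation K) : Prop :=
  [/\ point_transformation tau, over_domain tau E & maps_equation tau E E'].

(* The joint space of t, (x, x', ..., x^(r)) and the arbitrary elements. *)
Definition joint := (K * 'rV[K]_r.+1 * P)%type.

Definition joint_point (t : K) (u : nat -> K) (p : P) : joint :=
  (t, \row_(i < r.+1) u i, p).

Definition joint_domain (tau : transformation K) : set joint :=
  [set z : joint | regular_jet tau z.1.1 (fun i => z.1.2 0 (inord i))].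

(* An element of the equivalence group is given by its projection tau to the
   (t, x)-space and its components A for the arbitrary elements; those for the
   derivatives are the prolongation of tau.  As (t, x, x', ..., x^(r)) is
   mapped independently of the arbitrary elements, the Jacobian matrix on the
   joint space is block triangular, and invertibility amounts to that of tau
   and of A with respect to the arbitrary elements. *)
Definition equivalence_transformation
    (tau : transformation K) (A : joint -> P) : Prop :=
  [/\ point_transformation tau,
      smooth_on (joint_domain tau) A,
      (forall z, joint_domain tau z ->
         forall v : P, v != 0 -> 'D_((0, 0, v) : joint) A z != 0) &
      forall E, exists E', maps_equation tau E E' /\
        forall t u, eq_dom E t -> regular_jet tau t u ->
          eq_par E' (tr_t tau (t, u 0%N)) = A (joint_point t u (eq_par E t))].

Definition superposition (phi : K -> K) (z : K * K) : K * K :=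
  (z.1, z.2 + phi z.1).

Definition semi_normalized : Prop :=
  forall E E' tau, admissible E E' tau ->
    exists phi sigma A,
      [/\ solution E (t_range tau) phi,
          equivalence_transformation sigma A &
          forall z, tr_dom tau z ->
            [/\ tr_dom sigma (superposition phi z),
                tr_t tau z = tr_t sigma (superposition phi z) &
                tr_x tau z = tr_x sigma (superposition phi z)]].

(* Near every point of the domain of an equation, its linear superposition
   symmetries form a commutative group with parameterization
   c |-> superposition (\sum_i c_i f_i), c in K^r. *)
Definition uniform_superposition_groups : Prop :=
  forall (E : equation) (t0 : K), eq_dom E t0 ->
    exists W : set K,
      [/\ open W, connected W, W t0, W `<=` eq_dom E &
      exists f : 'I_r -> K -> K,
        [/\ forall c : 'rV[K]_r,
              solution E W (fun t => \sum_i c 0 i * f i t),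
            forall phi, solution E W phi ->
              exists! c : 'rV[K]_r, forall z, W z.1 ->
                superposition phi z =
                superposition (fun t => \sum_i c 0 i * f i t) z &
            forall c d : 'rV[K]_r, forall z, W z.1 ->
              let g (e : 'rV[K]_r) :=
                superposition (fun t => \sum_i e 0 i * f i t) in
              g c (g d z) = g (c + d) z /\ g c (g d z) = g d (g c z)]].

Definition uniformly_semi_normalized : Prop :=
  semi_normalized /\ uniform_superposition_groups.

End Classes.

(* x^(r) + a_(r-3) x^(r-3) + ... + a_0 x, with a_k = a 0 k. *)
Definition laguerre_forsyth_hom (K : numFieldType) (r : nat)
    (u : nat -> K) (a : 'rV[K]_(r - 2)) : K :=
  u r + \sum_(k < r - 2) a 0 k * u k.

(* The same minus b; the arbitrary elements are the pair (a, b). *)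
Definition laguerre_forsyth (K : numFieldType) (r : nat)
    (u : nat -> K) (p : 'rV[K]_(r - 2) * K) : K :=
  laguerre_forsyth_hom u p.1 - p.2.

Definition moebius_form (K : numFieldType) (r : nat) (tau : transformation K)
    (alpha beta gamma delta C : K) (X0 : K -> K) : Prop :=
  [/\ alpha * delta - beta * gamma != 0, C != 0, smooth_on (t_range tau) X0 &
      forall t x, tr_dom tau (t, x) ->
        [/\ gamma * t + delta != 0,
            tr_t tau (t, x) = (alpha * t + beta) / (gamma * t + delta) &
            tr_x tau (t, x) = C / (gamma * t + delta) ^+ r.-1 * x + X0 t]].

(* Main.v *)
Require Import Defs.
From HB Require Import structures.
From mathcomp Require Import all_boot all_order all_algebra.
From mathcomp Require Import all_classical all_reals all_analysis.
From mathcomp Require Import complex ring lra.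

Set Implicit Arguments.
Unset Strict Implicit.
Unset Printing Implicit Defensive.

Import Order.TTheory GRing.Theory Num.Theory.
Import numFieldNormedType.Exports.

Local Open Scope classical_set_scope.
Local Open Scope ring_scope.

(* A transformation mapping one linear equation without x^(r-1) and x^(r-2) to
   another is first shown to have the form T = T0(t), X = X1(t) x + X0(t): on the
   source equation the component P_r of the prolongation does not depend on
   x^(r-1), and differentiating this with respect to x'' and x' gives T_x = 0 and
   X_xx = 0.  Then P_k is affine in the derivatives of x, and the coefficients of
   x^(r-1) and x^(r-2) in P_r vanish iff X1'/X1 = (r-1)/2 h and h' = h^2/2, where
   h = T0''/T0'; the second equation says that T0 has vanishing Schwarzian, so
   T0 is Moebius, and the first gives X1.  Conversely, for such T0 and X1 no
   derivative of order less than r enters the x-part of P_r, so the target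
   equation is obtained by a triangular linear system.  Writing X0 = X1 phi, the
   target is homogeneous iff phi solves the source equation. *)

(** * Smooth functions *)

(** The ground field is only known to be R or C, so the analysis is rebuilt from what both share: a
    complete absolute value with values in R. A mean value inequality replaces Rolle's theorem,
    which fails for complex values, and primitives on discs are limits of Riemann sums. They yield
    local existence and uniqueness for linear equations, on which the r-dimensional superposition
    groups rest. A transformation need not preserve the fibres a priori, so D_t T may involve x' and
    vanish: jet computations are confined to regular jets. The arguments for T_x = 0 and X_xx = 0
    compare jets over one point (t, x), because T(t, x), and with it the target coefficients, may
    still vary with x. Connected sections turn T_x = 0 into a function T0 of t alone, and the
    connected domain gives one Moebius map on its whole range. In the equivalence group of the
    homogeneous class X0 = 0, because its elements must serve all equations at once, and no nonzero
    function solves both x^(r) = 0 and x^(r) + x = 0. *)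

Section Smooth.
Variable K : numFieldType.
Implicit Types V W : normedModType K.

(** The little-o expansion at [a] only sees values near [a], so the differential of [f] serves for
    [g]. *)
Lemma near_eq_differentiable V W (f g : V -> W) (a : V) :
  {near a, f =1 g} -> differentiable f a -> differentiable g a.
Proof.
move=> fg df; have dfc := diff_continuous df.
have E : g \o shift a = cst (g a) + 'd f a +o_ 0 id.
  apply/eqaddoP => e e0.
  have /eqaddoP/(_ e e0) Hf := diff_locally df.
  have fg0 : \forall h \near (0 : V), f (h + a) = g (h + a).
    by move: fg; rewrite [X in X -> _](near_shift 0 a) => /filterS; apply => h /=; rewrite subr0.
  near=> h.
  have fgh : f (h + a) = g (h + a) by near: h.
  have : `|(f \o shift a - (cst (f a) + 'd f a)) h| <= e * `|h| by near: h.
  by rewrite !fctE /= fgh (nbhs_singleton fg).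
apply/diff_locallyP; rewrite (diff_unique dfc E); split => //.
Unshelve. all: by end_near. Qed.

Lemma near_open V (A : set V) (P : V -> Prop) a :
  open A -> A a -> (forall z, A z -> P z) -> \forall z \near a, P z.
Proof.
move=> oA Aa AP; apply: filterS (open_nbhs_nbhs (conj oA Aa)) => z; exact: AP.
Qed.

(** ['D_v f] is a function on the whole space, and openness of [A] is what makes the derivatives of
    [f] and [g] agree on [A]. The closure lemmas below rest on this: each replaces a derivative by a
    formula valid on [A]. *)
Lemma upto_eq V W n (A : set V) (f g : V -> W) : open A ->
  (forall z, A z -> f z = g z) ->
  differentiable_upto n A f -> differentiable_upto n A g.
Proof.
elim: n f g => [//|n IH] f g oA fg /= [df Df]; split => [z Az|v].
  by apply: near_eq_differentiable (df z Az); exact: near_open Az fg.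
apply: IH (Df v) => // z Az; apply: near_eq_derive; exact: near_open Az fg.
Qed.

Lemma upto_sub V W n (A B : set V) (f : V -> W) : A `<=` B ->
  differentiable_upto n B f -> differentiable_upto n A f.
Proof.
elim: n f => [//|n IH] f AB /= [df Df]; split => [z Az|v].
  exact/df/AB.
exact: IH.
Qed.

Lemma upto_ltn V W n (A : set V) (f : V -> W) :
  differentiable_upto n.+1 A f -> differentiable_upto n A f.
Proof.
elim: n f => [//|n IH] f [df Df]; split => // v; exact/IH/Df.
Qed.

Lemma upto_cst V W n (A : set V) (a : W) :
  differentiable_upto n A (fun _ : V => a).
Proof.
elim: n a => [//|n IH] a /=; split => [z _|v]; first exact: differentiable_cst.
rewrite (_ : 'D_v _ = fun=> 0) //.
by apply/funext => z; rewrite derive_cst.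
Qed.

Lemma upto_add V W n (A : set V) (f g : V -> W) : open A ->
  differentiable_upto n A f -> differentiable_upto n A g ->
  differentiable_upto n A (fun z => f z + g z).
Proof.
elim: n f g => [//|n IH] f g oA /= [df Df] [dg Dg]; split => [z Az|v].
  by apply: differentiableD; [exact: df|exact: dg].
apply: upto_eq (IH _ _ oA (Df v) (Dg v)) => // z Az.
by rewrite [RHS]deriveD //; apply: diff_derivable; [exact: df|exact: dg].
Qed.

Lemma upto_mul V n (A : set V) (f g : V -> K) : open A ->
  differentiable_upto n A f -> differentiable_upto n A g ->
  differentiable_upto n A (fun z => f z * g z).
Proof.
elim: n f g => [//|n IH] f g oA sf sg.
have [sf' sg'] := (upto_ltn sf, upto_ltn sg).
case: sf sg => [df Df] [dg Dg]; split => [z Az|v].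
  by apply: differentiableM; [exact: df|exact: dg].
apply: upto_eq (upto_add oA (IH _ _ oA sf' (Dg v)) (IH _ _ oA sg' (Df v))) => // z Az.
by rewrite [RHS]deriveM //; apply: diff_derivable; [exact: df|exact: dg].
Qed.

Lemma upto_inv V n (A : set V) (f : V -> K) : open A ->
  (forall z, A z -> f z != 0) ->
  differentiable_upto n A f -> differentiable_upto n A (fun z => (f z)^-1).
Proof.
(* [f] stays fixed: the derivative of 1/f is -(1/f)^2 f', which involves 1/f itself one order
   lower. *)
move=> oA f0; elim: n => [//|n IH] sf; have sf' := IH (upto_ltn sf).
case: sf => [df Df]; split => [z Az|v].
  apply: differentiableV; [exact: df|exact: f0].
have N1 := upto_cst n A (-1 : K).
apply: upto_eq (upto_mul oA N1 (upto_mul oA (upto_mul oA sf' sf') (Df v))) => // z Az.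
rewrite [RHS]deriveV ?f0 //; last by apply: diff_derivable; exact: df.
by rewrite mulN1r scaleNr -expr2 exprVn.
Qed.

Lemma upto_linl V W W' n (A : set V) (f : V -> W) (L : {linear W -> W'}) :
  open A -> continuous L ->
  differentiable_upto n A f -> differentiable_upto n A (fun z => L (f z)).
Proof.
move=> oA Lc; elim: n f => [//|n IH] f /= [df Df].
have dLf z : A z -> differentiable (L \o f) z.
  by move=> Az; apply: differentiable_comp; [exact: df|exact: linear_differentiable].
split=> [//|v]; apply: upto_eq (IH _ (Df v)) => // z Az.
rewrite [RHS](deriveE _ (dLf z Az)) diff_comp //; last first.
- exact: linear_differentiable.
- exact: df.
by rewrite (diff_lin _ Lc) /= -deriveE //; exact: df.
Qed.

(** The derivative of the composite along [v] is the composite of the derivative of [f] along [L v],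
    so the affine map is fixed and the induction runs over [f]. *)
Lemma upto_affr V V' W n (A : set V) (B : set V') (f : V -> W)
    (L : {linear V' -> V}) (b : V) :
  open A -> open B -> continuous L -> (forall z, B z -> A (L z + b)) ->
  differentiable_upto n A f -> differentiable_upto n B (fun z => f (L z + b)).
Proof.
move=> oA oB Lc BA; elim: n f => [//|n IH] f /= [df Df].
have dL z : differentiable (fun z => L z + b) z.
  apply: differentiableD; last exact: differentiable_cst.
  exact: linear_differentiable.
have dLf z : B z -> differentiable (f \o (fun z => L z + b)) z.
  by move=> Bz; apply: differentiable_comp; [exact: dL|exact/df/BA].
split=> [//|v]; apply: upto_eq (IH _ (Df (L v))) => // z Bz.
rewrite [RHS](deriveE _ (dLf z Bz)) diff_comp //; last exact/df/BA.
rewrite /= deriveE; last exact/df/BA.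
congr (_ _).
have -> : (fun z => L z + b) = (L : V' -> V) + cst b by [].
rewrite diffD ?diff_cst ?(diff_lin _ Lc); last exact: differentiable_cst.
  by rewrite /= addr0.
exact: linear_differentiable.
Qed.

Lemma upto_comp1 V n (A : set V) (B : set K) (f : V -> K) (g : K -> K) :
  open A -> open B -> (forall z, A z -> B (f z)) ->
  differentiable_upto n A f -> differentiable_upto n B g ->
  differentiable_upto n A (fun z => g (f z)).
Proof.
move=> oA oB AB; elim: n g => [//|n IH] g sf sg.
have sf' := upto_ltn sf.
case: sf sg => [df Df] [dg Dg].
have dgf z : A z -> differentiable (g \o f) z.
  by move=> Az; apply: differentiable_comp; [exact: df|exact/dg/AB].
split=> [//|v]; apply: upto_eq (upto_mul oA (Df v) (IH _ sf' (Dg 1))) => // z Az.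
rewrite [RHS](deriveE _ (dgf z Az)) diff_comp //; last exact/dg/AB.
  rewrite /= !deriveE; [|exact/dg/AB|exact: df].
  by rewrite -[in RHS](mulr1 ('d f z v)) -[_ * 1]/(_ *: 1) linearZ.
exact: df.
Qed.

Lemma upto_id n (A : set K) : differentiable_upto n A (fun t : K => t).
Proof.
case: n => [//|n] /=; split=> [z _|v]; first exact: ex_diff.
rewrite (_ : 'D_v _ = fun=> v); first exact: upto_cst.
by apply/funext => z; rewrite derive_id.
Qed.

Lemma upto_lin V W n (A : set V) (L : {linear V -> W}) : continuous L ->
  differentiable_upto n A L.
Proof.
move=> Lc; case: n => [//|n] /=; split=> [z _|v]; first exact: linear_differentiable.
rewrite (_ : 'D_v _ = fun=> L v); first exact: upto_cst.
apply/funext => z; rewrite deriveE; last exact: linear_differentiable.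
by rewrite diff_lin.
Qed.

Lemma upto_sum V W n (A : set V) I (s : seq I) (f : I -> V -> W) : open A ->
  (forall i, differentiable_upto n A (f i)) ->
  differentiable_upto n A (fun z => \sum_(i <- s) f i z).
Proof.
move=> oA fP; elim: s => [|i s IH].
  by apply: upto_eq (upto_cst n A (0 : W)) => // z _; rewrite big_nil.
by apply: upto_eq (upto_add oA (fP i) IH) => // z _; rewrite big_cons.
Qed.

Lemma upto_prod V n (A : set V) I (s : seq I) (f : I -> V -> K) : open A ->
  (forall i, differentiable_upto n A (f i)) ->
  differentiable_upto n A (fun z => \prod_(i <- s) f i z).
Proof.
move=> oA fP; elim: s => [|i s IH].
  by apply: upto_eq (upto_cst n A (1 : K)) => // z _; rewrite big_nil.
by apply: upto_eq (upto_mul oA (fP i) IH) => // z _; rewrite big_cons.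
Qed.

Lemma upto_exp V n (A : set V) (f : V -> K) k : open A ->
  differentiable_upto n A f -> differentiable_upto n A (fun z => f z ^+ k).
Proof.
move=> oA fP; elim: k => [|k IH].
  exact: upto_cst.
by apply: upto_eq (upto_mul oA fP IH) => // z _; rewrite exprS.
Qed.

Lemma upto_opp V n (A : set V) (f : V -> K) : open A ->
  differentiable_upto n A f -> differentiable_upto n A (fun z => - f z).
Proof.
move=> oA fP; apply: upto_eq (upto_mul oA (upto_cst n A (-1 : K)) fP) => // z _.
by rewrite mulN1r.
Qed.

Lemma upto_scalel V W n (A : set V) (f : V -> K) (w : W) : open A ->
  differentiable_upto n A f -> differentiable_upto n A (fun z => f z *: w).
Proof.
move=> oA fP.
have sx_lin : linear ( *:%R ^~ w : K -> W).
  by move=> u y z; rewrite scalerDl scalerA.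
pose sxlM := GRing.isLinear.Build _ _ _ _ _ sx_lin.
pose sxL : {linear K -> W} := HB.pack ( *:%R ^~ w) sxlM.
exact: (@upto_linl _ _ _ _ _ _ sxL oA (@scalel_continuous _ _ w) fP).
Qed.

Lemma upto_row V m n (A : set V) (f : V -> 'rV[K]_m) : open A ->
  (forall j, differentiable_upto n A (fun z => f z 0 j)) ->
  differentiable_upto n A f.
Proof.
move=> oA fP.
apply: upto_eq (upto_sum (index_enum _) oA
  (fun j => upto_scalel (delta_mx 0 j) oA (fP j))) => // z _.
by rewrite [RHS]row_sum_delta.
Qed.

Lemma coord_linear_upto V m n (A : set V) (f : V -> 'rV[K]_m) j : open A ->
  differentiable_upto n A f -> differentiable_upto n A (fun z => f z 0 j).
Proof.
move=> oA fP.
have sx_lin : linear (fun N : 'rV[K]_m => N 0 j : K).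
  by move=> u y z; rewrite !mxE.
pose sxlM := GRing.isLinear.Build _ _ _ _ _ sx_lin.
pose sxL : {linear 'rV[K]_m -> K} := HB.pack (fun N : 'rV[K]_m => N 0 j : K) sxlM.
exact: (@upto_linl _ _ _ _ _ _ sxL oA (@coord_continuous _ _ _ 0 j) fP).
Qed.

Lemma upto_fst V W W' n (A : set V) (f : V -> W * W') : open A ->
  differentiable_upto n A f -> differentiable_upto n A (fun z => (f z).1).
Proof.
move=> oA; apply: (upto_linl (L := [the {linear _ -> _} of @fst W W'])) => //.
by move=> z; exact: cvg_fst.
Qed.

Lemma upto_snd V W W' n (A : set V) (f : V -> W * W') : open A ->
  differentiable_upto n A f -> differentiable_upto n A (fun z => (f z).2).
Proof.
move=> oA; apply: (upto_linl (L := [the {linear _ -> _} of @snd W W'])) => //.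
by move=> z; exact: cvg_snd.
Qed.

Lemma upto_idV V n (A : set V) : differentiable_upto n A (fun z : V => z).
apply: (upto_lin n A (L := [the {linear _ -> _} of @idfun V])) => z; exact: cvg_id.
Qed.

Lemma upto_pair V W W' n (A : set V) (f : V -> W) (g : V -> W') : open A ->
  differentiable_upto n A f -> differentiable_upto n A g ->
  differentiable_upto n A (fun z => (f z, g z)).
Proof.
elim: n f g => [//|n IH] f g oA /= [df Df] [dg Dg]; split => [z Az|v].
  by apply: differentiable_pair; [exact: df|exact: dg].
apply: upto_eq (IH _ _ oA (Df v) (Dg v)) => // z Az.
have [dfz dgz] := (df z Az, dg z Az).
by rewrite !deriveE ?diff_pair //; exact: differentiable_pair.
Qed.

End Smooth.

(** * Formal jet functions *)

(* The partial derivatives are sealed, for unification and [ring] would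
   otherwise compare them by unfolding limits. *)
Fact pdt_key (K : numFieldType) (f : K * K -> K) : {g | g = 'D_(1, 0) f}.
Proof. by exists ('D_(1, 0) f). Qed.
Definition pdt (K : numFieldType) (f : K * K -> K) := sval (pdt_key f).
Lemma pdtE (K : numFieldType) (f : K * K -> K) : pdt f = 'D_(1, 0) f.
Proof. exact: (svalP (pdt_key f)). Qed.

Fact pdx_key (K : numFieldType) (f : K * K -> K) : {g | g = 'D_(0, 1) f}.
Proof. by exists ('D_(0, 1) f). Qed.
Definition pdx (K : numFieldType) (f : K * K -> K) := sval (pdx_key f).
Lemma pdxE (K : numFieldType) (f : K * K -> K) : pdx f = 'D_(0, 1) f.
Proof. exact: (svalP (pdx_key f)). Qed.

Section Jets.
Variable K : numFieldType.

(* Jet functions as syntax: partial and total derivatives become operations on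
   expressions whose commutation relations follow by induction, so no symmetry
   of second derivatives is needed. *)
Inductive jexpr : Type :=
| JFun of (K * K -> K)
| JVar of nat
| JAdd of jexpr & jexpr
| JMul of jexpr & jexpr
| JInv of jexpr.

Fixpoint jeval (e : jexpr) (t : K) (u : nat -> K) : K :=
  match e with
  | JFun f => f (t, u 0%N)
  | JVar i => u i
  | JAdd e1 e2 => jeval e1 t u + jeval e2 t u
  | JMul e1 e2 => jeval e1 t u * jeval e2 t u
  | JInv e => (jeval e t u)^-1
  end.

Fixpoint jorder (N : nat) (e : jexpr) : bool :=
  match e with
  | JFun _ => true
  | JVar i => (i <= N)%N
  | JAdd e1 e2 | JMul e1 e2 => jorder N e1 && jorder N e2
  | JInv e => jorder N e
  end.

Definition jcst (c : K) := JFun (fun=> c).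

Section Derivation.
Variables (dF : (K * K -> K) -> jexpr) (dV : nat -> jexpr).

Fixpoint jder (e : jexpr) : jexpr :=
  match e with
  | JFun f => dF f
  | JVar i => dV i
  | JAdd e1 e2 => JAdd (jder e1) (jder e2)
  | JMul e1 e2 => JAdd (JMul (jder e1) e2) (JMul e1 (jder e2))
  | JInv e => JMul (jcst (-1)) (JMul (jder e) (JMul (JInv e) (JInv e)))
  end.
End Derivation.

(** Derivative in the direction with component [a] along t and [b i] along x^(i). For D_t, whose
    direction depends on the jet, see [jtotE]. *)
Definition jdir (a : K) (b : nat -> K) : jexpr -> jexpr :=
  jder (fun f => JAdd (JMul (jcst a) (JFun (pdt f)))
                      (JMul (jcst (b 0%N)) (JFun (pdx f))))
       (fun i => jcst (b i)).

(* [jdt], [jdu i] and [jtot] are d/dt, d/du_i and D_t. *)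
Definition jdt := jdir 1 (fun=> 0).

Fact jdu_key : {d : nat -> jexpr -> jexpr |
  d = fun i => jdir 0 (fun j => (i == j)%:R)}.
Proof. by eexists. Qed.
Definition jdu := sval jdu_key.
Lemma jdu_def : jdu = fun i => jdir 0 (fun j => (i == j)%:R).
Proof. exact: (svalP jdu_key). Qed.

Fact jtot_key : {d : jexpr -> jexpr |
  d = jder (fun f => JAdd (JFun (pdt f)) (JMul (JVar 1) (JFun (pdx f))))
           (fun i => JVar i.+1)}.
Proof. by eexists. Qed.
Definition jtot := sval jtot_key.
Lemma jtot_def :
  jtot = jder (fun f => JAdd (JFun (pdt f)) (JMul (JVar 1) (JFun (pdx f))))
              (fun i => JVar i.+1).
Proof. exact: (svalP jtot_key). Qed.

Lemma jorder_leq M N e : (M <= N)%N -> jorder M e -> jorder N e.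
Proof.
move=> MN; elim: e => //= [i /leq_trans|e1 H1 e2 H2 /andP[] |e1 H1 e2 H2 /andP[]].
- exact.
- by move=> /H1 -> /H2.
- by move=> /H1 -> /H2.
Qed.

Lemma jorder_dir N a b e : jorder N e -> jorder N (jdir a b e).
Proof.
elim: e => //= [e1 H1 e2 H2 /andP[/H1 h1 /H2 h2]
               |e1 H1 e2 H2 /andP[q1 q2] |e H o].
- by rewrite h1 h2.
- by rewrite q1 q2 H1 ?H2.
- by rewrite o H.
Qed.

Lemma jorder_tot N e : jorder N e -> jorder N.+1 (jtot e).
Proof.
rewrite jtot_def; have up e0 : jorder N e0 -> jorder N.+1 e0 by exact: jorder_leq.
elim: e => //= [e1 H1 e2 H2 /andP[/H1 h1 /H2 h2]
               |e1 H1 e2 H2 /andP[q1 q2] |e H o].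
- by rewrite h1 h2.
- by rewrite (up _ q1) (up _ q2) H1 ?H2.
- by rewrite (up _ o) H.
Qed.

(** At a given jet, D_t is the derivative in the direction (1, x', x'', ...); what is proved for
    fixed directions thus carries over to D_t. *)
Lemma jtotE e t u : jeval (jtot e) t u = jeval (jdir 1 (fun i => u i.+1) e) t u.
Proof.
rewrite jtot_def; elim: e => [f|i|e1 H1 e2 H2|e1 H1 e2 H2|e H] //=.
- by rewrite mul1r.
- by rewrite H1 H2.
- by rewrite H1 H2.
- by rewrite H.
Qed.

Lemma jdirE N a b e t u : jorder N e ->
  jeval (jdir a b e) t u =
  a * jeval (jdt e) t u + \sum_(i < N.+1) b i * jeval (jdu i e) t u.
Proof.
rewrite jdu_def; elim: e => [f|i|e1 H1 e2 H2|e1 H1 e2 H2|e H] /=.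
- move=> _; rewrite mul1r mul0r addr0 big_ord_recl /= mul0r add0r mul1r.
  by rewrite big1 ?addr0 // => i _; rewrite !mul0r add0r mulr0.
- move=> iN; rewrite mulr0 add0r.
  have iN' : (i < N.+1)%N by [].
  rewrite (bigD1 (Ordinal iN')) //= eqxx mulr1 big1 ?addr0 // => j ji.
  by rewrite (_ : (_ == i) = false) ?mulr0 //; apply/negbTE.
- move=> /andP[/H1 -> /H2 ->].
  by under [in RHS]eq_bigr do rewrite mulrDr; rewrite big_split /=; ring.
- move=> /andP[/H1 -> /H2 ->].
  set x1 := jeval e1 t u; set x2 := jeval e2 t u.
  rewrite [X in _ = _ + X](_ : _ =
      (\sum_(i < N.+1) b i * jeval (jdir 0 (fun j => (i == j :> nat)%:R) e1) t u) * x2 +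
      x1 * \sum_(i < N.+1) b i * jeval (jdir 0 (fun j => (i == j :> nat)%:R) e2) t u).
    by rewrite /jdt /jdir; ring.
  by rewrite mulr_suml mulr_sumr -big_split; apply: eq_bigr => i _ /=;
    rewrite /jdir; ring.
- move=> /H ->; set y := (jeval e t u)^-1.
  rewrite [X in _ = _ + X](_ : _ =
      (\sum_(i < N.+1) b i * jeval (jdir 0 (fun j => (i == j :> nat)%:R) e) t u) * (- (y * y))).
    by rewrite /jdt /jdir; ring.
  by rewrite mulr_suml; apply: eq_bigr => i _ /=; rewrite /jdir; ring.
Qed.

Lemma jdu_order N i e t u : jorder N e -> (N < i)%N -> jeval (jdu i e) t u = 0.
Proof.
move=> oe Ni; rewrite [in LHS]jdu_def (jdirE _ _ t u oe) mul0r add0r big1 // => j _.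
rewrite (_ : (i == j :> nat) = false) ?mul0r //; apply/negbTE.
by rewrite eq_sym neq_ltn (leq_trans (ltn_ord j)).
Qed.

(* A commutator of derivations is a derivation, so it is determined by its
   values on the generators. *)
Lemma jder_comm dF1 dV1 dF2 dV2 dF3 dV3 :
  let d1 := jder dF1 dV1 in let d2 := jder dF2 dV2 in let d3 := jder dF3 dV3 in
  (forall f t u, jeval (d1 (dF2 f)) t u =
     jeval (d2 (dF1 f)) t u + jeval (dF3 f) t u) ->
  (forall i t u, jeval (d1 (dV2 i)) t u =
     jeval (d2 (dV1 i)) t u + jeval (dV3 i) t u) ->
  (forall c t u, jeval (dF1 (fun=> c)) t u = 0) ->
  (forall c t u, jeval (dF2 (fun=> c)) t u = 0) ->
  forall e t u, jeval (d1 (d2 e)) t u = jeval (d2 (d1 e)) t u + jeval (d3 e) t u.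
Proof.
move=> d1 d2 d3 HF HV c1 c2 e t u.
elim: e => [f|i|e1 H1 e2 H2|e1 H1 e2 H2|e H] //=.
- by rewrite H1 H2; ring.
- by rewrite H1 H2; ring.
- by rewrite H c1 c2; ring.
Qed.

Lemma pdt_cst (c : K) z : pdt (fun=> c) z = 0.
Proof. by rewrite pdtE; exact: derive_cst. Qed.

Lemma pdx_cst (c : K) z : pdx (fun=> c) z = 0.
Proof. by rewrite pdxE; exact: derive_cst. Qed.

(** The commutator comes from the summand u_(i+1) d/du_i of D_t. The analogue for d/du_0 would
    require [pdt] and [pdx] to commute, so the index is a successor. *)
Lemma jdu_tot i e t u :
  jeval (jdu i.+1 (jtot e)) t u = jeval (jtot (jdu i.+1 e)) t u + jeval (jdu i e) t u.
Proof.
rewrite jdu_def jtot_def; apply: jder_comm => {e t u} [f|j|c|c] t u /=.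
- by rewrite ?pdt_cst ?pdx_cst; case: i => [|i] /=; ring.
- by rewrite ?pdt_cst ?pdx_cst eqSS; ring.
- by rewrite ?pdt_cst ?pdx_cst; ring.
- by rewrite ?pdt_cst ?pdx_cst; ring.
Qed.

Lemma jdu_comm i j e t u : (0 < i)%N -> (0 < j)%N ->
  jeval (jdu i (jdu j e)) t u = jeval (jdu j (jdu i e)) t u.
Proof.
move=> i0 j0; suff -> : jeval (jdu i (jdu j e)) t u =
  jeval (jdu j (jdu i e)) t u + jeval (jdir 0 (fun=> 0) e) t u.
  by rewrite (_ : jeval (jdir 0 _ e) t u = 0) ?addr0 //;
    elim: e => [f|k|e1 H1 e2 H2|e1 H1 e2 H2|e H] /=; rewrite ?H ?H1 ?H2; ring.
rewrite jdu_def; apply: jder_comm => {e t u} [f|k|c|c] t u /=.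
- rewrite (gtn_eqF i0) (gtn_eqF j0) ?pdt_cst ?pdx_cst; ring.
- rewrite ?pdt_cst ?pdx_cst; ring.
- rewrite ?pdt_cst ?pdx_cst; ring.
- rewrite ?pdt_cst ?pdx_cst; ring.
Qed.

Lemma jevalI (e : jexpr) t u : jeval (JInv e) t u = (jeval e t u)^-1.
Proof. by []. Qed.

Lemma jduM i (e1 e2 : jexpr) t u : jeval (jdu i (JMul e1 e2)) t u =
  jeval (jdu i e1) t u * jeval e2 t u + jeval e1 t u * jeval (jdu i e2) t u.
Proof. by rewrite jdu_def. Qed.

Lemma jduA i (e1 e2 : jexpr) t u : jeval (jdu i (JAdd e1 e2)) t u =
  jeval (jdu i e1) t u + jeval (jdu i e2) t u.
Proof. by rewrite jdu_def. Qed.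

Lemma jduI i (e : jexpr) t u : jeval (jdu i (JInv e)) t u =
  - (jeval (jdu i e) t u * (jeval e t u)^-1 ^+ 2).
Proof. by rewrite jdu_def /= -/(jdir _ _ e); ring. Qed.

Lemma jduF0 (f : K * K -> K) t u :
  jeval (jdu 0 (JFun f)) t u = pdx f (t, u 0%N).
Proof. by rewrite jdu_def /= mul0r add0r mul1r. Qed.

Lemma jduFS i (f : K * K -> K) t u : jeval (jdu i.+1 (JFun f)) t u = 0.
Proof. by rewrite jdu_def /= !mul0r add0r. Qed.

Lemma jduV i j t (u : nat -> K) : jeval (jdu i (JVar j)) t u = (i == j)%:R.
Proof. by rewrite jdu_def. Qed.

Lemma jtotF (f : K * K -> K) :
  jtot (JFun f) = JAdd (JFun (pdt f)) (JMul (JVar 1) (JFun (pdx f))).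
Proof. by rewrite jtot_def. Qed.

End Jets.

(** * Formal derivatives as derivatives along curves in the jet space *)

Section Curves.
Variable K : numFieldType.

Lemma is_derive1_cvg (V : normedModType K) (f : K -> V) (s : K) (a : V) :
  is_derive s 1 f a -> f @ s --> f s.
Proof.
by move=> [df _]; apply: differentiable_continuous; apply/derivable1_diffP.
Qed.

Lemma near_cvg_open (V : topologicalType) (A : set V) (c : K -> V) (s : K) :
  open A -> c @ s --> c s -> A (c s) -> \forall x \near s, A (c x).
Proof. by move=> oA cc Ac; apply: cc; exact: open_nbhs_nbhs. Qed.

Lemma is_derive_curve (f : K * K -> K) (x y : K -> K) (s a b : K) :
  differentiable f (x s, y s) -> is_derive s 1 x a -> is_derive s 1 y b ->
  is_derive s 1 (fun s => f (x s, y s))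
    (a * 'D_(1, 0) f (x s, y s) + b * 'D_(0, 1) f (x s, y s)).
Proof.
move=> df [dx <-] [dy <-].
have dx' : differentiable x s by apply/derivable1_diffP.
have dy' : differentiable y s by apply/derivable1_diffP.
have dp : differentiable (fun s => (x s, y s)) s by exact: differentiable_pair.
have dc : differentiable (f \o (fun s => (x s, y s))) s.
  exact: differentiable_comp.
apply: DeriveDef; first exact: diff_derivable.
rewrite [LHS](deriveE _ dc) diff_comp //= diff_pair // !deriveE //.
rewrite -[_ * 'd f _ _]/(_ *: _) -linearZ -[X in _ = _ + X]/(_ *: _) -linearZ -linearD.
congr ('d f _ _).
rewrite /= [RHS]/(_ + _) /=; congr pair.
  by rewrite -[RHS]/('d x s 1 * 1 + 'd y s 1 * 0) mulr1 mulr0 addr0.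
by rewrite -[RHS]/('d x s 1 * 0 + 'd y s 1 * 1) mulr1 mulr0 add0r.
Qed.

Lemma open_neq0 : open [set y : K | y != 0].
Proof.
rewrite (_ : [set y | _] = ~` [set 0]).
  rewrite openC; apply: accessible_closed_set1.
  exact/hausdorff_accessible/norm_hausdorff.
by apply/seteqP; split=> z /= /eqP.
Qed.

Variables (A : set (K * K)) (T : K * K -> K).
Hypotheses (oA : open A) (sT : smooth_on A T).

Definition jreg (t : K) (u : nat -> K) :=
  A (t, u 0%N) /\ jeval (jtot (JFun T)) t u != 0.

(** Conditions under which [jeval e] is differentiable along curves through regular jets;
    denominators have to be nonzero there only. *)
Fixpoint jwf (e : jexpr K) : Prop :=
  match e with
  | JFun f => smooth_on A f
  | JVar i => True
  | JAdd e1 e2 | JMul e1 e2 => jwf e1 /\ jwf e2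
  | JInv e => jwf e /\ forall t u, jreg t u -> jeval e t u != 0
  end.

Lemma smooth_D (f : K * K -> K) v : smooth_on A f -> smooth_on A ('D_v f).
Proof. by move=> sf n; have [_] := sf n.+1; apply. Qed.

Lemma smooth_pdt (f : K * K -> K) : smooth_on A f -> smooth_on A (pdt f).
Proof. by rewrite pdtE; exact: smooth_D. Qed.

Lemma smooth_pdx (f : K * K -> K) : smooth_on A f -> smooth_on A (pdx f).
Proof. by rewrite pdxE; exact: smooth_D. Qed.

Lemma smooth_cst (c : K) : smooth_on A (fun=> c).
Proof. by move=> n; apply: upto_cst. Qed.

Ltac smooth_partials := repeat first
  [assumption | simple apply smooth_pdt | simple apply smooth_pdx
  | simple apply smooth_cst].

Lemma jwf_dir a b e : jwf e -> jwf (jdir a b e).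
Proof.
elim: e => [f sf|i _|e1 H1 e2 H2 [/H1 ? /H2 ?]|e1 H1 e2 H2 [w1 w2]|e H [w e0]] //=.
- by do ?split; smooth_partials.
- exact: smooth_cst.
- by do ?split; rewrite ?w1 ?w2; (exact: H1 || exact: H2 || done).
- by do ?split => //; [exact: smooth_cst|exact: H].
Qed.

Lemma jwf_tot e : jwf e -> jwf (jtot e).
Proof.
rewrite jtot_def; elim: e => [f sf|i _|e1 H1 e2 H2 [/H1 ? /H2 ?]|e1 H1 e2 H2 [w1 w2]|e H [w e0]] //=.
- by do ?split; smooth_partials.
- by do ?split; rewrite ?w1 ?w2; (exact: H1 || exact: H2 || done).
- by do ?split => //; [exact: smooth_cst|exact: H].
Qed.

(** Chain rule. A jet is an infinite sequence, of which an expression involves finitely many terms;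
    working with curves whose coordinates are differentiable avoids any norm on sequences. *)
Lemma jeval_curve e (x : K -> K) (u : K -> nat -> K) (s a : K) (b : nat -> K) :
  jwf e -> jreg (x s) (u s) -> is_derive s 1 x a ->
  (forall i, is_derive s 1 (fun s => u s i) (b i)) ->
  is_derive s 1 (fun s => jeval e (x s) (u s)) (jeval (jdir a b e) (x s) (u s)).
Proof.
move=> we rs dx du; elim: e we => [f sf|i _|e1 H1 e2 H2 [/H1 d1 /H2 d2]
   |e1 H1 e2 H2 [/H1 d1 /H2 d2]|e H [/H d1 e0]] /=.
- rewrite pdtE pdxE; apply: is_derive_curve => //; have [df _] := sf 1%N; apply: df.
  by case: rs.
- exact: du.
- exact: (is_deriveD d1 d2).
- apply: is_derive_eq (is_deriveM d1 d2) _; rewrite /GRing.scale /=.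
  by rewrite addrC mulrC; congr (_ + _).
- have d0 := e0 _ _ rs; case: d1 => dd dv; apply: DeriveDef.
    exact: derivableV.
  by rewrite deriveV //= dv; rewrite /GRing.scale /= -exprVn; ring.
Qed.

Lemma jreg_near (x : K -> K) (u : K -> nat -> K) (s a : K) (b : nat -> K) :
  jreg (x s) (u s) -> is_derive s 1 x a ->
  (forall i, is_derive s 1 (fun s => u s i) (b i)) ->
  \forall s' \near s, jreg (x s') (u s').
Proof.
move=> rs dx du.
have wD : jwf (jtot (JFun T)) by exact: jwf_tot.
have /is_derive1_cvg dD := jeval_curve wD rs dx du.
have [As Ds] := rs.
have C1 : \forall s' \near s, A (x s', u s' 0%N).
  apply: (near_cvg_open (c := fun s => (x s, u s 0%N)) oA) => //.
  have cx := is_derive1_cvg dx; have cu := is_derive1_cvg (du 0%N).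
  exact: (cvg_pair cx cu).
have C2 : \forall s' \near s, jeval (jtot (JFun T)) (x s') (u s') != 0.
  apply: (near_cvg_open (A := [set y | y != 0]) (c := fun s => jeval (jtot (JFun T)) (x s) (u s))) => //.
  exact: open_neq0.
by apply: filterS2 C1 C2 => z; split.
Qed.

Definition jeqv (e e' : jexpr K) := forall t u, jreg t u -> jeval e t u = jeval e' t u.

Lemma is_derive_line (t a s : K) : is_derive s 1 (fun s => t + s * a) a.
Proof.
have h := is_deriveD (is_derive_cst t s 1) (is_deriveZ a (is_derive_id s 1)).
rewrite (_ : (fun _ => _) = cst t + a *: (id : K -> K)).
  by apply: is_derive_eq h _; rewrite add0r /GRing.scale /= mulr1.
by apply/funext => z; rewrite mulrC.
Qed.

(** Formal derivatives are defined by syntax, yet depend only on the values at regular jets: both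
    sides are true derivatives along the line through the jet with direction [(a, b)], and
    regularity persists near its origin. *)
Lemma jeqv_dir a b e e' : jwf e -> jwf e' -> jeqv e e' ->
  jeqv (jdir a b e) (jdir a b e').
Proof.
move=> we we' ee' t u ru.
pose x (s : K) := t + s * a; pose v (s : K) i := u i + s * b i.
have x0 : x 0 = t by rewrite /x mul0r addr0.
have v0 : v 0 = u by apply/funext => i; rewrite /v mul0r addr0.
have r0 : jreg (x 0) (v 0) by rewrite x0 v0.
have dx := is_derive_line t a 0.
have dv i := is_derive_line (u i) (b i) 0.
have [_ h1] := jeval_curve we r0 dx dv.
have [_ h2] := jeval_curve we' r0 dx dv.
rewrite -[t]x0 -[u]v0 -h1 -h2; apply: near_eq_derive.
by apply: filterS (jreg_near r0 dx dv) => s; exact: ee'.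
Qed.

Lemma jeqv_tot e e' : jwf e -> jwf e' -> jeqv e e' -> jeqv (jtot e) (jtot e').
Proof. by move=> we we' ee' t u ru; rewrite !jtotE; exact: (@jeqv_dir 1 (fun i => u i.+1) e e' we we' ee' t u ru). Qed.

Lemma jeqv_du i e e' : jwf e -> jwf e' -> jeqv e e' -> jeqv (jdu i e) (jdu i e').
Proof. by rewrite jdu_def; exact: jeqv_dir. Qed.

Lemma jwf_du i e : jwf e -> jwf (jdu i e).
Proof. by rewrite jdu_def; exact: jwf_dir. Qed.

End Curves.

(** * Highest-order dependence of the prolongation *)

Section Prolongation.
Variables (K : numFieldType) (A : set (K * K)) (T X : K * K -> K).
Hypotheses (oA : open A) (sT : smooth_on A T) (sX : smooth_on A X).

Local Notation jreg := (jreg A T).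
Local Notation jwf := (jwf A T).
Local Notation "e =j e'" := (jeqv A T e e') (at level 70).

Definition jD : jexpr K := jtot (JFun T).

Fixpoint jpro (k : nat) : jexpr K :=
  if k is m.+1 then JMul (jtot (jpro m)) (JInv jD) else JFun X.

Lemma jwf_D : jwf jD. Proof. exact: jwf_tot. Qed.

Lemma jwf_pro k : jwf (jpro k).
Proof.
by elim: k => //= k IH; split; [exact: jwf_tot|split; [exact: jwf_D|move=> t u []]].
Qed.

Lemma jorder_pro k : jorder k (jpro k).
Proof. by elim: k => //= k /jorder_tot ->; rewrite /jD jtotF. Qed.

(** Valid at every jet over the domain, which is what lets [jreg] and [regular_jet] be identified in
    [regular_jetE]. *)
Lemma jD_near t u : A (t, u 0%N) ->
  total_derivative 0 (lift_jet T) t u = jeval jD t u.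
Proof.
move=> Atu; have [dT _] := sT 1%N.
rewrite /total_derivative big_ord_recl big_ord0 addr0 /= /partial_t /partial_u.
rewrite !derive1E /lift_jet /set_coord /=.
have d1 := is_derive_curve (dT _ Atu) (is_derive_id t 1) (is_derive_cst (u 0%N) t 1).
have d2 := is_derive_curve (x := cst t) (y := id) (s := u 0%N) (dT _ Atu)
  (is_derive_cst t (u 0%N) 1) (is_derive_id (u 0%N) 1).
rewrite /jD jtotF [RHS]/= (pdtE T) (pdxE T); congr (_ + _ * _).
  by case: d1 => _ ->; rewrite mul1r mul0r addr0.
by case: d2 => _ ->; rewrite mul1r mul0r add0r.
Qed.

(** [F] is only known to agree with [e] at regular jets. The partial derivatives in
    [total_derivative] move along coordinate lines, on which regularity persists near the jet. *)
Lemma total_derivativeE N F e t u : jwf e -> jorder N e ->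
  (forall t u, jreg t u -> F t u = jeval e t u) -> jreg t u ->
  total_derivative N F t u = jeval (jtot e) t u.
Proof.
move=> we oe Fe r.
rewrite jtotE (jdirE _ _ _ _ oe) mul1r /total_derivative; congr (_ + _).
  rewrite /partial_t derive1E.
  have dx := is_derive_id t (1 : K); have du i := is_derive_cst (u i) t (1 : K).
  have r' : jreg (id t) ((fun=> u) t) by [].
  have [_ <-] := jeval_curve we r' dx du.
  by apply: near_eq_derive; apply: filterS (jreg_near oA sT r' dx du) => s; exact: Fe.
apply: eq_bigr => i _; congr (_ * _); rewrite /partial_u derive1E.
have dx := is_derive_cst t (u i) (1 : K).
pose v (s : K) := set_coord u i s.
have vi : v (u i) = u.
  by apply/funext => j; rewrite /v /set_coord; case: eqP => // ->.
have dv j : is_derive (u i) 1 (fun s => v s j) (i == j :> nat)%:R.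
  rewrite /v /set_coord eq_sym; case: eqP => _ /=; first exact: is_derive_id.
  exact: is_derive_cst.
have r' : jreg (cst t (u i)) (v (u i)) by rewrite vi.
have [_ h] := jeval_curve we r' dx dv.
rewrite -{3}vi jdu_def -[X in jeval _ X]/(cst t (u i)) -h.
by apply: near_eq_derive; apply: filterS (jreg_near oA sT r' dx dv) => s; exact: Fe.
Qed.

Lemma prolongE k t u : jreg t u -> prolong T X k t u = jeval (jpro k) t u.
Proof.
elim: k t u => [//|k IH] t u r /=.
rewrite (total_derivativeE (jwf_pro k) (jorder_pro k) IH r).
by rewrite jD_near //; case: r.
Qed.

Fixpoint jpow (e : jexpr K) (n : nat) :=
  if n is m.+1 then JMul e (jpow e m) else jcst 1.

Lemma jpowE e n t u : jeval (jpow e n) t u = jeval e t u ^+ n.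
Proof. by elim: n => //= n ->; rewrite exprS. Qed.

Lemma jwf_pow e n : jwf e -> jwf (jpow e n).
Proof. by move=> we; elim: n => //=; exact: smooth_cst. Qed.

Lemma jdu_pow i e n t u :
  jeval (jdu i (jpow e n)) t u =
  n%:R * jeval (jdu i e) t u * jeval e t u ^+ n.-1.
Proof.
elim: n => [|n IH]; first by rewrite [jpow _ _]/= /jcst mul0r; case: i => [|i]; rewrite ?jduF0 ?jduFS ?pdt_cst ?pdx_cst mul0r.
rewrite [jpow _ _]/= jduM IH jpowE -[n.+1%:R]natr1 /=.
by case: n {IH} => [|n]; rewrite /= ?exprS; ring.
Qed.

Lemma jdu_D i t u : (1 < i)%N -> jeval (jdu i jD) t u = 0.
Proof. by apply: (jdu_order (N := 1)); rewrite /jD jtotF. Qed.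

Lemma jeqv_zero_tot e t u : jwf e -> e =j jcst 0 -> jreg t u -> jeval (jtot e) t u = 0.
Proof.
move=> we e0 r; rewrite (jeqv_tot oA sT we _ e0 r); last exact: smooth_cst.
by rewrite /jcst jtotF /= pdt_cst pdx_cst mulr0 addr0.
Qed.

Lemma jdu_pro i k t u : jreg t u -> (0 < i)%N -> jeval (jdu i.+1 jD) t u = 0 ->
  jeval (jdu i.+1 (jpro k.+1)) t u =
  (jeval (jtot (jdu i.+1 (jpro k))) t u + jeval (jdu i (jpro k)) t u) / jeval jD t u.
Proof.
move=> r i0 D0.
rewrite [jpro k.+1]/= jduM jduI D0 jdu_tot /=; ring.
Qed.

Definition jjac : jexpr K := JFun (fun z => pdt T z * pdx X z - pdx T z * pdt X z).

(** J / (D_t T)^(k+1), which is the derivative of P_k with respect to x^(k) by [lead_pro]. *)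
Definition jlead k := JMul jjac (jpow (JInv jD) k.+1).

Lemma smooth_jac : jwf jjac.
Proof.
have pt f : smooth_on A f -> smooth_on A (pdt f) by exact: smooth_pdt.
have px f : smooth_on A f -> smooth_on A (pdx f) by exact: smooth_pdx.
move=> n; have [a b c d] := And4 (pt _ sT n) (px _ sX n) (px _ sT n) (pt _ sX n).
apply: upto_eq (upto_add oA (upto_mul oA a b) (upto_opp oA (upto_mul oA c d))) => //.
Qed.

Lemma jwf_invD : jwf (JInv jD).
Proof. by split; [exact: jwf_D|move=> t u []]. Qed.

Lemma jwf_lead k : jwf (jlead k).
Proof.
split; first exact: smooth_jac.
by apply: jwf_pow; exact: jwf_invD.
Qed.

Lemma jdu1_tot (f : K * K -> K) t u :
  jeval (jdu 1 (jtot (JFun f))) t u = pdx f (t, u 0%N).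
Proof. by rewrite jtotF jduA jduM !jduFS jduV add0r mul1r mulr0 addr0. Qed.

Lemma jdu1_D t u : jeval (jdu 1 jD) t u = pdx T (t, u 0%N).
Proof. exact: jdu1_tot. Qed.

Lemma jleadE k t u :
  jeval (jlead k) t u = jeval jjac t u * (jeval jD t u)^-1 ^+ k.+1.
Proof. by rewrite -[_^-1]/(jeval (JInv jD) t u) -jpowE. Qed.

(** P_1 = D_t X / D_t T gives J / (D_t T)^2 by the quotient rule, and each further D_t followed by
    division by D_t T passes the top coefficient on with one more factor 1 / D_t T. *)
Lemma lead_pro k : (0 < k)%N -> jdu k (jpro k) =j jlead k.
Proof.
elim: k => [//|[_ _|k IH _]] t u r.
  have D0 : jeval jD t u != 0 by case: r.
  rewrite [jpro 1]/=. rewrite jduM. rewrite jduI. rewrite (jdu1_tot X). rewrite (jdu1_tot T). rewrite jleadE.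
  rewrite (_ : jeval jjac t u = jeval jD t u * pdx X (t, u 0%N) -
    pdx T (t, u 0%N) * jeval (jtot (JFun X)) t u); last by rewrite /jD !jtotF /jjac /=; ring.
  rewrite jevalI; move: (jeval jD t u) (jeval (jtot _) t u) D0 => d x d0.
  by field.
rewrite jdu_pro // ?jdu_D // (IH _ t u r) // jeqv_zero_tot //.
- by rewrite add0r !jleadE -mulrA -exprSr.
- exact/jwf_du/jwf_pro.
- by move=> t' u' r'; rewrite (jdu_order _ _ (jorder_pro _)).
Qed.

(** Dependence of P_(k+1) on the derivative one order below the top. Its vanishing on the source
    equation for k = r - 1 is the constraint from which T_x = 0 and X_xx = 0 are drawn. *)
Definition jsub k := jdu k (jpro k.+1).

Lemma jwf_sub k : jwf (jsub k).
Proof. exact/jwf_du/jwf_pro. Qed.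

Lemma jwf_lead_pro k : jwf (jdu k (jpro k)).
Proof. exact/jwf_du/jwf_pro. Qed.

Definition jsub_succ k := JMul (JAdd (jtot (jdu k.+1 (jpro k.+1))) (jsub k)) (JInv jD).

Lemma jwf_sub_succ k : jwf (jsub_succ k).
Proof.
split; [split|exact: jwf_invD].
  exact/jwf_tot/jwf_lead_pro.
exact: jwf_sub.
Qed.

Lemma sub_pro k : (0 < k)%N -> jsub k.+1 =j jsub_succ k.
Proof.
by case: k => // k _ t u r; rewrite /jsub jdu_pro // jdu_D.
Qed.

Lemma jdu_lead i k t u : jeval (jdu i (jlead k)) t u =
  jeval (jdu i jjac) t u * (jeval jD t u)^-1 ^+ k.+1
  - k.+1%:R * jeval jjac t u * jeval (jdu i jD) t u * (jeval jD t u)^-1 ^+ k.+2.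
Proof.
rewrite jduM jdu_pow jduI jpowE [k.+1.-1]/= !exprS jevalI; ring.
Qed.

Lemma jdu_lead_pro i k : (0 < i)%N -> (0 < k)%N -> jdu i (jdu k (jpro k)) =j jdu i (jlead k).
Proof.
move=> i0 k0; apply: jeqv_du => //; [exact: jwf_lead_pro|exact: jwf_lead|].
exact: lead_pro.
Qed.

Lemma jtot_jdu_lead0 i k t u : (0 < k)%N -> (0 < i)%N ->
  (forall t u, jreg t u -> jeval (jdu i (jlead k)) t u = 0) ->
  jreg t u -> jeval (jtot (jdu i (jdu k (jpro k)))) t u = 0.
Proof.
move=> k0 i0 h r; rewrite jeqv_zero_tot //; first exact/jwf_du/jwf_lead_pro.
by move=> t' u' r'; rewrite jdu_lead_pro // h.
Qed.

(** The denominator D_t T = T_t + T_x x' brings x' into the top coefficients. From k to k + 1,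
    commuting d/du_2 with D_t adds the derivative by x' of J / (D_t T)^(k+2), that is -(k + 2) J T_x
    / (D_t T)^(k+3), before the division by D_t T; the factors add up to the binomial by Pascal's
    rule. *)
Lemma du2_sub k : (0 < k)%N -> forall t u, jreg t u -> jeval (jdu 2 (jsub k)) t u =
  - ('C(k.+2, 2)%:R * jeval jjac t u * pdx T (t, u 0%N)
     * (jeval jD t u)^-1 ^+ k.+3).
Proof.
elim: k => [//|[_ _|k IH _]] t u r.
  rewrite /jsub jdu_comm // jdu_lead_pro // jdu_lead jdu1_D.
  by rewrite /jjac jduFS (_ : 'C(3, 2) = 3%N) // mul0r sub0r; ring.
have h2 t' u' : jreg t' u' -> jeval (jdu 2 (jlead k.+2)) t' u' = 0.
  by move=> _; rewrite jdu_lead jdu_D // jduFS !mul0r mulr0 mul0r subr0.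
rewrite (jeqv_du oA sT _ (jwf_sub _) (jwf_sub_succ _) (sub_pro _) r) //.
rewrite jduM jduA jduI jdu_D // jdu_tot jtot_jdu_lead0 // IH //.
rewrite jdu_lead_pro // jdu_lead jdu1_D jduFS.
rewrite (binS k.+3) bin1 natrD jevalI !exprS; ring.
Qed.

(** * Jets of transformations with T independent of x *)

Section VerticalFibres.
(** [Ttx] is assumed apart from [Tx]: it is obtained from constancy of T along fibres in
    [fibre_cst_pdt], instead of from symmetry of mixed derivatives. *)
Hypotheses (Tx : forall z, A z -> pdx T z = 0)
  (Ttx : forall z, A z -> pdx (pdt T) z = 0).

Lemma Txx z : A z -> pdx (pdx T) z = 0.
Proof.
move=> Az; rewrite pdxE (near_eq_derive (g := fun=> 0)); first exact: derive_cst.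
exact: near_open Az Tx.
Qed.

Lemma jD_Tx t u : A (t, u 0%N) -> jeval jD t u = pdt T (t, u 0%N).
Proof. by move=> Atu; rewrite /jD jtotF /= Tx // mulr0 addr0. Qed.

Lemma jdu0_D t u : jreg t u -> jeval (jdu 0 jD) t u = 0.
Proof.
case=> Atu _; rewrite /jD jtotF.
rewrite jduA jduM !jduF0 jduV Ttx // Txx //=; ring.
Qed.

Lemma jdu1_D0 t u : jreg t u -> jeval (jdu 1 jD) t u = 0.
Proof. by case=> Atu _; rewrite jdu1_D Tx. Qed.

Lemma jdu1_lead k t u : jreg t u -> jeval (jdu 1 (jlead k)) t u = 0.
Proof. by move=> r; rewrite jdu_lead jdu1_D0 // jduFS !mul0r mulr0 mul0r subr0. Qed.

Definition jleadX k := JMul (JFun (pdx X)) (jpow (JInv jD) k).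

(** With T_x = 0 the Jacobian is T_t X_x and D_t T = T_t, so one power of D_t T cancels. *)
Lemma lead_leadX k : jlead k =j jleadX k.
Proof.
move=> t u [Atu]; rewrite -/jD jleadE => T0.
rewrite (_ : jeval (jleadX k) t u =
  pdx X (t, u 0%N) * (jeval jD t u)^-1 ^+ k); last by rewrite -jevalI -jpowE.
rewrite (_ : jeval jjac t u = jeval jD t u * pdx X (t, u 0%N)).
  by rewrite exprS mulrACA divff // mul1r.
by rewrite jD_Tx // /jjac /= Tx // mul0r subr0.
Qed.

Lemma jwf_leadX k : jwf (jleadX k).
Proof.
split; first exact: smooth_pdx.
by apply: jwf_pow; exact: jwf_invD.
Qed.

Lemma du0_lead k : (0 < k)%N -> forall t u, jreg t u ->
  jeval (jdu 0 (jdu k (jpro k))) t u =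
  pdx (pdx X) (t, u 0%N) * (jeval jD t u)^-1 ^+ k.
Proof.
move=> k0 t u r.
rewrite (jeqv_du oA sT _ (jwf_lead_pro _) (jwf_lead _) (lead_pro k0) r).
rewrite (jeqv_du oA sT _ (jwf_lead _) (jwf_leadX _) (@lead_leadX _) r).
by rewrite jduM jduF0 jdu_pow jduI jdu0_D // jpowE jevalI; ring.
Qed.

(** As in [du2_sub], except that commuting d/du_1 with D_t now produces d/du_0 of the top
    coefficient X_x / (D_t T)^(k+1), hence one summand X_xx / (D_t T)^(k+1) per step. *)
Lemma du1_sub k t u : jreg t u -> jeval (jdu 1 (jsub k)) t u =
  k.+1%:R * pdx (pdx X) (t, u 0%N) * (jeval jD t u)^-1 ^+ k.+1.
Proof.
have h1 m t' u' : jreg t' u' -> jeval (jdu 1 (jlead m)) t' u' = 0 by exact: jdu1_lead.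
elim: k t u => [|k IH] t u r.
  pose e := JMul (JAdd (JFun (pdx (pdt X)))
    (JMul (JVar K 1) (JFun (pdx (pdx X))))) (JInv jD).
  have we : jwf e.
    split; last exact: jwf_invD.
    by split; [exact/smooth_pdx/smooth_pdt|split => //; exact/smooth_pdx/smooth_pdx].
  have he : jsub 0 =j e.
    move=> t' u' r'; rewrite /jsub /jpro jduM jduI jdu0_D // jtotF.
    rewrite jduA jduM !jduF0 jduV /=; ring.
  rewrite (jeqv_du oA sT _ (jwf_sub _) we he r) /e jduM jduA jduM !jduFS.
  rewrite jduI jduV jdu1_D0 // jevalI [jeval (JFun _) _ _]/= eqxx.
  by rewrite add0r mulr0 addr0 mul0r oppr0 mulr0 addr0.
have hs : jsub k.+1 =j jsub_succ k.
  (* [sub_pro] starts at 1; for 0 the contribution of d/du_1 of D_t T vanishes by T_x = 0. *)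
  case: k {IH} => [|k]; last exact: sub_pro.
  move=> t' u' r'; rewrite /jsub jduM jduI jdu1_D0 // jdu_tot /=; ring.
rewrite (jeqv_du oA sT _ (jwf_sub _) (jwf_sub_succ _) hs r) //.
rewrite jduM jduA jduI jdu1_D0 // jdu_tot (jtot_jdu_lead0 _ _ (h1 k.+1)) // IH //.
rewrite du0_lead // jevalI -[k.+2%:R]natr1 !exprS; ring.
Qed.
End VerticalFibres.

End Prolongation.

(** * T_x = 0 and X_xx = 0 for transformations between linear equations *)

Section MapsEquation.
Variables (K : numFieldType) (A : set (K * K)) (T X : K * K -> K) (s : nat).
Hypotheses (oA : open A) (sT : smooth_on A T) (sX : smooth_on A X).
Hypothesis jacP : forall z, A z -> Defs.jacobian T X z != 0.

Local Notation jreg := (jreg A T).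
Local Notation jwf := (jwf A T).
Local Notation P := (jpro T X).
Local Notation r := s.+3.

Definition lin_eq (u : nat -> K) (a : 'rV[K]_(r - 2)) (b : K) :=
  u r + \sum_(k < r - 2) a 0 k * u k = b.

(** The coefficients may depend on the point (t, x), since those of the target are evaluated at T(t,
    x). Accordingly the arguments below move only derivatives of x of positive order. *)
Hypothesis maps_lin : forall t x, A (t, x) ->
  exists a b a' b', forall u, u 0%N = x -> jreg t u -> lin_eq u a b ->
    lin_eq (fun k => jeval (P k) t u) a' b'.

Lemma is_derive_moving_jet e t u (be : nat -> K) : jwf e -> jreg t u ->
  is_derive (0 : K) 1 (fun x => jeval e t (fun i => u i + x * be i))
    (jeval (jdir 0 be e) t u).
Proof.
move=> we ru.
pose v (x : K) i := u i + x * be i.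
have v0 : v 0 = u by apply/funext => i; rewrite /v mul0r addr0.
have r0 : jreg (cst t (0:K)) (v 0) by rewrite v0.
have := jeval_curve we r0 (is_derive_cst t (0:K) 1) (fun i => is_derive_line (u i) (be i) 0).
by rewrite v0.
Qed.

Lemma jreg_moving_jet t u (be : nat -> K) : jreg t u ->
  \forall x \near (0 : K), jreg t (fun i => u i + x * be i).
Proof.
move=> ru; pose v (x : K) i := u i + x * be i.
have v0 : v 0 = u by apply/funext => i; rewrite /v mul0r addr0.
have r0 : jreg (cst t (0:K)) (v 0) by rewrite v0.
exact: (jreg_near oA sT r0 (is_derive_cst t (0:K) 1) (fun i => is_derive_line (u i) (be i) 0)).
Qed.

Lemma is_derive_near_cst (f : K -> K) (x d c : K) :
  (\forall y \near x, f y = c) -> is_derive x 1 f d -> d = 0.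
Proof.
move=> fc [_ <-]; rewrite (near_eq_derive (g := cst c)) //; exact: derive_cst.
Qed.

(* The source equation does not involve [u (r - 1)], and neither do the
   components of order at most r - 3; so on the source equation the component of
   order r is independent of [u (r - 1)]. *)
Lemma sub_vanishes t u a b a' b' :
  (forall v, v 0%N = u 0%N -> jreg t v -> lin_eq v a b ->
    lin_eq (fun k => jeval (P k) t v) a' b') ->
  jreg t u -> lin_eq u a b -> jeval (jsub T X s.+2) t u = 0.
Proof.
move=> h ru e0.
pose be (i : nat) : K := (s.+2 == i)%:R.
pose v (x : K) i := u i + x * be i.
pose G (x : K) := jeval (P r) t (v x) + \sum_(k < r - 2) a' 0 k * jeval (P k) t (v x).
have dP k : is_derive (0 : K) 1 (fun x => jeval (P k) t (v x)) (jeval (jdu s.+2 (P k)) t u).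
  by rewrite jdu_def; apply: is_derive_moving_jet => //; exact: jwf_pro.
have dG : is_derive (0 : K) 1 G (jeval (jdu s.+2 (P r)) t u +
    \sum_(k < r - 2) a' 0 k * jeval (jdu s.+2 (P k)) t u).
  have dS := is_derive_sum (fun k : 'I_(r-2) => is_deriveZ (a' 0 k) (dP k)).
  have := is_deriveD (dP r) dS; congr (is_derive _ _ _ _).
  by apply/funext => x; rewrite /G /= !fctE /= fct_sumE.
have : \forall x \near (0 : K), G x = b'.
  apply: filterS (jreg_moving_jet be ru) => x rx; apply: h => //.
    by rewrite /v /be mulr0 addr0.
  rewrite /lin_eq /v /be (_ : (s.+2 == r) = false) ?mulr0 ?addr0; last first.
    by rewrite eqSS ltn_eqF.
  rewrite -e0; congr (_ + _); apply: eq_bigr => k _; congr (_ * _).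
  rewrite (_ : (s.+2 == k) = false) ?mulr0 ?addr0 // gtn_eqF //.
  by apply: (leq_trans (ltn_ord k)); rewrite subSS subSS subn0.
move=> /is_derive_near_cst/(_ dG) => <-.
rewrite big1 ?addr0 // => k _; rewrite (jdu_order _ _ (jorder_pro T X _)) ?mulr0 //.
by apply: (leq_trans (ltn_ord k)); rewrite subSS subSS subn0.
Qed.

Lemma du_sub_vanishes j t u a b a' b' : (0 < j < 3)%N ->
  (forall v, v 0%N = u 0%N -> jreg t v -> lin_eq v a b ->
    lin_eq (fun k => jeval (P k) t v) a' b') ->
  jreg t u -> lin_eq u a b -> jeval (jdu j (jsub T X s.+2)) t u = 0.
Proof.
move=> /andP[j0 j3] h ru e0.
(* Moving x^(j) at speed 1 changes the left-hand side of the source equation at speed [c]; moving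
   x^(r) at speed [-c] compensates, so the line stays on the equation, where [sub_vanishes]
   applies. *)
pose c : K := \sum_(k < r - 2) a 0 k * (j == k)%:R.
pose be (i : nat) : K := (j == i)%:R - (r == i)%:R * c.
pose v (x : K) i := u i + x * be i.
have ws : jwf (jsub T X s.+2) by exact: jwf_sub.
have dL := is_derive_moving_jet be ws ru.
have v0 x : v x 0%N = u 0%N by rewrite /v /be (gtn_eqF j0) mul0r subr0 mulr0 addr0.
have Z : \forall x \near (0 : K), jeval (jsub T X s.+2) t (v x) = 0.
  apply: filterS (jreg_moving_jet be ru) => x rx.
  apply: (sub_vanishes (a := a) (b := b) (a' := a') (b' := b')) => //.
    by move=> w; rewrite v0; exact: h.
  rewrite -e0 /lin_eq /v /be eqxx (_ : (j == r) = false); last first.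
    by rewrite ltn_eqF // (leq_trans j3).
  rewrite (eq_bigr (fun k : 'I_(r - 2) => a 0 k * u k + x * (a 0 k * (j == k)%:R))).
    rewrite big_split /= -mulr_sumr -/c; ring.
  move=> k _; rewrite (_ : (r == k) = false); first by rewrite mul0r subr0; ring.
  by rewrite gtn_eqF // (leq_trans (ltn_ord k)) // subSS subSS subn0 // ltnW.
have := is_derive_near_cst Z dL.
have os : jorder r (jsub T X s.+2) by rewrite /jsub jdu_def; exact/jorder_dir/jorder_pro.
rewrite (jdirE _ _ _ _ os) mul0r add0r.
rewrite big_ord_recr /= {2}/be eqxx mul1r (_ : (j == r) = false) ?sub0r; last first.
  by rewrite ltn_eqF // (leq_trans j3).
(* The compensation is invisible: the derivative of [jsub] by x^(r) is that of J / (D_t T)^(r+1) by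
   x^(r-1), and r - 1 >= 2 while D_t T stops at x'. *)
rewrite (_ : jeval (jdu r _) t u = 0) ?mulr0 ?addr0; last first.
  rewrite /jsub jdu_comm // (jdu_lead_pro oA sT sX) // jdu_lead jdu_D // /jjac jduFS.
  ring.
have jr : (j < r)%N by rewrite (leq_trans j3).
rewrite (bigD1 (Ordinal jr)) //= /be eqxx (gtn_eqF jr) mul0r subr0 mul1r.
rewrite big1 ?addr0 // => k kj.
rewrite (_ : (j == k) = false) ?(gtn_eqF (ltn_ord k)) ?mul0r ?subr0 ?mul0r //.
by apply/negbTE; rewrite eq_sym.
Qed.

Lemma exists_lin_eq x q a b : exists u : nat -> K,
  [/\ u 0%N = x, u 1%N = q & lin_eq u a b].
Proof.
pose w (i : nat) : K := if i == 0%N then x else if i == 1%N then q else 0.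
exists (fun i => if i == r then b - \sum_(k < r - 2) a 0 k * w k else w i).
split=> //; rewrite /lin_eq eqxx.
rewrite [X in _ + X](_ : _ = \sum_(k < r - 2) a 0 k * w k) ?subrK //.
apply: eq_bigr => k _; rewrite ltn_eqF // (leq_trans (ltn_ord k)) //.
by rewrite subSS subSS subn0 ltnW.
Qed.

Lemma regular_slope t x : A (t, x) -> exists q : K,
  forall u, u 0%N = x -> u 1%N = q -> jreg t u.
Proof.
move=> Az; have J := jacP Az.
(* If T_x = 0 then D_t T = T_t is nonzero by the Jacobian and slope 0 will do; otherwise the slope
   is chosen to make D_t T equal to 1. *)
have [Tx0|Tx0] := eqVneq (pdx T (t, x)) 0.
  exists 0 => u u0 u1; split; rewrite ?u0 // jtotF /= u0 u1 mul0r addr0 pdtE.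
  apply: contraNneq J => T0; rewrite /Defs.jacobian T0.
  by move: Tx0; rewrite pdxE => ->; rewrite !mul0r subrr.
exists ((1 - pdt T (t, x)) / pdx T (t, x)) => u u0 u1; split; rewrite ?u0 //.
by rewrite jtotF /= u0 u1 divfK // addrC subrK oner_eq0.
Qed.

Lemma jjac_neq0 t u : jreg t u -> jeval (jjac T X) t u != 0.
Proof.
by move=> [/jacP + _]; rewrite /jjac /= /Defs.jacobian !pdtE !pdxE.
Qed.

Lemma vertical_T t x : A (t, x) -> pdx T (t, x) = 0.
Proof.
move=> Az; have [a [b [a' [b' h]]]] := maps_lin Az.
have [q qP] := regular_slope Az.
have [u [u0 u1 ue]] := exists_lin_eq x q a b.
have ru := qP u u0 u1; rewrite -u0 in h.
have := @du_sub_vanishes 2 t u a b a' b' isT h ru ue.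
rewrite (du2_sub oA sT sX _ ru) // => /eqP.
rewrite oppr_eq0 mulf_eq0 expf_eq0 invr_eq0 (negbTE ru.2) andbF orbF !mulf_eq0.
by rewrite (negbTE (jjac_neq0 ru)) pnatr_eq0 -leqn0 leqNgt bin_gt0 /= u0 => /eqP.
Qed.

Lemma affine_X t x :
  (forall z, A z -> pdx (pdt T) z = 0) -> A (t, x) -> pdx (pdx X) (t, x) = 0.
Proof.
move=> Ttx Az; have [a [b [a' [b' h]]]] := maps_lin Az.
have [q qP] := regular_slope Az.
have [u [u0 u1 ue]] := exists_lin_eq x q a b.
have ru := qP u u0 u1; rewrite -u0 in h.
have := @du_sub_vanishes 1 t u a b a' b' isT h ru ue.
rewrite (du1_sub oA sT sX _ Ttx _ ru); last by move=> [t' x'] /vertical_T.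
move=> /eqP; rewrite mulf_eq0 expf_eq0 invr_eq0 (negbTE ru.2) andbF orbF.
by rewrite mulf_eq0 pnatr_eq0 /= u0 => /eqP.
Qed.

End MapsEquation.

(** * Real and complex ground fields *)

(* [R] and [R[i]] treated uniformly: [io] embeds [R] in [K] and [N] is the
   absolute value with values in [R]. *)
Record real_norm (R : realType) (K : numFieldType) (io : {rmorphism R -> K})
    (N : K -> R) : Prop := RealNorm {
  rn_norm : forall z, `|z| = io (N z);
  rn_le : forall a b, (io a <= io b) = (a <= b);
  rn_complete : forall u : nat -> K,
    (forall e, 0 < e -> exists n, forall m p,
       (n <= m)%N -> (n <= p)%N -> N (u m - u p) <= e) ->
    exists l, forall e, 0 < e -> exists n, forall m, (n <= m)%N -> N (u m - l) <= e }.

Lemma realType_complete (R : realType) (u : nat -> R) :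
  (forall e, 0 < e -> exists n, forall m p,
     (n <= m)%N -> (n <= p)%N -> `|u m - u p| <= e) ->
  exists l, forall e, 0 < e -> exists n, forall m, (n <= m)%N -> `|u m - l| <= e.
Proof.
move=> hu; have cu : cvg (u @ \oo).
  apply/cauchy_cvgP/cauchy_exP => e e0.
  have e20 : 0 < e / 2 by rewrite divr_gt0.
  have [n hn] := hu _ e20; exists (u n); exists n => // m /= nm.
  rewrite /ball /= (le_lt_trans (hn _ _ (leqnn n) nm)) //.
  by rewrite ltr_pdivrMr // ltr_pMr // ltr1n.
exists (lim (u @ \oo)) => e e0.
have /cvgrPdist_le/(_ e e0) [n _ hn] := cu.
by exists n => m nm; rewrite distrC; apply: hn.
Qed.

Section GroundField.
Import ComplexField.Normc.
Local Open Scope complex_scope.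

Lemma real_norm_of (R : realType) (K : numFieldType) : real_or_complex R K ->
  exists io N, @real_norm R K io N.
Proof.
case.
  exists [the {rmorphism R -> R} of idfun], (fun x => `|x|); split=> //.
  exact: realType_complete.
exists [the {rmorphism R -> R[i]} of real_complex R], (@normc R); split=> //.
- by move=> a b; rewrite lecR.
- move=> u hu.
  (* A Cauchy sequence for [normc] is Cauchy in both real coordinates, whose limits are
     assembled. *)
  have le_Re (z : R[i]) : `|complex.Re z| <= normc z.
    by have := normc_ge_Re z; rewrite lecR.
  have le_Im (z : R[i]) : `|complex.Im z| <= normc z.
    case: z => a b /=; rewrite -sqrtr_sqr ler_sqrt ?addr_ge0 ?sqr_ge0 //.
    by rewrite lerDr sqr_ge0.
  have [a ha] : exists l, forall e, 0 < e -> exists n, forall m, (n <= m)%N -> `|complex.Re (u m) - l| <= e.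
    apply: realType_complete => e e0; have [n hn] := hu e e0; exists n => m p nm np.
    apply: le_trans (hn m p nm np); apply: le_trans (le_Re _).
    by case: (u m) (u p) => ? ? [].
  have [b hb] : exists l, forall e, 0 < e -> exists n, forall m, (n <= m)%N -> `|complex.Im (u m) - l| <= e.
    apply: realType_complete => e e0; have [n hn] := hu e e0; exists n => m p nm np.
    apply: le_trans (hn m p nm np); apply: le_trans (le_Im _).
    by case: (u m) (u p) => ? ? [].
  exists (a +i* b) => e e0; have e20 : 0 < e / 2 by rewrite divr_gt0.
  have [n1 h1] := ha _ e20; have [n2 h2] := hb _ e20; exists (maxn n1 n2) => m.
  rewrite geq_max => /andP[/h1 {}h1 /h2 {}h2].
  have -> : u m - (a +i* b) = (complex.Re (u m) - a)%:C + (Complex 0 1) * (complex.Im (u m) - b)%:C.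
    by case: (u m) => x y; apply/eqP; rewrite eq_complex /=; apply/andP; split; apply/eqP; ring.
  apply: le_trans (le_normcD _ _) _; rewrite normcM /= !expr0n /= !add0r !addr0 !expr1n.
  by rewrite sqrtr1 mul1r !sqrtr_sqr [leRHS]splitr lerD.
Qed.

End GroundField.

Section RealNorm.
Variables (R : realType) (K : numFieldType) (io : {rmorphism R -> K}) (N : K -> R).
Hypothesis HN : real_norm io N.
Implicit Types (x y z : K) (e d : R).

Let io_inj : injective io.
Proof.
by move=> a b ab; apply/eqP; rewrite eq_le -!(rn_le HN) ab lexx.
Qed.

Let io_lt a b : (io a < io b) = (a < b).
Proof. by rewrite !lt_neqAle (rn_le HN) (inj_eq io_inj). Qed.

Let io_gt0 a : (0 < io a) = (0 < a).
Proof. by rewrite -(rmorph0 io) io_lt. Qed.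

Lemma N_ge0 z : 0 <= N z.
Proof. by rewrite -(rn_le HN) rmorph0 -(rn_norm HN). Qed.

Lemma N_eq0 z : (N z == 0) = (z == 0).
Proof. by rewrite -(inj_eq io_inj) rmorph0 -(rn_norm HN) normr_eq0. Qed.

Lemma N0 : N 0 = 0. Proof. by apply/eqP; rewrite N_eq0. Qed.

Lemma NM x y : N (x * y) = N x * N y.
Proof. by apply: io_inj; rewrite rmorphM -!(rn_norm HN) normrM. Qed.

Lemma ND x y : N (x + y) <= N x + N y.
Proof. by rewrite -(rn_le HN) rmorphD -!(rn_norm HN) ler_normD. Qed.

Lemma NN x : N (- x) = N x.
Proof. by apply: io_inj; rewrite -!(rn_norm HN) normrN. Qed.

Lemma Ndist x y : N (x - y) = N (y - x).
Proof. by rewrite -NN opprB. Qed.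

Lemma N_tri z x y : N (x - y) <= N (x - z) + N (z - y).
Proof. by rewrite -(subrKA z) ND. Qed.

Lemma NV x : N x^-1 = (N x)^-1.
Proof. by apply: io_inj; rewrite fmorphV -!(rn_norm HN) normfV. Qed.

Lemma N_io a : N (io a) = `|a|.
Proof.
wlog a0 : a / 0 <= a => [h|].
  by have [/h //|/ltW a0] := leP 0 a; rewrite -NN -rmorphN h ?oppr_ge0 // normrN.
apply: io_inj; rewrite -(rn_norm HN) (ger0_norm a0) ger0_norm //.
by rewrite -(rmorph0 io) (rn_le HN).
Qed.

Lemma N_sum n (f : 'I_n -> K) : N (\sum_(i < n) f i) <= \sum_(i < n) N (f i).
Proof.
elim: n f => [|n IH] f; first by rewrite !big_ord0 N0.
by rewrite !big_ord_recl (le_trans (ND _ _)) // lerD2l IH.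
Qed.

Lemma nbhs_NP x (P : K -> Prop) : (\forall z \near x, P z) <->
  exists2 d, 0 < d & forall z, N (z - x) < d -> P z.
Proof.
split=> [/nbhs_ballP [e /= e0 he]|[d d0 hd]].
  have Ee : e = io (N e) by rewrite -(rn_norm HN) gtr0_norm.
  exists (N e) => [|z hz]; first by rewrite -io_lt rmorph0 -Ee.
  by apply: he; rewrite -ball_normE /= (rn_norm HN) Ee io_lt Ndist.
apply/nbhs_ballP; exists (io d); first by rewrite /= io_gt0.
by move=> z; rewrite -ball_normE /= (rn_norm HN) io_lt Ndist => /hd.
Qed.

Lemma open_NP (U : set K) : open U <->
  forall x, U x -> exists2 d, 0 < d & forall z, N (z - x) < d -> U z.
Proof.
rewrite openE; split=> [h x /h /nbhs_NP //|h x /h /nbhs_NP //].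
Qed.

Lemma cvg_NP (f : K -> K) x l : f z @[z --> x] --> l <->
  forall e, 0 < e -> exists2 d, 0 < d & forall z, N (z - x) < d -> N (f z - l) < e.
Proof.
split=> [h e e0|h P /nbhs_NP[e e0 he]].
  have : \forall w \near l, N (w - l) < e by apply/nbhs_NP; exists e.
  by move=> /h /nbhs_NP.
by apply/nbhs_NP; have [d d0 hd] := h e e0; exists d => // z /hd /he.
Qed.

(** The estimate has no quotient, so it covers z = x and passes to limits in [is_derive_ucvg]. *)
Lemma is_derive_NP (f : K -> K) x l : is_derive x 1 f l <->
  forall e, 0 < e -> exists2 d, 0 < d &
    forall z, N (z - x) < d -> N (f z - f x - l * (z - x)) <= e * N (z - x).
Proof.
split=> [df e e0|h].
  have [fx <-] := df.
  have /derivable1_diffP dfx := fx.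
  have /eqaddoP/(_ (io e)) := diff_locally dfx.
  rewrite io_gt0 => /(_ e0) /nbhs_NP [d d0 hd]; exists d => // z hz.
  have hz' : N (z - x - 0) < d by rewrite subr0.
  have := hd (z - x) hz'; rewrite /= !fctE /= subrK.
  have -> : 'd f x (z - x) = 'D_1 f x * (z - x).
    by rewrite deriveE // -[z - x in LHS]mulr1 -[_ * 1]/(_ *: _) linearZ mulrC.
  by rewrite !(rn_norm HN) -rmorphM (rn_le HN) opprD addrA.
have key : (fun h => h^-1 *: ((f \o shift x) (h *: 1) - f x)) @ 0^' --> l.
  apply/cvgrPdist_le => e e0.
  have Ee : e = io (N e) by rewrite -(rn_norm HN) gtr0_norm.
  have Ne0 : 0 < N e by rewrite -io_lt rmorph0 -Ee.
  have [d d0 hd] := h _ Ne0.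
  have D : \forall z \near (0 : K), N (z - 0) < d by apply/nbhs_NP; exists d.
  rewrite near_withinE; apply: filterS D => z; rewrite subr0 => zd z0 /=.
  rewrite (rn_norm HN) Ee (rn_le HN) -(ler_pM2r (x := N z)); last first.
    by rewrite lt_neqAle N_ge0 eq_sym N_eq0 z0.
  rewrite -NM mulrBl -[_ *: 1]/(_ * 1) mulr1 -[z^-1 *: _]/(_ * _) mulrAC mulVf // mul1r.
  by have := hd (z + x); rewrite addrK => /(_ zd); rewrite -NN opprB.
by apply: DeriveDef; [apply/cvg_ex; exists l|apply/cvg_lim].
Qed.

End RealNorm.

(** [P] is locally constant on [U], so the points of [U] where it holds and those where it fails
    both form relatively open sets. *)
Lemma connected_near_ind (T : topologicalType) (U : set T) (P : T -> Prop) z0 :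
  connected U -> (forall z, U z -> \forall w \near z, P w <-> P z) ->
  U z0 -> P z0 -> forall z, U z -> P z.
Proof.
move=> cU lP Uz0 Pz0 z Uz.
suff : U `&` P = U by move=> UP; move: Uz; rewrite -{1}UP => -[].
apply: cU; first by exists z0.
- exists (interior [set v | U v -> P v]); first exact: open_interior.
  apply/seteqP; split=> w [Uw Pw]; split=> //.
    by apply: filterS (lP w Uw) => v Hv _; apply/Hv.
  by move: Pw => /nbhs_singleton; apply.
- exists (~` interior [set v | U v -> ~ P v]).
    exact/open_closedC/open_interior.
  apply/seteqP; split=> w [Uw Pw]; split=> //.
    by move=> /nbhs_singleton; apply.
  apply: contrapT => nP; apply: Pw.
  by apply: filterS (lP w Uw) => v Hv _ /Hv.
Qed.

(** * Mean value inequality over R and C *)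

Section MeanValue.
Variables (R : realType) (K : numFieldType) (io : {rmorphism R -> K}) (N : K -> R).
Hypothesis HN : real_norm io N.
Let N_ge0 := N_ge0 HN. Let N_eq0 := N_eq0 HN. Let N0 := N0 HN. Let NM := NM HN.
Let ND := ND HN. Let Ndist := Ndist HN. Let N_tri := N_tri HN.
Let N_io := N_io HN.
Implicit Types (x y z : K) (e d : R).

Lemma le_of_N_cvg (u : nat -> K) l B :
  (forall e, 0 < e -> exists n, forall m, (n <= m)%N -> N (u m - l) <= e) ->
  (exists n, forall m, (n <= m)%N -> N (u m) <= B) -> N l <= B.
Proof.
move=> ul [n1 uB]; apply/ler_addgt0Pr => e e0.
have [n2 h] := ul e e0; set m := maxn n1 n2.
have h1 := uB m (leq_maxl _ _); have h2 := h m (leq_maxr _ _).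
have := N_tri (u m) l 0; rewrite !subr0 (Ndist l).
by move/le_trans; apply; rewrite addrC lerD.
Qed.

Lemma N_cvg_unique (u : nat -> K) l l' :
  (forall e, 0 < e -> exists n, forall m, (n <= m)%N -> N (u m - l) <= e) ->
  (forall e, 0 < e -> exists n, forall m, (n <= m)%N -> N (u m - l') <= e) -> l = l'.
Proof.
move=> ul ul'; apply/eqP; rewrite -subr_eq0 -N_eq0 eq_le N_ge0 andbT.
apply/ler_addgt0Pr => e e0; rewrite add0r.
have e20 : 0 < e / 2 by rewrite divr_gt0.
have [n h] := ul _ e20; have [n' h'] := ul' _ e20; set m := maxn n n'.
have h1 := h m (leq_maxl _ _); have h2 := h' m (leq_maxr _ _).
by rewrite (le_trans (N_tri (u m) l l')) // (Ndist l) [leRHS]splitr lerD.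
Qed.

(** A supremum argument, valid for values in K. The local bound compares only with the value at [p],
    which is what a derivative at [p] provides. *)
Lemma lipschitz_of_local (g : R -> K) (C : R) :
  (forall p, 0 <= p <= 1 -> exists2 d, 0 < d &
    forall s, 0 <= s <= 1 -> `|s - p| < d -> N (g s - g p) <= C * `|s - p|) ->
  N (g 1 - g 0) <= C.
Proof.
move=> loc.
pose S := [set s | 0 <= s <= 1 /\ forall s', 0 <= s' <= s -> N (g s' - g 0) <= C * s'].
have S0 : S 0.
  split=> [|s' /andP[a b]]; first by rewrite lexx ler01.
  have -> : s' = 0 by apply: le_anti; rewrite a b.
  by rewrite subrr N0 mulr0.
have ubS : has_sup S by split; [exists 0|exists 1 => s [/andP[]]].
set c := sup S.
have c01 : 0 <= c <= 1.
  apply/andP; split; first by apply: ub_le_sup => //; case: ubS.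
  by apply: ge_sup => // [|s [/andP[]]]; case: ubS.
have [d d0 hd] := loc c c01.
(* Up to c + d the bound at s' is assembled from those on [0, s], [s, c] and [c, s'], for some s in
   [S] within d of c. *)
have hc s' : 0 <= s' <= 1 -> s' < c + d -> N (g s' - g 0) <= C * s'.
  move=> s'01 s'd; have [s'c|cs'] := ltP s' c.
    have [|s [s01 hs] cs] := sup_adherent (eps := c - s') _ ubS; first by lra.
    by apply: hs; rewrite -/c in cs; lra.
  have [s [s01 hs] cs] := sup_adherent d0 ubS; rewrite -/c in cs.
  have sc : s <= c by apply: ub_le_sup => //; case: ubS.
  have h1 : N (g c - g s) <= C * (c - s).
    have := hd s s01; rewrite distrC ger0_norm ?subr_ge0 // => h.
    by rewrite Ndist h //; lra.
  have h2 : N (g s' - g c) <= C * (s' - c).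
    by have := hd s' s'01; rewrite ger0_norm ?subr_ge0 // => h; apply: h; lra.
  have h3 : N (g s - g 0) <= C * s by apply: hs; lra.
  have h4 := N_tri (g c) (g s') (g 0); have h5 := N_tri (g s) (g c) (g 0); lra.
have c1 : c = 1.
  apply: le_anti; rewrite (andP c01).2 /=; rewrite leNgt; apply/negP => c1.
  have [d' [d'0 d'd d'1]] : exists d', [/\ 0 < d', d' < d & c + d' <= 1].
    have [h|h] := leP (d / 2) (1 - c).
      by exists (d / 2); split; lra.
    by exists (1 - c); split; lra.
  have : S (c + d').
    split=> [|s' s'c]; first by lra.
    by apply: hc; lra.
  by move=> /(ub_le_sup ubS.2); rewrite -/c; lra.
by have := hc 1; rewrite c1 mulr1; apply; lra.
Qed.

Definition seg a b (s : R) : K := a + io s * (b - a).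

Lemma mean_value (f : K -> K) a b M :
  (forall s, 0 <= s <= 1 -> exists l, is_derive (seg a b s) 1 f l /\ N l <= M) ->
  N (f b - f a) <= M * N (b - a).
Proof.
move=> df; apply/ler_addgt0Pr => e e0.
(* The summand 1 keeps the quotients meaningful when a = b. *)
have ab0 : 0 < N (b - a) + 1 by rewrite ltr_wpDl // N_ge0.
have eab0 : 0 < e / (N (b - a) + 1) by rewrite divr_gt0.
have -> : f b - f a = f (seg a b 1) - f (seg a b 0).
  by rewrite /seg rmorph1 mul1r subrKC rmorph0 mul0r addr0.
apply: (lipschitz_of_local (g := fun s => f (seg a b s))) => p p01.
have [l [dl lM]] := df p p01.
have [d d0 hd] := (is_derive_NP HN _ _ _).1 dl _ eab0.
exists (d / (N (b - a) + 1)) => [|s s01 sp]; first by rewrite divr_gt0.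
have E : seg a b s - seg a b p = io (s - p) * (b - a).
  by rewrite /seg rmorphB; ring.
have NE : N (seg a b s - seg a b p) = `|s - p| * N (b - a) by rewrite E NM N_io.
have [Nab0|Nab0] := eqVneq (N (b - a)) 0.
  have ba : b - a = 0 by apply/eqP; rewrite -N_eq0 Nab0.
  have -> : seg a b s = seg a b p by rewrite /seg ba !mulr0.
  rewrite subrr N0 mulr_ge0 // Nab0 mulr0 add0r ltW //.
have lt : N (seg a b s - seg a b p) < d.
  rewrite NE; move: sp; rewrite ltr_pdivlMr // => /(le_lt_trans _); apply.
  by rewrite ler_wpM2l // lerDl.
have := hd _ lt; set D := _ - _ - _ => hD.
have -> : f (seg a b s) - f (seg a b p) = D + l * (seg a b s - seg a b p).
  by rewrite /D subrK.
apply: le_trans (ND _ _) _; rewrite NM.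
apply: le_trans (lerD hD (ler_wpM2r (N_ge0 _) lM)) _.
rewrite NE -mulrDl mulrCA mulrC ler_wpM2r // mulrDl addrC lerD2l.
by rewrite mulrAC ler_pdivrMr // ler_wpM2l ?(ltW e0) // lerDl.
Qed.

Definition Nball c d : set K := [set z | N (z - c) < d].

Lemma seg_Nball c d a b s : Nball c d a -> Nball c d b -> 0 <= s <= 1 ->
  Nball c d (seg a b s).
Proof.
rewrite /Nball /= => ha hb /andP[s0 s1].
have -> : seg a b s - c = io (1 - s) * (a - c) + io s * (b - c).
  by rewrite /seg rmorphB rmorph1; ring.
apply: le_lt_trans (ND _ _) _; rewrite !NM !N_io !ger0_norm ?subr_ge0 //.
have [->|s0'] := eqVneq s 0; first by rewrite subr0 mul1r mul0r addr0.
have : s * N (b - c) < s * d by rewrite ltr_pM2l // lt_neqAle eq_sym s0'.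
have : (1 - s) * N (a - c) <= (1 - s) * d by rewrite ler_wpM2l ?subr_ge0 // ltW.
lra.
Qed.

Lemma open_Nball c d : open (Nball c d).
Proof.
apply/(open_NP HN) => x hx; exists (d - N (x - c)); first by rewrite subr_gt0.
move=> z hz; rewrite /Nball /=; have := N_tri x z c; lra.
Qed.

Lemma mean_value_ball (f f1 : K -> K) c d a b M :
  (forall z, Nball c d z -> is_derive z 1 f (f1 z) /\ N (f1 z) <= M) ->
  Nball c d a -> Nball c d b -> N (f b - f a) <= M * N (b - a).
Proof.
move=> h ha hb; apply: mean_value => s s01.
by exists (f1 (seg a b s)); apply: h; apply: seg_Nball.
Qed.

Lemma connected_Nball c d : connected (Nball c d).
Proof.
pose I z : set K := seg c z @` `[0, 1]%classic.
have [d0|d0] := leP d 0.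
  rewrite (_ : Nball c d = set0); first exact: connected0.
  apply/seteqP; split=> z //; rewrite /Nball /= => h.
  by have := lt_le_trans h d0; rewrite ltNge N_ge0.
have cc : Nball c d c by rewrite /Nball /= subrr N0.
rewrite (_ : Nball c d = \bigcup_(z in Nball c d) I z).
  apply: bigcup_connected.
    exists c => z _; exists 0; first by rewrite /= in_itv /= lexx ler01.
    by rewrite /seg rmorph0 mul0r addr0.
  move=> z _; apply: connected_continuous_connected; first exact: segment_connected.
  apply: continuous_subspaceT => s P /(nbhs_NP HN) [e e0 he].
  have zc0 : 0 < N (z - c) + 1 by rewrite ltr_wpDl // N_ge0.
  apply/nbhs_ballP; exists (e / (N (z - c) + 1)) => [|s' hs']; first by rewrite /= divr_gt0.
  apply: he; have -> : seg c z s' - seg c z s = io (s' - s) * (z - c).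
    by rewrite /seg rmorphB; ring.
  rewrite NM N_io; move: hs'; rewrite /ball /= distrC ltr_pdivlMr //.
  by move=> /(le_lt_trans _); apply; rewrite ler_wpM2l // lerDl.
apply/seteqP; split=> [z hz|w [z hz [s s01 <-]]].
  exists z => //; exists 1; first by rewrite /= in_itv /= lexx ler01.
  by rewrite /seg rmorph1 mul1r subrKC.
by apply: seg_Nball => //; rewrite /= in_itv /= in s01.
Qed.

Lemma cst_of_derive0 (U : set K) (f : K -> K) : open U -> connected U ->
  (forall z, U z -> is_derive z 1 f 0) -> forall z w, U z -> U w -> f z = f w.
Proof.
move=> oU cU df z w Uz Uw.
apply: (connected_near_ind (P := fun z => f z = f w) (z0 := w) cU) => // {Uz}z Uz.
have [d d0 hd] := (open_NP HN U).1 oU z Uz.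
apply/(nbhs_NP HN); exists d => // v hv.
have zz : Nball z d z by rewrite /Nball /= subrr N0.
have := @mean_value_ball f (fun=> 0) z d z v 0.
move=> /(_ _ zz hv); rewrite mul0r => h.
have -> : f v = f z.
  apply/eqP; rewrite -subr_eq0 -N_eq0 eq_le N_ge0 andbT h //.
  by move=> x hx; split; [exact/df/hd|rewrite N0].
by [].
Qed.

End MeanValue.

(** * Existence for linear equations *)

Section LinearODE.
Variables (R : realType) (K : numFieldType) (io : {rmorphism R -> K}) (N : K -> R).
Hypothesis HN : real_norm io N.
Let N_ge0 := N_ge0 HN. Let N_eq0 := N_eq0 HN. Let N0 := N0 HN. Let NM := NM HN.
Let ND := ND HN. Let NN := NN HN. Let Ndist := Ndist HN. Let N_tri := N_tri HN.
Let NV := NV HN. Let N_io := N_io HN. Let N_sum := N_sum HN.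
Let seg_Nball := seg_Nball HN. Let mean_value_ball := mean_value_ball HN.
Let le_of_N_cvg := le_of_N_cvg HN. Let N_cvg_unique := N_cvg_unique HN.
Local Notation seg := (seg io).
Local Notation Nball := (Nball N).
Implicit Types (x y z : K) (e : R).

Variables (c : K) (d : R).
Hypothesis d0 : 0 < d.
Local Notation W := (Nball c d).

Lemma center_Nball : W c. Proof. by rewrite /Nball /= subrr N0. Qed.

Definition ucvg (u : nat -> K -> K) (f : K -> K) :=
  forall e, 0 < e -> exists n, forall m, (n <= m)%N ->
    forall z, W z -> N (u m z - f z) <= e.

Definition ucauchy (u : nat -> K -> K) :=
  forall e, 0 < e -> exists n, forall m p, (n <= m)%N -> (n <= p)%N ->
    forall z, W z -> N (u m z - u p z) <= e.

Lemma ucvg_pt u f z : W z -> ucvg u f ->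
  forall e, 0 < e -> exists n, forall m, (n <= m)%N -> N (u m z - f z) <= e.
Proof. by move=> Wz uf e e0; have [n h] := uf e e0; exists n => m /h; apply. Qed.

Lemma ucauchy_ucvg u : ucauchy u -> exists f, ucvg u f.
Proof.
move=> cu.
have lim z : exists l, W z -> forall e, 0 < e -> exists n, forall m, (n <= m)%N -> N (u m z - l) <= e.
  have [Wz|nWz] := pselect (W z); last by exists 0.
  have [|l hl] := rn_complete HN (u := fun n => u n z); last by exists l.
  by move=> e e0; have [n h] := cu e e0; exists n => m p nm np; apply: h.
exists (fun z => sval (cid (lim z))) => e e0.
have [n h] := cu e e0; exists n => m nm z Wz.
have hl := svalP (cid (lim z)) Wz; set l := sval _ in hl *.
apply: (le_of_N_cvg (u := fun p => u m z - u p z)).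
  move=> e' e'0; have [n' h'] := hl e' e'0; exists n' => p /h'.
  by rewrite (_ : _ - _ - _ = l - u p z); [rewrite Ndist|ring].
by exists n => p np; apply: h.
Qed.

Lemma ucvg_ucauchy u f : ucvg u f -> ucauchy u.
Proof.
move=> uf e e0; have e20 : 0 < e / 2 by rewrite divr_gt0.
have [n h] := uf _ e20; exists n => m p nm np z Wz.
have := N_tri (f z) (u m z) (u p z); have := h m nm z Wz; have := h p np z Wz.
by rewrite (Ndist (u p z)); lra.
Qed.

Lemma ucauchy_of_derive (u u' : nat -> K -> K) (y0 : K) :
  (forall n z, W z -> is_derive z 1 (u n) (u' n z)) ->
  (forall n, u n c = y0) -> ucauchy u' -> ucauchy u.
Proof.
move=> du uc cu' e e0; have ed0 : 0 < e / d by rewrite divr_gt0.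
have [n h] := cu' _ ed0; exists n => m p nm np z Wz.
have := @mean_value_ball (fun z => u m z - u p z) (fun z => u' m z - u' p z) c d c z (e / d).
move=> /(_ _ center_Nball Wz); rewrite !uc subrr subr0 => /(_ _)/le_trans; apply.
  by move=> x Wx; split; [exact: (is_deriveB (du m x Wx) (du p x Wx))|exact: h].
by rewrite mulrAC ler_pdivrMr // ler_wpM2l ?(ltW e0) // ltW.
Qed.

(** The differences u p - u n have small derivatives, so by the mean value inequality they are
    Lipschitz with a small constant uniform in p; letting p grow bounds f - u n in the same way. *)
Lemma is_derive_ucvg (u u' : nat -> K -> K) (f f' : K -> K) :
  (forall n z, W z -> is_derive z 1 (u n) (u' n z)) ->
  ucvg u f -> ucvg u' f' -> forall z, W z -> is_derive z 1 f (f' z).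
Proof.
move=> du uf uf' z Wz; apply/(is_derive_NP HN) => e e0.
have e40 : 0 < e / 4 by rewrite divr_gt0.
have [n hn] := uf' _ e40.
have [d1 d10 hd1] := (is_derive_NP HN _ _ _).1 (du n z Wz) _ e40.
have [d2 d20 hd2] := (open_NP HN W).1 (@open_Nball _ _ _ _ HN c d) z Wz.
exists (Num.min d1 d2) => [|w]; first by rewrite lt_min d10 d20.
rewrite lt_min => /andP[/hd1 h1 /hd2 Ww].
have hB p : (n <= p)%N ->
    N ((u p w - u n w) - (u p z - u n z)) <= e / 2 * N (w - z).
  move=> np; apply: (@mean_value_ball (fun z => u p z - u n z) (fun z => u' p z - u' n z) c d z w).
  - move=> x Wx; split; first exact: (is_deriveB (du p x Wx) (du n x Wx)).
    have := hn p np x Wx; have := hn n (leqnn n) x Wx.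
    have := N_tri (f' x) (u' p x) (u' n x); rewrite (Ndist (f' x)); lra.
  - exact: Wz.
  - exact: Ww.
have h2 : N ((f w - u n w) - (f z - u n z)) <= e / 2 * N (w - z).
  apply: (le_of_N_cvg (u := fun p => (u p w - u n w) - (u p z - u n z))); last first.
    by exists n.
  move=> e' e'0; have e'20 : 0 < e' / 2 by rewrite divr_gt0.
  have [n' h'] := uf _ e'20; exists n' => m mn.
  have := h' m mn w Ww; have := h' m mn z Wz.
  have -> : (u m w - u n w - (u m z - u n z)) - (f w - u n w - (f z - u n z)) =
    (u m w - f w) - (u m z - f z) by ring.
  have := ND (u m w - f w) (- (u m z - f z)); rewrite NN; lra.
have h3 := hn n (leqnn n) z Wz.
have -> : f w - f z - f' z * (w - z) = ((f w - u n w) - (f z - u n z)) +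
   ((u n w - u n z - u' n z * (w - z)) + (u' n z - f' z) * (w - z)) by ring.
apply: le_trans (ND _ _) _; apply: le_trans (lerD h2 (ND _ _)) _.
rewrite NM.
have := ler_wpM2r (N_ge0 (w - z)) h3; lra.
Qed.

(* Functions with two bounded derivatives on the disc; they have primitives,
   obtained as limits of Riemann sums along the rays from the centre. *)
Definition C2b (f : K -> K) := exists f1 f2 M, forall z, W z ->
  [/\ is_derive z 1 f (f1 z), is_derive z 1 f1 (f2 z),
      N (f z) <= M, N (f1 z) <= M & N (f2 z) <= M].

Lemma C2b_cst a : C2b (fun=> a).
Proof.
exists (fun=> 0), (fun=> 0), (N a) => z _; rewrite N0; split=> //.
- exact: is_derive_cst.
- exact: is_derive_cst.
Qed.

Lemma C2b_add f g : C2b f -> C2b g -> C2b (fun z => f z + g z).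
Proof.
move=> [f1 [f2 [M hf]]] [g1 [g2 [M' hg]]].
exists (fun z => f1 z + g1 z), (fun z => f2 z + g2 z), (M + M') => z Wz.
have [df df1 b0 b1 b2] := hf z Wz; have [dg dg1 b'0 b'1 b'2] := hg z Wz.
by split; [exact: (is_deriveD df dg)|exact: (is_deriveD df1 dg1)|..]; rewrite (le_trans (ND _ _)) // lerD.
Qed.

Lemma is_deriveMK (f g : K -> K) z a b : is_derive z 1 f a -> is_derive z 1 g b ->
  is_derive z 1 (fun z => f z * g z) (a * g z + f z * b).
Proof.
move=> df dg; apply: is_derive_eq (is_deriveM df dg) _.
by rewrite /GRing.scale /= addrC [g z * a]mulrC.
Qed.

Lemma is_derive_compK (f g : K -> K) z a b : is_derive z 1 g a ->
  is_derive (g z) 1 f b -> is_derive z 1 (fun z => f (g z)) (b * a).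
Proof.
move=> [dg dgE] [df dfE].
have e1 : differentiable g z by apply/derivable1_diffP.
have e2 : differentiable f (g z) by apply/derivable1_diffP.
have e3 : differentiable (f \o g) z by exact: differentiable_comp.
apply: DeriveDef; first exact/derivable1_diffP.
rewrite [LHS](deriveE _ e3) diff_comp //= -(deriveE _ e1) dgE.
by rewrite -[X in 'd f _ X]mulr1 -[_ * 1]/(_ *: 1) linearZ -deriveE // dfE mulrC.
Qed.

Lemma C2b_mul f g : C2b f -> C2b g -> C2b (fun z => f z * g z).
Proof.
move=> [f1 [f2 [M hf]]] [g1 [g2 [M' hg]]].
exists (fun z => f1 z * g z + f z * g1 z).
exists (fun z => (f2 z * g z + f1 z * g1 z) + (f1 z * g1 z + f z * g2 z)).
exists (M * M' *+ 4) => z Wz.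
have [df df1 b0 b1 b2] := hf z Wz; have [dg dg1 b'0 b'1 b'2] := hg z Wz.
have p a b : N a <= M -> N b <= M' -> N (a * b) <= M * M'.
  by move=> ha hb; rewrite NM ler_pM.
have M0 : 0 <= M * M' by rewrite mulr_ge0 ?(le_trans (N_ge0 _) b0) ?(le_trans (N_ge0 _) b'0).
split.
- exact: is_deriveMK.
- exact: (is_deriveD (is_deriveMK df1 dg) (is_deriveMK df dg1)).
- have := p _ _ b0 b'0; lra.
- have := ND (f1 z * g z) (f z * g1 z); have := p _ _ b1 b'0; have := p _ _ b0 b'1; lra.
- have := ND (f2 z * g z + f1 z * g1 z) (f1 z * g1 z + f z * g2 z).
  have := ND (f2 z * g z) (f1 z * g1 z); have := ND (f1 z * g1 z) (f z * g2 z).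
  have := p _ _ b2 b'0; have := p _ _ b1 b'1; have := p _ _ b0 b'2; lra.
Qed.

Lemma C2b_sum n (f : 'I_n -> K -> K) : (forall i, C2b (f i)) ->
  C2b (fun z => \sum_(i < n) f i z).
Proof.
elim: n f => [|n IH] f hf.
  by under eq_fun do rewrite big_ord0; exact: C2b_cst.
under eq_fun do rewrite big_ord_recl; apply: C2b_add => //.
by apply: IH => i; exact: hf.
Qed.

Lemma C2b_opp f : C2b f -> C2b (fun z => - f z).
Proof.
move=> hf; have := C2b_mul (C2b_cst (-1)) hf; congr C2b.
by apply/funext => z; rewrite mulN1r.
Qed.

Lemma seg_E a b (k n : nat) : seg a b (k%:R / n.+1%:R) = a + k%:R / n.+1%:R * (b - a).
Proof. by rewrite /seg fmorph_div !rmorph_nat. Qed.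

(** The mean value inequality is applied to g z - g1 a * z, whose derivative g1 z - g1 a is itself
    estimated by it. *)
Lemma taylor1 (g g1 g2 : K -> K) (B : R) a b : W a -> W b ->
  (forall z, W z -> [/\ is_derive z 1 g (g1 z), is_derive z 1 g1 (g2 z) & N (g2 z) <= B]) ->
  N (g b - g a - g1 a * (b - a)) <= B * N (b - a) ^+ 2.
Proof.
move=> Wa Wb hg.
have -> : g b - g a - g1 a * (b - a) = (g b - g1 a * b) - (g a - g1 a * a) by ring.
rewrite expr2 mulrA.
apply: (mean_value HN (f := fun z => g z - g1 a * z)) => s s01.
set z := seg a b s; have Wz : W z by apply: seg_Nball.
have [dg dg1 bB] := hg z Wz.
have dz : is_derive z 1 (fun z => g1 a * z) (g1 a).
  by apply: is_derive_eq (is_deriveMK (is_derive_cst (g1 a) z 1) (is_derive_id z 1)) _; rewrite mul0r add0r mulr1.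
exists (g1 z - g1 a); split; first exact: (is_deriveB dg dz).
apply: le_trans (_ : B * N (z - a) <= _).
  by apply: (@mean_value_ball g1 g2 c d a z B) => // x Wx; have [_ ? ?] := hg x Wx.
rewrite ler_wpM2l ?(le_trans (N_ge0 _) bB) //.
have -> : z - a = io s * (b - a) by rewrite /z /seg; ring.
rewrite NM N_io ger0_norm; last by case/andP: s01.
by rewrite ler_piMl //; case/andP: s01.
Qed.

Definition ray (n k : nat) z : K := c + k%:R / n.+1%:R * (z - c).

Lemma ray_W n k z : (k <= n.+1)%N -> W z -> W (ray n k z).
Proof.
move=> kn Wz; rewrite /ray -seg_E; apply: seg_Nball => //; first exact: center_Nball.
by rewrite divr_ge0 ?ler0n //= ler_pdivrMr ?ltr0n // mul1r ler_nat.
Qed.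

(** [u n] is the Riemann sum of f on the segment from c to z. Its derivative [u' n] is a mean of
    values of g1, the derivative of g z = (z - c) f z, so (z - c) u' n is a Riemann sum of g1, with
    limit g z - g c = (z - c) f z. Thus u' n tends uniformly to f, and u n converges because its
    derivatives do. The second derivative of f enters through the error bound for g. *)
Lemma C2b_primitive f : C2b f -> exists F, F c = 0 /\
  forall z, W z -> is_derive z 1 F (f z).
Proof.
move=> [f1 [f2 [M hf]]].
have M0 : 0 <= M by have [_ _ b _ _] := hf c center_Nball; rewrite (le_trans (N_ge0 _) b).
pose g z := (z - c) * f z; pose g1 z := f z + (z - c) * f1 z.
pose g2 z := f1 z + (f1 z + (z - c) * f2 z).
have dc z : is_derive z 1 (fun z => z - c) 1.
  by apply: is_derive_eq (is_deriveB (is_derive_id z 1) (is_derive_cst c z 1)) _; rewrite subr0.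
pose B := M + (M + d * M).
have hg z : W z -> [/\ is_derive z 1 g (g1 z), is_derive z 1 g1 (g2 z) & N (g2 z) <= B].
  move=> Wz; have [df df1 b0 b1 b2] := hf z Wz; split.
  - by apply: is_derive_eq (is_deriveMK (dc z) df) _; rewrite mul1r.
  - apply: is_derive_eq (is_deriveD df (is_deriveMK (dc z) df1)) _.
    by rewrite mul1r.
  - apply: le_trans (ND _ _) _; apply: lerD => //; apply: le_trans (ND _ _) _.
    by apply: lerD => //; rewrite NM ler_pM // ltW.
have B0 : 0 <= B by have [_ _ b] := hg c center_Nball; rewrite (le_trans (N_ge0 _) b).
pose u n z := n.+1%:R^-1 * ((z - c) * \sum_(k < n.+1) f (ray n k z)).
pose u' n z := n.+1%:R^-1 * \sum_(k < n.+1) g1 (ray n k z).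
have du n z : W z -> is_derive z 1 (u n) (u' n z).
  move=> Wz.
  have dray k x : is_derive x 1 (ray n k) (k%:R / n.+1%:R).
    have := is_deriveD (is_derive_cst c x 1) (is_deriveMK (is_derive_cst (k%:R / n.+1%:R : K) x 1) (dc x)).
    by move=> h; apply: is_derive_eq h _; rewrite mul0r add0r mulr1 add0r.
  have dfk (k : 'I_n.+1) : is_derive z 1 (fun z => f (ray n k z)) (k%:R / n.+1%:R * f1 (ray n k z)).
    have [dfr _ _ _ _] := hf _ (ray_W (ltnW (ltn_ord k)) Wz).
    by rewrite mulrC; exact: is_derive_compK (dray k z) dfr.
  have dS := is_derive_sum dfk.
  have := is_deriveMK (is_derive_cst (n.+1%:R^-1 : K) z 1) (is_deriveMK (dc z) dS).
  rewrite (_ : (fun z0 => _) = u n); last first.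
    by apply/funext => x; rewrite /u /= fct_sumE.
  move=> h; apply: is_derive_eq h _; rewrite mul0r add0r mul1r /u'; congr (_ * _).
  rewrite fct_sumE mulr_sumr -big_split; apply: eq_bigr => k _ /=.
  by rewrite /g1 [in ray _ _ _ - c]/ray addrAC subrr add0r; ring.
have uu' : ucvg u' f.
  move=> e e0; have [n hn] : exists n : nat, B * d / e < n.+1%:R.
    exists (Num.truncn (B * d / e)); apply: lt_le_trans (truncnS_gt _) _ => //.
  exists n => m nm z Wz.
  have m0 : 0 < m.+1%:R :> R by rewrite ltr0n.
  have mK0 : m.+1%:R != 0 :> K by rewrite pnatr_eq0.
  have bound : N (u' m z - f z) <= B * d / m.+1%:R.
    (* Away from the centre the estimate is multiplied by N (z - c), which turns it into the error
       of a telescoping sum. *)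
    have [zc|zc] := eqVneq z c.
      have -> : u' m z = f z.
        rewrite zc /u' (eq_bigr (fun=> f c)).
          by rewrite sumr_const card_ord -[f c *+ _]mulr_natl mulrA mulVf // mul1r.
        by move=> k _; rewrite /ray /g1 subrr mulr0 addr0 subrr mul0r addr0.
      by rewrite subrr N0 divr_ge0 ?mulr_ge0 // ltW.
    have Nzc0 : 0 < N (z - c) by rewrite lt_neqAle eq_sym N_eq0 subr_eq0 zc N_ge0.
    rewrite -(ler_pM2l Nzc0) -NM.
    pose h := (z - c) / m.+1%:R.
    have -> : (z - c) * (u' m z - f z) =
       - \sum_(k < m.+1) (g (ray m k.+1 z) - g (ray m k z) - g1 (ray m k z) * h).
      rewrite sumrB -mulr_suml.
      have -> : \sum_(k < m.+1) (g (ray m k.+1 z) - g (ray m k z)) = g z.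
        rewrite -(big_mkord xpredT (fun k => g (ray m k.+1 z) - g (ray m k z))).
        rewrite telescope_sumr // /ray divff // mul1r mul0r mul0r addr0 subrKC.
        by rewrite /g subrr mul0r subr0.
      by rewrite /g /u' /h; ring.
    rewrite NN; apply: le_trans (N_sum _) _.
    apply: le_trans (_ : \sum_(k < m.+1) B * N h ^+ 2 <= _).
      apply: ler_sum => k _.
      have rk : ray m k.+1 z - ray m k z = h by rewrite /ray /h -natr1; field.
      rewrite -rk; apply: (taylor1 (g2 := g2)) => //; apply: ray_W => //.
      by rewrite ltnW // ltnS ltn_ord.
    have Nm : N m.+1%:R = m.+1%:R by rewrite -(rmorph_nat io) N_io normr_nat.
    rewrite sumr_const card_ord -[_ *+ m.+1]mulr_natl /h NM NV Nm.
    have -> : m.+1%:R * (B * (N (z - c) / m.+1%:R) ^+ 2) =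
      N (z - c) * (B * N (z - c) / m.+1%:R).
      by field; rewrite gt_eqF.
    by rewrite ler_pM2l // ler_pM2r ?invr_gt0 // ler_wpM2l // ltW.
  apply: le_trans bound _; rewrite ler_pdivrMr //.
  move: hn; rewrite ltr_pdivrMr // => /ltW/le_trans; apply.
  by rewrite mulrC ler_pM2l // ler_nat.
have u0 n : u n c = 0 by rewrite /u subrr mul0r mulr0.
have [F uF] := ucauchy_ucvg (ucauchy_of_derive du u0 (ucvg_ucauchy uu')).
exists F; split; last exact: is_derive_ucvg du uF uu'.
apply: (N_cvg_unique (u := fun n => u n c)); first exact: ucvg_pt center_Nball uF.
by move=> e e0; exists 0%N => m _; rewrite u0 subrr N0 ltW.
Qed.

End LinearODE.

(** * Picard iteration for the highest derivative *)

Section Picard.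
Variables (R : realType) (K : numFieldType) (io : {rmorphism R -> K}) (N : K -> R).
Hypothesis HN : real_norm io N.
Let N_ge0 := N_ge0 HN. Let N0 := N0 HN. Let NM := NM HN.
Let NN := NN HN. Let Ndist := Ndist HN. Let N_tri := N_tri HN.
Let N_sum := N_sum HN.
Let mean_value_ball := mean_value_ball HN.
Let le_of_N_cvg := le_of_N_cvg HN. Let N_cvg_unique := N_cvg_unique HN.
Local Notation Nball := (Nball N).
Implicit Types (x y z : K) (e : R).

Variables (c : K) (d : R).
Hypothesis d0 : 0 < d.
Local Notation W := (Nball c d).
Local Notation C2b := (C2b N c d).
Let Wc : W c := center_Nball HN c d0.

Definition prim (f : K -> K) : K -> K :=
  if pselect (C2b f) is left h then sval (cid (C2b_primitive HN d0 h)) else fun=> 0.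

Lemma primP f : C2b f -> prim f c = 0 /\ forall z, W z -> is_derive z 1 (prim f) (f z).
Proof.
by move=> h; rewrite /prim; case: pselect => // h'; exact: (svalP (cid (C2b_primitive HN d0 h'))).
Qed.

Lemma prim_sub f g e : C2b f -> C2b g -> (forall z, W z -> N (f z - g z) <= e) ->
  forall z, W z -> N (prim f z - prim g z) <= d * e.
Proof.
move=> /primP[f0 df] /primP[g0 dg] fg z Wz.
have e0 : 0 <= e by rewrite (le_trans (N_ge0 _) (fg c Wc)).
have := @mean_value_ball (fun z => prim f z - prim g z) (fun z => f z - g z) c d c z e.
move=> /(_ _ Wc Wz); rewrite f0 g0 !subr0 => /(_ _)/le_trans; apply.
  by move=> x Wx; split; [exact: (is_deriveB (df x Wx) (dg x Wx))|exact: fg].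
by rewrite mulrC ler_wpM2r // ltW.
Qed.

Lemma C2b_prim f : C2b f -> C2b (prim f).
Proof.
move=> hf; have [F0 dF] := primP hf; have [f1 [f2 [M h]]] := hf.
exists f, f1, (M + d * M) => z Wz; have [df df1 b0 b1 b2] := h z Wz.
have M0 : 0 <= M by rewrite (le_trans (N_ge0 _) b0).
have dM0 : 0 <= d * M by rewrite mulr_ge0 // ltW.
split; [exact: dF|exact: df| |by rewrite (le_trans b0) // lerDl|by rewrite (le_trans b1) // lerDl].
have := @mean_value_ball (prim f) f c d c z M.
move=> /(_ _ Wc Wz); rewrite F0 subr0 => /(_ _)/le_trans; apply.
  by move=> x Wx; split; [exact: dF|have [] := h x Wx].
by rewrite mulrC -[leLHS]add0r lerD // ler_wpM2r // ltW.
Qed.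

Variables (m r : nat) (a : 'I_m -> K -> K) (Abd : R) (init : nat -> K).
Hypotheses (mr : (m < r)%N) (aC2b : forall i, C2b (a i)).
Hypotheses (aA : forall z, W z -> \sum_(i < m) N (a i z) <= Abd).
(** d <= 1 keeps iterated primitives from enlarging uniform distances, and d * Abd <= 1/2 then makes
    [pstep] a contraction with factor 1/2. *)
Hypotheses (d1 : d <= 1) (dA : d * Abd <= 2^-1).

(* [g] is the derivative of order r of the solution to be constructed, whose
   derivative of order r - j is then [iprim j g]. *)
Fixpoint iprim (j : nat) (g : K -> K) : K -> K :=
  if j is j'.+1 then fun z => init (r - j) + prim (iprim j' g) z else g.

Lemma C2b_iprim j g : C2b g -> C2b (iprim j g).
Proof.
move=> hg; elim: j => //= j IH; apply: (C2b_add HN); first exact: (C2b_cst HN).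
exact: C2b_prim.
Qed.

Lemma iprim_sub f g e : C2b f -> C2b g -> (forall z, W z -> N (f z - g z) <= e) ->
  forall j z, W z -> N (iprim j f z - iprim j g z) <= e.
Proof.
move=> hf hg fg; elim=> [//|j IH] z Wz /=.
have e0 : 0 <= e by rewrite (le_trans (N_ge0 _) (fg c Wc)).
have -> (x y w : K) : x + y - (x + w) = y - w by ring.
apply: le_trans (prim_sub (C2b_iprim j hf) (C2b_iprim j hg) IH Wz) _.
by rewrite ler_piMl.
Qed.

Lemma iprimS_sub f g e : C2b f -> C2b g -> (forall z, W z -> N (f z - g z) <= e) ->
  forall j z, W z -> N (iprim j.+1 f z - iprim j.+1 g z) <= d * e.
Proof.
move=> hf hg fg j z Wz /=.
have -> (x y w : K) : x + y - (x + w) = y - w by ring.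
apply: prim_sub => //; [exact: C2b_iprim|exact: C2b_iprim|exact: iprim_sub].
Qed.

(** A fixed point is the r-th derivative of a solution whose lower derivatives are recovered by
    [iprim]. *)
Definition pstep (g : K -> K) : K -> K :=
  fun z => - \sum_(k < m) a k z * iprim (r - k) g z.

Lemma C2b_step g : C2b g -> C2b (pstep g).
Proof.
move=> hg; apply: (C2b_opp HN); apply: (C2b_sum HN) => i.
by apply: (C2b_mul HN); [exact: aC2b|exact: C2b_iprim].
Qed.

Lemma pstep_sub f g e : C2b f -> C2b g -> (forall z, W z -> N (f z - g z) <= e) ->
  forall z, W z -> N (pstep f z - pstep g z) <= e / 2.
Proof.
move=> hf hg fg z Wz.
have e0 : 0 <= e by rewrite (le_trans (N_ge0 _) (fg c Wc)).
rewrite /pstep -opprD NN -sumrB; apply: le_trans (N_sum _) _.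
apply: le_trans (_ : \sum_(k < m) N (a k z) * (d * e) <= _).
  apply: ler_sum => k _; rewrite -mulrBr NM ler_wpM2l //.
  have -> : (r - k)%N = (r - k.+1).+1 by rewrite subnSK // (ltn_trans (ltn_ord k)).
  exact: iprimS_sub.
rewrite -mulr_suml mulrA mulrC ler_wpM2l //.
apply: le_trans dA; rewrite mulrC ler_wpM2l ?(ltW d0) //; exact: aA.
Qed.

Definition pseq n := iter n pstep (fun=> 0).

Lemma C2b_pseq n : C2b (pseq n).
Proof. by elim: n => [|n IH] /=; [exact: (C2b_cst HN)|exact: C2b_step]. Qed.

Lemma pseq_cauchy : exists2 E, 0 <= E & forall n k z, W z ->
  N (pseq (n + k) z - pseq n z) <= E / 2 ^+ n.
Proof.
have [f1 [f2 [M hM]]] := C2b_pseq 1.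
have M0 : 0 <= M by have [_ _ b _ _] := hM c Wc; rewrite (le_trans (N_ge0 _) b).
(* The bound 2M reproduces itself: if an iterate is within 2M of [pseq 0] = 0, the next is within M
   of [pseq 1], which is within M of 0. *)
exists (2 * M); first by rewrite mulr_ge0.
elim=> [|n IH] k z Wz.
  rewrite expr0 divr1 add0n; elim: k z Wz => [|k IH] z Wz.
    by rewrite subrr N0 mulr_ge0.
  have h1 : N (pseq k.+1 z - pseq 1 z) <= M.
    have := pstep_sub (C2b_pseq k) (C2b_pseq 0) IH Wz.
    by rewrite mulrAC divff ?pnatr_eq0 // mul1r.
  have [_ _ h2 _ _] := hM z Wz.
  have := N_tri (pseq 1 z) (pseq k.+1 z) (pseq 0 z); rewrite [pseq 0 z]/= subr0.
  rewrite subr0; lra.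
rewrite addSn exprSr invfM mulrA.
by apply: (pstep_sub (C2b_pseq _) (C2b_pseq _)) => // x Wx; exact: IH.
Qed.

Lemma exists_geometric (E e : R) : 0 <= E -> 0 < e -> exists n0, forall n, (n0 <= n)%N -> E / 2 ^+ n <= e.
Proof.
move=> E0 e0; exists (Num.truncn (E / e)) => n nE.
have h : E / e < n.+1%:R.
  by apply: lt_le_trans (truncnS_gt _) _; rewrite ler_nat ltnS.
rewrite ler_pdivrMr ?exprn_gt0 // mulrC -ler_pdivrMr //.
apply: le_trans (ltW h) _; rewrite -natrX ler_nat; exact: ltn_expl.
Qed.

Theorem picard : exists y : nat -> K -> K,
  [/\ forall k, (k < r)%N -> y k c = init k,
      forall k z, (k < r)%N -> W z -> is_derive z 1 (y k) (y k.+1 z) &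
      forall z, W z -> y r z = - \sum_(k < m) a k z * y k z].
Proof.
have [E E0 hE] := pseq_cauchy.
have hJ j n p z : W z -> (n <= p)%N ->
    N (iprim j (pseq n) z - iprim j (pseq p) z) <= E / 2 ^+ n.
  move=> Wz np; apply: iprim_sub => //; try exact: C2b_pseq.
  by move=> x Wx; rewrite Ndist -(subnKC np); exact: hE.
have cJ j : ucauchy N c d (fun n => iprim j (pseq n)).
  move=> e e0; have [n0 hn0] := exists_geometric E0 e0; exists n0.
  suff h m' p z : (n0 <= m')%N -> (m' <= p)%N -> W z ->
      N (iprim j (pseq m') z - iprim j (pseq p) z) <= e.
    move=> m' p hm hp z Wz; have [mp|pm] := leqP m' p; first exact: h.
    by rewrite Ndist; apply: h => //; exact: ltnW.
  by move=> nm mp Wz; apply: le_trans (hJ _ _ _ _ Wz mp) _; exact: hn0.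
have /choice [Y hY] : forall j, exists f, ucvg N c d (fun n => iprim j (pseq n)) f.
  by move=> j; exact: (ucauchy_ucvg HN (cJ j)).
have rate j n z : W z -> N (iprim j (pseq n) z - Y j z) <= E / 2 ^+ n.
  move=> Wz.
  apply: (le_of_N_cvg (u := fun p => iprim j (pseq n) z - iprim j (pseq p) z)).
    move=> e e0; have [n' h'] := ucvg_pt Wz (hY j) e0; exists n' => p /h'.
    by rewrite (_ : _ - _ - _ = Y j z - iprim j (pseq p) z); [rewrite Ndist|ring].
  by exists n => p; exact: hJ.
(* [Y j] is the limit of the j-fold primitives, so the derivative of order k is [Y (r - k)]. *)
exists (fun k => Y (r - k)%N); split.
- move=> k kr; apply: (N_cvg_unique (u := fun n => iprim (r - k) (pseq n) c)).
    exact: ucvg_pt Wc (hY _).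
  move=> e e0; exists 0%N => n _; rewrite -subnSK //= subnSK // subKn ?(ltnW kr) //.
  have [-> _] := primP (C2b_iprim (r - k.+1) (C2b_pseq n)).
  by rewrite addr0 subrr N0 ltW.
- move=> k z kr Wz; rewrite -subnSK //.
  apply: (is_derive_ucvg HN _ (hY (r - k.+1).+1) (hY (r - k.+1)%N) Wz).
  move=> n x Wx /=.
  have [_ dP] := primP (C2b_iprim (r - k.+1) (C2b_pseq n)).
  have := is_deriveD (is_derive_cst (init (r - (r - k.+1).+1)) x 1) (dP x Wx).
  by rewrite add0r.
move=> z Wz; rewrite subnn.
apply: (N_cvg_unique (u := fun n => pseq n.+1 z)).
  move=> e e0; have [n h] := ucvg_pt Wz (hY 0%N) e0; exists n => p np.
  exact: (h p.+1 (leqW np)).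
move=> e e0.
have A0 : 0 <= Abd by rewrite (le_trans _ (aA Wz)) // sumr_ge0.
have [n0 h] := exists_geometric (mulr_ge0 E0 A0) e0; exists n0 => n nn0.
rewrite /= /pstep -opprD NN -sumrB; apply: le_trans (N_sum _) _.
apply: le_trans (_ : \sum_(k < m) N (a k z) * (E / 2 ^+ n) <= _).
  by apply: ler_sum => k _; rewrite -mulrBr NM ler_wpM2l // rate.
rewrite -mulr_suml; apply: le_trans (h n nn0).
by rewrite [leLHS]mulrC [leRHS]mulrAC ler_wpM2l ?aA // divr_ge0 // exprn_ge0.
Qed.

End Picard.

Section Derivatives.
Variable K : numFieldType.

Lemma derive1n_eq (U : set K) (f g : K -> K) : open U ->
  (forall z, U z -> f z = g z) -> forall k z, U z -> derive1n k f z = derive1n k g z.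
Proof.
move=> oU fg; elim=> [|k IH] z Uz; first exact: fg.
rewrite !derive1nS !derive1E; apply: near_eq_derive; exact: near_open Uz IH.
Qed.

Lemma derive1n_chain (U : set K) (r : nat) (y : nat -> K -> K) : open U ->
  (forall k z, (k < r)%N -> U z -> is_derive z 1 (y k) (y k.+1 z)) ->
  forall k z, (k <= r)%N -> U z -> derive1n k (y 0%N) z = y k z.
Proof.
move=> oU dy; elim=> [//|k IH] z kr Uz.
rewrite derive1nS derive1E (near_eq_derive (g := y k)).
  by have [_ ->] := dy k z kr Uz.
by apply: near_open Uz _ => // w Uw; apply: IH => //; exact: ltnW.
Qed.

Lemma upto_derive1 n (U : set K) (f f' : K -> K) : open U ->
  (forall z, U z -> is_derive z 1 f (f' z)) -> differentiable_upto n U f' ->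
  differentiable_upto n.+1 U f.
Proof.
move=> oU df sf'.
have df' z : U z -> differentiable f z.
  by move=> Uz; apply/derivable1_diffP; have [] := df z Uz.
split=> // v; apply: upto_eq (upto_mul oU (upto_cst n U v) sf') => // z Uz.
have [_ <-] := df z Uz; have dz := df' z Uz; rewrite !deriveE //.
by rewrite -[in RHS](mulr1 v) -[_ * 1]/(_ *: 1) linearZ.
Qed.

Lemma smooth_is_derive (U : set K) (f : K -> K) z : smooth_on U f -> U z ->
  is_derive z 1 f (derive1 f z).
Proof.
move=> sf Uz; rewrite derive1E; have [df _] := sf 1%N.
by apply: derivableP; apply/derivable1_diffP; exact: df.
Qed.

Lemma smooth_derive1 (U : set K) (f : K -> K) : smooth_on U f -> smooth_on U (derive1 f).
Proof.
move=> sf n; have [_ /(_ 1)] := sf n.+1; congr differentiable_upto.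
by apply/funext => z; rewrite derive1E.
Qed.

Lemma smooth_derive1n (U : set K) (f : K -> K) k : smooth_on U f -> smooth_on U (derive1n k f).
Proof. by move=> sf; elim: k => [//|k IH]; rewrite derive1nS; exact: smooth_derive1. Qed.

Lemma smooth_derive1n_chain (U : set K) (f : K -> K) k z : smooth_on U f -> U z ->
  is_derive z 1 (derive1n k f) (derive1n k.+1 f z).
Proof.
by move=> sf Uz; rewrite derive1nS; apply: smooth_is_derive Uz; exact: smooth_derive1n.
Qed.

Lemma smooth_continuous (U : set K) (f : K -> K) z : smooth_on U f -> U z ->
  f w @[w --> z] --> f z.
Proof. by move=> sf Uz; exact: is_derive1_cvg (smooth_is_derive sf Uz). Qed.

End Derivatives.

(** * Regularity and uniqueness for linear homogeneous equations *)

Section LinearChains.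
Variables (R : realType) (K : numFieldType) (io : {rmorphism R -> K}) (N : K -> R).
Hypothesis HN : real_norm io N.
Let N_ge0 := N_ge0 HN. Let N_eq0 := N_eq0 HN. Let N0 := N0 HN. Let NM := NM HN.
Let NN := NN HN. Let N_tri := N_tri HN.
Let N_sum := N_sum HN.
Local Notation Nball := (Nball N).

Variables (m r : nat) (a : 'I_m -> K -> K).
Hypothesis mr : (m < r)%N.

Definition chain (U : set K) (y : nat -> K -> K) :=
  (forall k z, (k < r)%N -> U z -> is_derive z 1 (y k) (y k.+1 z)) /\
  (forall z, U z -> y r z = - \sum_(k < m) a k z * y k z).

(** Bootstrapping: order n for all y k gives order n + 1 for k < r, since y k.+1 is the derivative
    of y k, and then for y r through the equation. *)
Lemma upto_chain (U : set K) (y : nat -> K -> K) : open U ->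
  (forall i, smooth_on U (a i)) -> chain U y ->
  forall n k, (k <= r)%N -> differentiable_upto n U (y k).
Proof.
move=> oU sa [dy ey].
have top n : (forall k, (k < r)%N -> differentiable_upto n U (y k)) -> differentiable_upto n U (y r).
  move=> h; pose s z := \sum_(k < m) a k z * y k z.
  apply: (upto_eq (f := fun z => - s z)) => // [z Uz|]; first by rewrite ey.
  apply: upto_opp => //; apply: upto_sum => // i; apply: upto_mul => //.
    exact: sa.
  by apply: h; exact: ltn_trans mr.
elim=> [//|n IH].
have below k : (k < r)%N -> differentiable_upto n.+1 U (y k).
  move=> kr; apply: (upto_derive1 (f' := y k.+1)) => // [z Uz|]; first exact: dy.
  exact: IH.
move=> k; rewrite leq_eqVlt => /orP[/eqP ->|/below //]; exact: top.
Qed.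

Lemma near_N_bounded (f : K -> K) z : f w @[w --> z] --> f z ->
  \forall w \near z, N (f w) <= N (f z) + 1.
Proof.
move=> /(cvg_NP HN) h; have [e e0 he] := h 1 ltr01.
apply/(nbhs_NP HN); exists e => // w /he hw.
have := N_tri (f z) (f w) 0; rewrite !subr0; lra.
Qed.

Lemma near_ord n (P : 'I_n -> K -> Prop) (z : K) :
  (forall i, \forall w \near z, P i w) -> \forall w \near z, forall i, P i w.
Proof. by move=> h; exact: filter_forall h. Qed.

(** That all v k with k < r vanish is a locally constant condition. Where some v k is nonzero this
    is continuity. Where all vanish, the bound 1 on a small disc can be halved repeatedly: v k is
    controlled by d times the bound of v k.+1, and the last one by d * A times the bound of the
    others. *)
Lemma chain_zero (U : set K) (v : nat -> K -> K) z0 : open U -> connected U ->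
  (forall i z, U z -> a i w @[w --> z] --> a i z) ->
  chain U v -> U z0 -> (forall k, (k < r)%N -> v k z0 = 0) ->
  forall z, U z -> forall k, (k < r)%N -> v k z = 0.
Proof.
move=> oU cU ca [dv ev] Uz0 v0.
apply: (connected_near_ind (z0 := z0) cU) => // z Uz.
have cv k : (k < r)%N -> v k w @[w --> z] --> v k z.
  by move=> kr; exact: is_derive1_cvg (dv k z kr Uz).
have [Pz|nPz] := pselect (forall k, (k < r)%N -> v k z = 0); last first.
  have /existsNP[k /not_implyP[kr /eqP vk0]] := nPz.
  have h : \forall w \near z, v k w != 0.
    exact: (near_cvg_open (@open_neq0 K) (cv k kr) vk0).
  by apply: filterS h => w vkw; split=> // Pw; rewrite Pw ?eqxx in vkw.
have hB : \forall w \near z, forall k : 'I_r, N (v k w) <= 1.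
  apply: near_ord => k; have := near_N_bounded (cv k (ltn_ord k)).
  by apply: filterS => w; rewrite Pz // N0 add0r.
pose A : R := \sum_(i < m) (N (a i z) + 1).
have hA : \forall w \near z, forall i : 'I_m, N (a i w) <= N (a i z) + 1.
  by apply: near_ord => i; apply: near_N_bounded; exact: ca.
have A0 : 0 <= A by apply: sumr_ge0 => i _; rewrite addr_ge0.
have hU : \forall w \near z, U w by exact: (near_open oU Uz).
have [e e0 he] := (nbhs_NP HN z _).1 (filterI hU (filterI hB hA)).
(* As d * (A + 1) <= 1/2 and A >= 0, both d and d * A are at most 1/2. *)
pose d := Num.min e (2^-1 / (A + 1)).
have A1 : 0 < A + 1 by rewrite ltr_wpDl.
have d0 : 0 < d by rewrite lt_min e0 divr_gt0 ?invr_gt0.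
have dA : d * A <= 2^-1.
  have : d * (A + 1) <= 2^-1 by rewrite -ler_pdivlMr // ge_min lexx orbT.
  by apply: le_trans; rewrite ler_wpM2l ?(ltW d0) // lerDl.
have d12 : d <= 2^-1.
  have : d * (A + 1) <= 2^-1 by rewrite -ler_pdivlMr // ge_min lexx orbT.
  by apply: le_trans; rewrite ler_peMr ?(ltW d0) // lerDr.
have inb w : Nball z d w -> [/\ U w, forall k, (k < r)%N -> N (v k w) <= 1
    & \sum_(i < m) N (a i w) <= A].
  rewrite /Nball /= lt_min => /andP[/he [Uw [Bw Aw]] _]; split=> //.
    by move=> k kr; exact: (Bw (Ordinal kr)).
  by apply: ler_sum => i _; exact: Aw.
have zb : Nball z d z by exact: (center_Nball HN z d0).
have small n : forall k w, (k < r)%N -> Nball z d w -> N (v k w) <= 1 / 2 ^+ n.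
  elim: n => [|n IH] k w kr wb.
    by rewrite expr0 divr1; have [_ h _] := inb w wb; exact: h.
  have pn : 0 <= 1 / 2 ^+ n :> R by rewrite divr_ge0 // exprn_ge0.
  have mv M : (forall x, Nball z d x -> N (v k.+1 x) <= M) -> N (v k w) <= M * d.
    move=> hM; have M0 : 0 <= M by rewrite (le_trans (N_ge0 _) (hM z zb)).
    have := @mean_value_ball _ _ _ _ HN (v k) (v k.+1) z d z w M.
    move=> /(_ _ zb wb); rewrite Pz // subr0 => /(_ _)/le_trans; apply.
      by move=> x xb; split; [have [Ux _ _] := inb x xb; exact: dv|exact: hM].
    by rewrite ler_wpM2l // ltW.
  rewrite exprSr invfM mulrA.
  have := kr; rewrite leq_eqVlt => /orP[/eqP kr1|kr1].
    apply: le_trans (mv (A * (1 / 2 ^+ n)) _) _.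
      move=> x xb; have [Ux _ Ax] := inb x xb.
      rewrite kr1 ev // NN; apply: le_trans (N_sum _) _.
      apply: le_trans (_ : \sum_(i < m) N (a i x) * (1 / 2 ^+ n) <= _).
        apply: ler_sum => i _; rewrite NM ler_wpM2l //.
        by apply: IH => //; exact: ltn_trans mr.
      by rewrite -mulr_suml ler_wpM2r.
    by rewrite mulrC mulrA [leRHS]mulrC ler_wpM2r.
  apply: le_trans (mv (1 / 2 ^+ n) _) _; first by move=> x xb; exact: IH.
  by rewrite ler_wpM2l.
have Pb w : Nball z d w -> forall k, (k < r)%N -> v k w = 0.
  move=> wb k kr; apply/eqP; rewrite -N_eq0 eq_le N_ge0 andbT.
  apply/ler_addgt0Pr => e' e'0; rewrite add0r.
  have [n0 /(_ n0 (leqnn _))] := exists_geometric ler01 e'0.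
  by apply: le_trans; exact: small.
by apply/(nbhs_NP HN); exists d => // w wb; split=> _ //; exact: Pb.
Qed.

End LinearChains.

(** * Linear superposition groups *)

Section Superposition.
Variables (R : realType) (K : numFieldType) (io : {rmorphism R -> K}) (N : K -> R).
Hypothesis HN : real_norm io N.
Let N_ge0 := N_ge0 HN.
Variable r : nat.
Hypothesis r3 : (3 <= r)%N.
Local Notation m := (r - 2)%N.
Local Notation Nball := (Nball N).

Let mr : (m < r)%N. Proof. by rewrite ltn_subrL (leq_trans _ r3). Qed.

Lemma smooth_coord (U : set K) n (f : K -> 'rV[K]_n) j : open U ->
  smooth_on U f -> smooth_on U (fun t => f t 0 j).
Proof. by move=> oU sf k; apply: coord_linear_upto. Qed.

(** Provides the disc required by [picard]: it is small enough for the contraction, and the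
    coefficients have two bounded derivatives on it. *)
Lemma bounded_ball (a : 'I_m -> K -> K) (U : set K) (t0 : K) : open U ->
  (forall i, smooth_on U (a i)) -> U t0 ->
  exists d A, [/\ 0 < d, d <= 1 /\ d * A <= 2^-1, Nball t0 d `<=` U,
    (forall i, C2b N t0 d (a i)) &
    forall z, Nball t0 d z -> \sum_(i < m) N (a i z) <= A].
Proof.
move=> oU sa Ut0.
pose b j i := derive1n j (a i).
have sb j i : smooth_on U (b j i) by exact: smooth_derive1n.
have hb j : \forall w \near t0, forall i : 'I_m, N (b j i w) <= N (b j i t0) + 1.
  apply: (@near_ord _ _ (fun (i : 'I_m) w => N (b j i w) <= N (b j i t0) + 1)) => i.
  exact: (near_N_bounded HN (smooth_continuous (sb j i) Ut0)).
have [e e0 he] := (nbhs_NP HN t0 _).1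
  (filterI (near_open oU Ut0 (fun z Uz => Uz)) (filterI (hb 0%N) (filterI (hb 1%N) (hb 2%N)))).
pose A : R := \sum_(i < m) (N (a i t0) + 1).
have A0 : 0 <= A by apply: sumr_ge0 => i _; rewrite addr_ge0.
have A1 : 0 < A + 1 by rewrite ltr_wpDl.
pose d := Num.min e (Num.min 1 (2^-1 / (A + 1))).
have d0 : 0 < d by rewrite !lt_min e0 ltr01 divr_gt0 ?invr_gt0.
have ball_e z : Nball t0 d z -> N (z - t0) < e.
  by rewrite /Nball /= lt_min => /andP[].
exists d, A; split=> //.
- split; first by rewrite !ge_min lexx orbT.
  have : d * (A + 1) <= 2^-1 by rewrite -ler_pdivlMr // !ge_min lexx !orbT.
  by apply: le_trans; rewrite ler_wpM2l ?(ltW d0) // lerDl.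
- by move=> z /ball_e /he [].
- move=> i; exists (b 1%N i), (b 2%N i).
  exists ((N (b 0%N i t0) + 1) + ((N (b 1%N i t0) + 1) + (N (b 2%N i t0) + 1))).
  move=> z /ball_e /he [Uz [h0 [h1 h2]]].
  have p j : 0 <= N (b j i t0) + 1 by rewrite addr_ge0.
  split.
  + exact: (smooth_derive1n_chain 0 (sa i) Uz).
  + exact: (smooth_derive1n_chain 1 (sa i) Uz).
  + by apply: le_trans (h0 i) _; rewrite lerDl addr_ge0.
  + by apply: le_trans (h1 i) _; rewrite addrCA lerDl addr_ge0.
  + by apply: le_trans (h2 i) _; rewrite addrA lerDr addr_ge0.
- by move=> z /ball_e /he [_ [h0 _]]; apply: ler_sum => i _; exact: h0.
Qed.

Lemma hom_chain_solution (E : equation 'rV[K]_(r - 2)) (W : set K) y :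
  open W -> W `<=` eq_dom E ->
  chain r (fun i t => eq_par E t 0 i) W y ->
  solution (@laguerre_forsyth_hom K r) E W (y 0%N).
Proof.
move=> oW WE cy; have [dy ey] := cy; split.
  have sa i : smooth_on W (fun t => eq_par E t 0 i).
    move=> n; apply: (upto_sub WE); apply: smooth_coord; [exact: eq_dom_open|exact: eq_par_smooth].
  by move=> n; exact: (upto_chain mr oW sa cy).
move=> t Wt; rewrite /laguerre_forsyth_hom.
have dn k : (k <= r)%N -> derive1n k (y 0%N) t = y k t.
  by move=> kr; exact: (derive1n_chain oW dy).
rewrite dn // ey // addrC; apply/eqP; rewrite subr_eq0; apply/eqP.
by apply: eq_bigr => k _; rewrite dn // ltnW // (ltn_trans (ltn_ord k)).
Qed.

Lemma solution_hom_chain (E : equation 'rV[K]_(r - 2)) (W : set K) phi :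
  solution (@laguerre_forsyth_hom K r) E W phi ->
  chain r (fun i t => eq_par E t 0 i) W (fun k => derive1n k phi).
Proof.
move=> [sphi ephi]; split=> [k z kr Wz|z Wz]; first exact: smooth_derive1n_chain sphi Wz.
by apply/eqP; rewrite -addr_eq0; apply/eqP; exact: ephi.
Qed.

(** The basis consists of solutions with Kronecker initial data at t0, so the parameters of a
    solution are its derivatives of order less than r at t0; [chain_zero] on the connected disc
    shows that they determine it. *)
Theorem superposition_groups :
  uniform_superposition_groups r (@laguerre_forsyth_hom K r).
Proof.
move=> E t0 Et0.
pose a (i : 'I_m) t := eq_par E t 0 i.
have sa i : smooth_on (eq_dom E) (a i).
  by apply: smooth_coord; [exact: eq_dom_open|exact: eq_par_smooth].
have [d [A [d0 [d1 dA] WE aC aA]]] := bounded_ball (@eq_dom_open _ _ E) sa Et0.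
pose W := Nball t0 d.
have oW : open W by exact: (open_Nball HN).
have cW : connected W by exact: (connected_Nball HN).
have Wt0 : W t0 by exact: (center_Nball HN t0 d0).
have /choice [y hy] : forall i : 'I_r, exists y : nat -> K -> K,
    chain r a W y /\ forall k, (k < r)%N -> y k t0 = (k == i)%:R.
  move=> i; have [y [y0 dy ey]] := picard HN d0 (fun k => (k == i)%:R) mr aC aA d1 dA.
  by exists y; split=> //; split.
pose Y (e : 'rV[K]_r) k t := \sum_i e 0 i * y i k t.
have cY e : chain r a W (Y e).
  split=> [k z kr Wz|z Wz].
    have dS := is_derive_sum (fun i => is_deriveZ (e 0 i) ((hy i).1.1 k z kr Wz)).
    by apply: is_derive_eq; last (rewrite /Y; reflexivity); move: dS; rewrite /Y;
      congr (is_derive _ _ _ _); apply/funext => w; rewrite fct_sumE.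
  rewrite /Y -sumrN; under eq_bigr => i _ do rewrite (hy i).1.2 // mulrN.
  rewrite !sumrN; congr (- _).
  under eq_bigr => i _ do rewrite mulr_sumr.
  rewrite exchange_big /=; apply: eq_bigr => k _; rewrite mulr_sumr.
  by apply: eq_bigr => i _; rewrite mulrCA.
have Y0 e k (kr : (k < r)%N) : Y e k t0 = e 0 (Ordinal kr).
  rewrite /Y (bigD1 (Ordinal kr)) //= (hy _).2 // eqxx mulr1 big1 ?addr0 // => j jk.
  rewrite (hy _).2 // (_ : (k == j) = false) ?mulr0 //.
  by apply/negbTE; move: jk; rewrite -val_eqE eq_sym.
exists W; split=> //; exists (fun i => y i 0%N); split.
- by move=> e; exact: (hom_chain_solution oW WE (cY e)).
- move=> phi sphi; have cphi := solution_hom_chain sphi.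
  pose c : 'rV[K]_r := \row_i derive1n i phi t0.
  exists c; split.
    move=> z Wz; rewrite /superposition; congr (_, _ + _).
    have [dphi ephi] := cphi; have [dYc eYc] := cY c.
    have cdiff : chain r a W (fun k t => derive1n k phi t - Y c k t).
      split=> [k w kr Ww|w Ww]; first exact: (is_deriveB (dphi k w kr Ww) (dYc k w kr Ww)).
      rewrite ephi // eYc // -opprD -sumrB; congr (- _).
      by apply: eq_bigr => k _; rewrite mulrBr.
    have ca i x : W x -> a i w @[w --> x] --> a i x.
      by move=> Wx; apply: smooth_continuous (sa i) _; exact: WE.
    have zero k : (k < r)%N -> derive1n k phi t0 - Y c k t0 = 0.
      by move=> kr; rewrite (Y0 c k kr) mxE subrr.
    have r0 : (0 < r)%N by exact: leq_trans r3.
    have := chain_zero HN mr oW cW ca cdiff Wt0 zero Wz r0.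
    by move/eqP; rewrite subr_eq0 => /eqP.
  move=> e he; apply/rowP => i; rewrite mxE.
  have pe t : W t -> phi t = Y e 0%N t.
    by move=> Wt; have := he (t, 0) Wt; rewrite /superposition /= !add0r => -[].
  rewrite (derive1n_eq oW pe) // (derive1n_chain oW (cY e).1) //; last exact: ltnW.
  by rewrite (Y0 e i (ltn_ord i)); congr (e 0 _); apply: val_inj.
- move=> e e' z Wz g.
  have gD (a1 a2 : 'rV[K]_r) : g a1 (g a2 z) = g (a1 + a2) z.
    rewrite /g /superposition /= -addrA -big_split /=; congr (_, _ + _).
    by apply: eq_bigr => i _; rewrite mxE -mulrDl addrC.
  by rewrite !gD addrC.
Qed.

End Superposition.

(** * Transformations affine in x *)

Section AffineProlongation.
Variables (K : numFieldType) (U : set K) (T0 X1 X0 : K -> K).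
Hypotheses (oU : open U) (sT0 : smooth_on U T0) (sX1 : smooth_on U X1)
  (sX0 : smooth_on U X0) (T0' : forall t, U t -> derive1 T0 t != 0).

(* Coefficients of the prolongation of [t ~> T0 t, x ~> X1 t * x + X0 t]:
   the component for x^(k) is [\sum_j pcoef k j t * u j + pcst k t]. *)
Fixpoint pcoef (k j : nat) : K -> K :=
  if k is k'.+1 then fun t =>
    (derive1 (pcoef k' j) t + (if j is j'.+1 then pcoef k' j' t else 0)) /
      derive1 T0 t
  else if j is 0 then X1 else fun=> 0.

Fixpoint pcst (k : nat) : K -> K :=
  if k is k'.+1 then fun t => derive1 (pcst k') t / derive1 T0 t else X0.

Lemma pcoefS0 k t : pcoef k.+1 0 t = (derive1 (pcoef k 0) t + 0) / derive1 T0 t.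
Proof. by []. Qed.

Lemma pcoefS k j t :
  pcoef k.+1 j.+1 t = (derive1 (pcoef k j.+1) t + pcoef k j t) / derive1 T0 t.
Proof. by []. Qed.

Lemma smooth_invT : smooth_on U (fun t => (derive1 T0 t)^-1).
Proof.
by move=> n; apply: upto_inv => //; have := smooth_derive1 sT0; apply.
Qed.

Lemma smooth_pcoef k j : smooth_on U (pcoef k j).
Proof.
elim: k j => [|k IH] [|j] n //=; first exact: upto_cst.
- apply: upto_mul => //; last exact: smooth_invT.
  apply: upto_add => //; last exact: upto_cst.
  by have := smooth_derive1 (IH 0%N); apply.
- apply: upto_mul => //; last exact: smooth_invT.
  apply: upto_add => //; last exact: IH.
  by have := smooth_derive1 (IH j.+1); apply.
Qed.

Lemma smooth_pcst k : smooth_on U (pcst k).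
Proof.
elim: k => [//|k IH] n /=; apply: upto_mul => //; last exact: smooth_invT.
by have := smooth_derive1 IH; apply.
Qed.

Lemma derive1_eq0 (f : K -> K) t : U t -> (forall s, U s -> f s = 0) -> derive1 f t = 0.
Proof.
move=> Ut f0; rewrite derive1E (near_eq_derive (g := cst 0)); first exact: derive_cst.
exact: near_open Ut f0.
Qed.

Lemma pcoef_gt k j t : U t -> (k < j)%N -> pcoef k j t = 0.
Proof.
elim: k j t => [|k IH] [|j] t Ut //= kj.
rewrite IH // derive1_eq0 ?addr0 ?mul0r // => s Us; apply: IH => //; exact: ltnW.
Qed.

Lemma pcoef_diag k t : U t -> pcoef k k t = X1 t / derive1 T0 t ^+ k.
Proof.
elim: k t => [|k IH] t Ut /=; first by rewrite expr0 divr1.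
rewrite derive1_eq0 ?add0r ?IH // ?exprSr ?invfM ?mulrA //.
by move=> s Us; exact: pcoef_gt.
Qed.

Variables (A : set (K * K)) (T X : K * K -> K).
Hypotheses (oA : open A) (AU : forall t x, A (t, x) -> U t)
  (TE : forall t x, A (t, x) -> T (t, x) = T0 t)
  (XE : forall t x, A (t, x) -> X (t, x) = X1 t * x + X0 t).

Lemma near_section_t t x : A (t, x) -> \forall s \near t, A (s, x).
Proof.
move=> Az; apply: (near_cvg_open (c := fun s => (s, x)) oA) => //.
have c1 := is_derive1_cvg (is_derive_id t (1 : K)).
have c2 := is_derive1_cvg (is_derive_cst x t (1 : K)).
exact: cvg_pair c1 c2.
Qed.

Lemma near_section_x t x : A (t, x) -> \forall y \near x, A (t, y).
Proof.
move=> Az; apply: (near_cvg_open (c := fun s => (t, s)) oA) => //.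
have c1 := is_derive1_cvg (is_derive_id x (1 : K)).
have c2 := is_derive1_cvg (is_derive_cst t x (1 : K)).
exact: cvg_pair c2 c1.
Qed.

Lemma total_derivative_T t u : A (t, u 0%N) ->
  total_derivative 0 (lift_jet T) t u = derive1 T0 t.
Proof.
move=> Az; rewrite /total_derivative big_ord_recl big_ord0 addr0 /=.
rewrite /partial_t /partial_u !derive1E /lift_jet /set_coord /=.
rewrite (near_eq_derive (g := T0)); last by apply: filterS (near_section_t Az) => s /TE.
rewrite (near_eq_derive (a := u 0%N) (g := cst (T0 t))); last first.
  by apply: filterS (near_section_x Az) => s /TE.
by rewrite derive_cst mulr0 addr0.
Qed.

Lemma prolong_affine k t u : A (t, u 0%N) ->
  prolong T X k t u = \sum_(j < k.+1) pcoef k j t * u j + pcst k t.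
Proof.
elim: k t u => [|k IH] t u Az.
  by rewrite big_ord_recl big_ord0 addr0 /= /lift_jet XE.
have Ut := AU Az.
rewrite [LHS]/= total_derivative_T //.
have E1 : partial_t (prolong T X k) t u =
    \sum_(j < k.+1) derive1 (pcoef k j) t * u j + derive1 (pcst k) t.
  rewrite /partial_t derive1E.
  rewrite (near_eq_derive (g := fun s => \sum_(j < k.+1) pcoef k j s * u j + pcst k s)).
    have dS := is_derive_sum (fun j : 'I_k.+1 => is_deriveM (smooth_is_derive
      (smooth_pcoef k j) Ut) (is_derive_cst (u j) t (1 : K))).
    have [_ dE] := is_deriveD dS (smooth_is_derive (smooth_pcst k) Ut).
    rewrite [X in 'D_1 X t](_ : _ = \sum_(j < k.+1) pcoef k j * cst (u j) + pcst k).
      rewrite dE; congr (_ + _); apply: eq_bigr => j _.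
      by rewrite scaler0 add0r /GRing.scale /= mulrC.
    by apply/funext => s; rewrite !fctE fct_sumE.
  by apply: filterS (near_section_t Az) => s /IH.
have E2 i : (i < k.+1)%N -> partial_u i (prolong T X k) t u = pcoef k i t.
  move=> ik; rewrite /partial_u derive1E.
  pose g s := pcoef k i t * s +
    (\sum_(j < k.+1 | j != Ordinal ik) pcoef k j t * u j + pcst k t).
  rewrite (near_eq_derive (g := g)).
    have [_ ->] := is_deriveD (is_deriveM (is_derive_cst (pcoef k i t) (u i) 1)
      (is_derive_id (u i) (1 : K))) (is_derive_cst
        (\sum_(j < k.+1 | j != Ordinal ik) pcoef k j t * u j + pcst k t) (u i) 1).
    by rewrite scaler0 !addr0 /GRing.scale /= mulr1.
  (* Only u 0 moves the base point; for i > 0 it stays in [A]. *)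
  have : \forall s \near (u i), A (t, set_coord u i s 0%N).
    rewrite /set_coord; case: i ik {g} => [|i] ik; first exact: near_section_x.
    by near=> s.
  apply: filterS => s /IH ->; rewrite (bigD1 (Ordinal ik)) //= -addrA /g.
  congr (_ * _ + (_ + _)); first by rewrite /set_coord eqxx.
  apply: eq_bigr => j ji; rewrite /set_coord.
  by rewrite (_ : (nat_of_ord j == i) = false) //; apply/negbTE; rewrite -val_eqE in ji.
rewrite /total_derivative E1.
rewrite [X in _ + X](eq_bigr (fun i : 'I_k.+1 => u i.+1 * pcoef k i t)); last first.
  by move=> i _; rewrite E2.
rewrite (eq_bigr (fun j : 'I_k.+2 => (derive1 (pcoef k j) t * u j) / derive1 T0 t +
    ((if j : nat is j'.+1 then pcoef k j' t else 0) * u j) / derive1 T0 t)); last first.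
  by move=> j _ /=; rewrite mulrAC !mulrDl.
rewrite big_split /= -!mulr_suml -mulrDl.
rewrite [in RHS]big_ord_recr /= [derive1 (pcoef k k.+1) t]derive1_eq0 //; last first.
  by move=> s Us; apply: pcoef_gt.
rewrite mul0r addr0 [X in _ = (_ + X) / _ + _]big_ord_recl mul0r add0r -mulrDl.
rewrite addrAC; congr ((_ + _ + _) / _); apply: eq_bigr => i _.
by rewrite mulrC.
Unshelve. all: by end_near. Qed.

End AffineProlongation.

Section DeriveK.
Variable K : numFieldType.
Implicit Types (f g : K -> K) (z a b : K).

Lemma derive1_val f z a : is_derive z 1 f a -> derive1 f z = a.
Proof. by move=> [_]; rewrite derive1E. Qed.

Lemma is_deriveVK f z a : f z != 0 -> is_derive z 1 f a ->
  is_derive z 1 (fun z => (f z)^-1) (- a / f z ^+ 2).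
Proof.
move=> fz0 [df dfE]; apply: DeriveDef; first exact: derivableV.
by rewrite deriveV //= dfE; rewrite /GRing.scale /= mulNr mulrC mulNr.
Qed.

Lemma is_deriveXK f z a n : is_derive z 1 f a ->
  is_derive z 1 (fun z => f z ^+ n) (n%:R * a * f z ^+ n.-1).
Proof.
move=> df; elim: n => [|n IH].
  by rewrite !mul0r; exact: (is_derive_cst (1 : K)).
rewrite (_ : (fun z => _) = fun z => f z * f z ^+ n); last first.
  by apply/funext => w; rewrite exprS.
apply: is_derive_eq (is_deriveMK df IH) _; rewrite -[n.+1%:R]natr1 /=.
by case: n {IH} => [|n] /=; rewrite ?exprS; ring.
Qed.

Lemma derive1_on (U : set K) f g z : open U -> U z -> (forall s, U s -> f s = g s) ->
  derive1 f z = derive1 g z.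
Proof.
by move=> oU Uz fg; rewrite !derive1E; apply: near_eq_derive; exact: near_open Uz fg.
Qed.

End DeriveK.

(** * Comparison of coefficients on the source equation *)

Section ImageCoefficients.
Variables (K : numFieldType) (U : set K) (T0 X1 X0 : K -> K) (r m : nat).
Hypotheses (oU : open U) (sT0 : smooth_on U T0) (sX1 : smooth_on U X1)
  (sX0 : smooth_on U X0) (T0' : forall t, U t -> derive1 T0 t != 0).
Hypothesis mr : (m < r)%N.
Variables (A : set (K * K)) (T X : K * K -> K).
Hypotheses (oA : open A) (AU : forall t, U t <-> exists x, A (t, x))
  (TE : forall t x, A (t, x) -> T (t, x) = T0 t)
  (XE : forall t x, A (t, x) -> X (t, x) = X1 t * x + X0 t).

Local Notation pcoef := (pcoef T0 X1).
Local Notation pcst := (pcst T0 X0).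
Local Notation P := (prolong T X).

Let prolongE k t u : A (t, u 0%N) ->
  P k t u = \sum_(j < k.+1) pcoef k j t * u j + pcst k t.
Proof.
apply: (prolong_affine oU sT0 sX1 sX0 T0' oA _ TE XE) => t' x Az.
by apply/AU; exists x.
Qed.

(** The u j with j > 0 are free, whereas u 0 is confined to the fibre over t. The fibre is open,
    hence has two distinct points, and these separate the coefficient of u 0 from the constant
    term. *)
Lemma affine_form_zero (q : nat -> K) q' t n : (0 < n)%N -> U t ->
  (forall u : nat -> K, A (t, u 0%N) -> \sum_(j < n) q j * u j + q' = 0) ->
  (forall j, (j < n)%N -> q j = 0) /\ q' = 0.
Proof.
case: n => [//|n] _ /AU[x Ax] h.
have h0 y : A (t, y) -> q 0%N * y + q' = 0.
  move=> Ay; have := h (fun j => if j == 0%N then y else 0) Ay.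
  by rewrite big_ord_recl /= big1 ?addr0 // => j _; rewrite mulr0.
have [y [xy Ay]] : exists y, x != y /\ A (t, y).
  have := near_section_x oA Ax; rewrite -nbhs_nearE => /nbhs_ballP[e /= e0 he].
  have e20 : 0 < e / 2 by rewrite divr_gt0.
  have E : x - (x + e / 2) = - (e / 2) by ring.
  exists (x + e / 2); split; first by rewrite -subr_eq0 E oppr_eq0 gt_eqF.
  apply: he; rewrite -ball_normE /= E normrN gtr0_norm //.
  by rewrite ltr_pdivrMr // ltr_pMr // ltr1n.
have q0 : q 0%N = 0.
  have E0 : q 0%N * x = q 0%N * y by apply: (addIr q'); rewrite !h0.
  apply/eqP; move/eqP: E0; rewrite -subr_eq0 -mulrBr mulf_eq0 subr_eq0.
  by rewrite (negbTE xy) orbF.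
have q'0 : q' = 0 by have := h0 x Ax; rewrite q0 mul0r add0r.
split=> // -[_|j jn]; first exact: q0.
have := h (fun i => if i == 0%N then x else (i == j.+1)%:R) Ax.
rewrite q'0 addr0 (bigD1 (Ordinal jn)) //= eqxx mulr1 big1 ?addr0 // => i ij.
case: eqP => [->|_]; first by rewrite q0 mul0r.
by rewrite (_ : (_ == _) = false) ?mulr0 //; apply/negbTE; rewrite -val_eqE in ij.
Qed.

(** Extension of [a] by zero, so that sums over k < m and over j < r can be compared term by
    term. *)
Definition row_coef (a : 'rV[K]_m) (j : nat) : K :=
  \sum_(k < m) a 0 k * (k == j :> nat)%:R.

Lemma row_coefE (a : 'rV[K]_m) (k : 'I_m) : row_coef a k = a 0 k.
Proof.
rewrite /row_coef (bigD1 k) //= eqxx mulr1 big1 ?addr0 // => i ik.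
by rewrite (_ : (_ == _) = false) ?mulr0 //; apply/negbTE; rewrite -val_eqE in ik.
Qed.

Lemma row_coef_ge (a : 'rV[K]_m) j : (m <= j)%N -> row_coef a j = 0.
Proof.
move=> mj; rewrite /row_coef big1 // => k _.
by rewrite ltn_eqF ?mulr0 // (leq_trans (ltn_ord k)).
Qed.

Lemma sum_row_coef (a : 'rV[K]_m) (u : nat -> K) :
  \sum_(k < m) a 0 k * u k = \sum_(j < r) row_coef a j * u j.
Proof.
rewrite (eq_bigr (fun k : 'I_m => row_coef a k * u k)); last first.
  by move=> k _; rewrite row_coefE.
rewrite (big_ord_widen r (fun k => row_coef a k * u k) (ltnW mr)) big_mkcond /=.
apply: eq_bigr => j _; case: ifPn => //; rewrite -leqNgt => mj.
by rewrite row_coef_ge // mul0r.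
Qed.

Lemma sum_pcoef k t (u : nat -> K) : (k < r)%N -> U t ->
  \sum_(j < k.+1) pcoef k j t * u j = \sum_(j < r) pcoef k j t * u j.
Proof.
move=> kr Ut; rewrite (big_ord_widen r (fun j => pcoef k j t * u j) kr) big_mkcond /=.
apply: eq_bigr => j _; case: ifPn => //; rewrite -ltnNge => mj.
by rewrite (pcoef_gt _ _ oU) // mul0r.
Qed.

(** Eliminating u r through the source equation leaves an affine form in u 0, ..., u (r - 1), to
    which [affine_form_zero] applies. *)
Lemma lhs_affine (a a' : 'rV[K]_m) b b' t u : A (t, u 0%N) ->
  u r + \sum_(k < m) a 0 k * u k = b ->
  P r t u + \sum_(k < m) a' 0 k * P k t u - b' =
  \sum_(j < r) (pcoef r j t - pcoef r r t * row_coef a j +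
                \sum_(k < m) a' 0 k * pcoef k j t) * u j +
  (pcoef r r t * b + pcst r t + \sum_(k < m) a' 0 k * pcst k t - b').
Proof.
move=> Az ub; have Ut : U t by apply/AU; exists (u 0%N).
have ur : u r = b - \sum_(j < r) row_coef a j * u j by rewrite -sum_row_coef -ub addrK.
rewrite prolongE // big_ord_recr /= ur.
have -> : \sum_(k < m) a' 0 k * P k t u =
    \sum_(j < r) (\sum_(k < m) a' 0 k * pcoef k j t) * u j +
    \sum_(k < m) a' 0 k * pcst k t.
  rewrite [X in _ = X + _](eq_bigr (fun j : 'I_r =>
     \sum_(k < m) a' 0 k * pcoef k j t * u j)); last by move=> j _; rewrite mulr_suml.
  rewrite exchange_big -big_split; apply: eq_bigr => k _ /=.
  rewrite prolongE // sum_pcoef ?(ltn_trans (ltn_ord k)) // mulrDr mulr_sumr.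
  by congr (_ + _); apply: eq_bigr => j _; rewrite mulrA.
rewrite [in RHS](eq_bigr (fun j : 'I_r => (pcoef r j t * u j +
  (- pcoef r r t) * (row_coef a j * u j)) +
  (\sum_(k < m) a' 0 k * pcoef k j t) * u j)); last by move=> j _; ring.
rewrite !big_split /= -mulr_sumr; ring.
Qed.

Lemma image_coefs (a a' : 'rV[K]_m) b b' t : U t ->
  (forall u, A (t, u 0%N) -> u r + \sum_(k < m) a 0 k * u k = b ->
     P r t u + \sum_(k < m) a' 0 k * P k t u = b') ->
  (forall j, (j < r)%N -> pcoef r j t - pcoef r r t * row_coef a j +
                \sum_(k < m) a' 0 k * pcoef k j t = 0) /\
  pcoef r r t * b + pcst r t + \sum_(k < m) a' 0 k * pcst k t = b'.
Proof.
move=> Ut h.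
have r0 : (0 < r)%N by exact: leq_ltn_trans mr.
have [|h1 h2] := @affine_form_zero (fun j => pcoef r j t - pcoef r r t * row_coef a j +
    \sum_(k < m) a' 0 k * pcoef k j t)
  (pcoef r r t * b + pcst r t + \sum_(k < m) a' 0 k * pcst k t - b') t r r0 Ut; last first.
  by split=> //; apply/eqP; rewrite -subr_eq0 h2.
move=> u Au.
(* u r is reset so that the jet satisfies the source equation; the affine form does not contain
   it. *)
pose v i := if i == r then b - \sum_(k < m) a 0 k * u k else u i.
have vE i : (i < r)%N -> v i = u i by move=> ir; rewrite /v ltn_eqF.
have v0 : v 0%N = u 0%N by exact: vE.
have Av : A (t, v 0%N) by rewrite v0.
have ev : v r + \sum_(k < m) a 0 k * v k = b.
  rewrite {1}/v eqxx [X in _ + X](eq_bigr (fun k : 'I_m => a 0 k * u k)) ?subrK // => k _.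
  by rewrite vE // (ltn_trans (ltn_ord k)).
have E := lhs_affine a' b' Av ev; rewrite (h v Av ev) subrr in E; rewrite [RHS]E.
by congr (_ + _); apply: eq_bigr => j _; rewrite vE.
Qed.

End ImageCoefficients.

Lemma bin2K (K : numFieldType) n : 'C(n.+1, 2)%:R = n.+1%:R * n%:R / 2 :> K.
Proof.
apply: (mulIf (x := 2)); rewrite ?pnatr_eq0 // divfK ?pnatr_eq0 // -!natrM.
by congr _%:R; have := mul_bin_diag n.+1 1; rewrite /= bin1 => ->; rewrite mulnC.
Qed.

(** * Solution of the determining equations for T0 and X1 *)

Section MoebiusSolve.
Variables (R : realType) (K : numFieldType) (io : {rmorphism R -> K}) (N : K -> R).
Hypothesis HN : real_norm io N.
Variables (U : set K) (T0 X1 : K -> K) (s : nat) (t0 : K).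
Hypotheses (oU : open U) (cU : connected U) (Ut0 : U t0) (sT0 : smooth_on U T0)
  (sX1 : smooth_on U X1) (T0' : forall t, U t -> derive1 T0 t != 0)
  (X1n0 : forall t, U t -> X1 t != 0).
Local Notation pcoef := (pcoef T0 X1).
Hypotheses (c1 : forall t, U t -> pcoef s.+3 s.+2 t = 0)
  (c2 : forall t, U t -> pcoef s.+3 s.+1 t = 0).

Let p := derive1 T0.
Let h t := derive1 p t / p t.
Let sp : smooth_on U p := smooth_derive1 sT0.
Let lam : K := s.+2%:R / 2.

Let dX1 t : U t -> is_derive t 1 X1 (derive1 X1 t).
Proof. exact: smooth_is_derive. Qed.

Let dp t : U t -> is_derive t 1 p (h t * p t).
Proof.
move=> Ut; have := smooth_is_derive sp Ut; congr is_derive.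
by rewrite /h divfK // T0'.
Qed.

Let dpV t : U t -> is_derive t 1 (fun t => (p t)^-1) (- h t / p t).
Proof.
move=> Ut; apply: is_derive_eq (is_deriveVK (T0' Ut) (dp Ut)) _.
by have := T0' Ut; rewrite -/p; move: (p t) (h t) => x y x0; field.
Qed.

Let dpVX t n : U t ->
  is_derive t 1 (fun t => (p t)^-1 ^+ n) (- (n%:R * h t * (p t)^-1 ^+ n)).
Proof.
move=> Ut; apply: is_derive_eq (is_deriveXK n (dpV Ut)) _.
by case: n => [|n] /=; rewrite ?exprS; ring.
Qed.

(** Each step of the recursion adds the derivative of the diagonal coefficient X1 p^-(k+1),
    contributing X1' and -(k + 1) X1 h; the latter factors add up to the binomial. *)
Lemma pcoef_sub1 k t : U t ->
  pcoef k.+1 k t = (k.+1%:R * derive1 X1 t - 'C(k.+1, 2)%:R * X1 t * h t) * (p t)^-1 ^+ k.+1.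
Proof.
elim: k t => [|k IH] t Ut; first by rewrite [LHS]/= -/p expr1 bin_small //; ring.
rewrite pcoefS -/p IH //.
rewrite (derive1_on oU (g := fun t => X1 t * (p t)^-1 ^+ k.+1)) //; last first.
  by move=> w Uw; rewrite (pcoef_diag _ _ oU) // exprVn.
rewrite (derive1_val (is_deriveMK (dX1 Ut) (dpVX k.+1 Ut))).
rewrite (binS k.+1) bin1 natrD -[k.+2%:R]natr1 -[k.+1%:R]natr1 !exprS; ring.
Qed.

Lemma X1_ode t : U t -> derive1 X1 t = lam * h t * X1 t.
Proof.
move=> Ut; have := c1 Ut; rewrite pcoef_sub1 // => /eqP.
rewrite mulf_eq0 expf_eq0 invr_eq0 (negbTE (T0' Ut)) andbF orbF subr_eq0 => /eqP.
have s30 : s.+3%:R != 0 :> K by rewrite pnatr_eq0.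
have E : 'C(s.+3, 2)%:R = s.+3%:R * lam :> K by rewrite bin2K mulrA.
by rewrite E => e; apply: (mulfI s30); rewrite e; ring.
Qed.

(** Factor of X1 h p^-k in the coefficient of x^(k-1) in P_k, once X1' = lam h X1 is inserted. *)
Definition q1 (k : nat) : K := k%:R * lam - 'C(k, 2)%:R.

Lemma pcoef_sub1' k t : U t -> pcoef k.+1 k t = q1 k.+1 * (X1 t * h t * (p t)^-1 ^+ k.+1).
Proof. by move=> Ut; rewrite pcoef_sub1 // X1_ode // /q1; ring. Qed.

Lemma smooth_h : smooth_on U h.
Proof.
move=> n; apply: upto_mul => //; first by have := smooth_derive1 sp; apply.
by apply: upto_inv => //; exact: sp.
Qed.

(** The same summation one level down: with X1' = lam h X1 all terms are multiples of X1 p^-(k+2) by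
    combinations of h^2 and h'. *)
Lemma pcoef_sub2 k t : U t -> pcoef k.+2 k t =
  \sum_(i < k.+1) q1 i.+1 * ((lam - i.+1%:R) * h t ^+ 2 + derive1 h t) *
  (X1 t * (p t)^-1 ^+ k.+2).
Proof.
have dL k' w : U w -> derive1 (pcoef k'.+1 k') w =
    q1 k'.+1 * ((lam - k'.+1%:R) * h w ^+ 2 + derive1 h w) * (X1 w * (p w)^-1 ^+ k'.+1).
  move=> Uw; rewrite (derive1_on oU (g := fun t => q1 k'.+1 * (X1 t * h t * (p t)^-1 ^+ k'.+1))) //.
    have dXh := is_deriveMK (dX1 Uw) (smooth_is_derive smooth_h Uw).
    have := is_deriveMK (is_derive_cst (q1 k'.+1) w 1) (is_deriveMK dXh (dpVX k'.+1 Uw)).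
    by move=> /derive1_val ->; rewrite X1_ode // [cst _ _]/=; ring.
  by move=> x Ux; rewrite pcoef_sub1'.
elim: k t => [|k IH] t Ut.
  rewrite big_ord_recl big_ord0 addr0 pcoefS0 addr0 dL // -/p.
  by rewrite [nat_of_ord _]/= !exprS expr0; ring.
rewrite pcoefS dL // IH // -/p.
by rewrite [in RHS]big_ord_recr /= -!mulr_suml [(p t)^-1 ^+ k.+3]exprS; ring.
Qed.

(* At [n = s.+2 = 2 * lam] the two sums below are [n (n + 1) (n + 2) / 12] and
   the opposite of half of it, whatever the order: this is how the vanishing of
   the Schwarzian derivative of [T0] comes out in [h_ode]. *)
Lemma sum_q1 n : \sum_(i < n) q1 i.+1 =
  lam * (n%:R * (n%:R + 1) / 2) - (n%:R + 1) * n%:R * (n%:R - 1) / 6.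
Proof.
elim: n => [|n IH]; first by rewrite big_ord0; ring.
rewrite big_ord_recr /= IH /q1 bin2K -[n.+1%:R]natr1; by field.
Qed.

Lemma sum_q1_weighted n : \sum_(i < n) q1 i.+1 * (lam - i.+1%:R) =
  lam ^+ 2 * (n%:R * (n%:R + 1) / 2)
  - lam * ((n%:R + 1) * n%:R * (2 * n%:R + 1) / 6 + (n%:R + 1) * n%:R * (n%:R - 1) / 6)
  + (n%:R ^+ 2 * (n%:R + 1) ^+ 2 / 4 - (n%:R + 1) * n%:R * (2 * n%:R + 1) / 6) / 2.
Proof.
elim: n => [|n IH]; first by rewrite big_ord0; ring.
rewrite big_ord_recr /= IH /q1 bin2K -[n.+1%:R]natr1; by field.
Qed.

Lemma h_ode t : U t -> derive1 h t = h t ^+ 2 / 2.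
Proof.
move=> Ut; have := c2 Ut; rewrite pcoef_sub2 // => /eqP.
have nz : X1 t * (p t)^-1 ^+ s.+3 != 0.
  by rewrite mulf_neq0 ?X1n0 // expf_neq0 // invr_neq0 // T0'.
rewrite -mulr_suml mulf_eq0 (negbTE nz) orbF => /eqP.
rewrite (eq_bigr (fun i : 'I_s.+2 => q1 i.+1 * (lam - i.+1%:R) * h t ^+ 2 +
   q1 i.+1 * derive1 h t)); last by move=> i _; ring.
rewrite big_split /= -!mulr_suml sum_q1 sum_q1_weighted.
move: (derive1 h t) (h t) => d x; rewrite /lam.
have n0 : (s.+2%:R + 2) * (s.+2%:R + 1) * s.+2%:R / 12 != 0 :> K.
  by rewrite natr1 -natrD !mulf_neq0 ?invr_eq0 ?pnatr_eq0 // addnS.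
move: (s.+2%:R : K) n0 => n n0 e; apply/eqP; rewrite -subr_eq0.
rewrite -(mulrI_eq0 _ (mulfI n0)) -e; apply/eqP; by field.
Qed.

(** v = 1/T0' satisfies v' = -h v, v'' = h^2 v / 2 and v''' = 0, so it is a polynomial of degree at
    most 2, and 2 v v'' = v'^2. If k = v'' is zero, then h = 0, T0 is affine and X1 constant.
    Otherwise w = v' is the denominator: T0' = 2 k / w^2, and X1 is a multiple of w^-(r-1). *)
Lemma moebius_solve : exists alpha beta gamma delta C,
  [/\ alpha * delta - beta * gamma != 0, C != 0 &
    forall t, U t -> [/\ gamma * t + delta != 0,
      T0 t = (alpha * t + beta) / (gamma * t + delta) &
      X1 t = C / (gamma * t + delta) ^+ s.+2]].
Proof.
pose v t := (p t)^-1; pose v' t := - h t * v t; pose v'' t := h t ^+ 2 / 2 * v t.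
have dh t : U t -> is_derive t 1 h (h t ^+ 2 / 2).
  by move=> Ut; rewrite -h_ode //; exact: smooth_is_derive smooth_h Ut.
have dv t : U t -> is_derive t 1 v (v' t) by exact: dpV.
have dv' t : U t -> is_derive t 1 v' (v'' t).
  move=> Ut; apply: is_derive_eq (is_deriveMK (is_deriveN (dh t Ut)) (dv t Ut)) _.
  by rewrite /v'' /v' [(- h) t](_ : _ = - h t) //; field.
have dv'' t : U t -> is_derive t 1 v'' 0.
  move=> Ut; pose g t := h t * h t / 2.
  have dg : is_derive t 1 g (h t ^+ 3 / 2).
    apply: is_derive_eq (is_deriveMK (is_deriveMK (dh t Ut) (dh t Ut)) (is_derive_cst (2^-1 : K) t 1)) _.
    by rewrite /cst /=; field.
  have := is_deriveMK dg (dv t Ut); rewrite (_ : (fun z => _) = v'').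
    by move=> H; apply: is_derive_eq H _; rewrite /v' /g; field.
  by apply/funext => w; rewrite /v'' /g expr2.
have cst0 (f : K -> K) : (forall t, U t -> is_derive t 1 f 0) -> forall t, U t -> f t = f t0.
  by move=> df t Ut; exact: (cst_of_derive0 HN oU cU df Ut Ut0).
have k0 := cst0 _ dv''; set k := v'' t0 in k0.
have vn0 t : U t -> v t != 0 by move=> Ut; rewrite invr_neq0 // T0'.
have lin (f : K -> K) a : (forall t, U t -> is_derive t 1 f a) -> forall t, U t -> f t - a * t = f t0 - a * t0.
  move=> df; apply: (cst0 (fun t => f t - a * t)) => t Ut.
  apply: is_derive_eq (is_deriveB (df t Ut) (is_deriveMK (is_derive_cst a t 1) (is_derive_id t 1))) _.
  by rewrite /cst /=; ring.
have dT t : U t -> is_derive t 1 T0 (p t) by exact: smooth_is_derive.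
have [kz|kn] := eqVneq k 0.
  have h0 t : U t -> h t = 0.
    move=> Ut; apply/eqP; have /eqP := k0 t Ut; rewrite kz mulf_eq0 (negbTE (vn0 t Ut)) orbF.
    by rewrite mulf_eq0 invr_eq0 pnatr_eq0 orbF expf_eq0 => /andP[].
  have p0 t : U t -> p t = p t0.
    apply: cst0 => w Uw; apply: is_derive_eq (dp Uw) _; by rewrite h0 // mul0r.
  have X10 t : U t -> X1 t = X1 t0.
    apply: cst0 => w Uw; apply: is_derive_eq (dX1 Uw) _.
    by rewrite X1_ode // h0 // mulr0 mul0r.
  have dT' t : U t -> is_derive t 1 T0 (p t0) by move=> Ut; rewrite -(p0 t Ut); exact: dT.
  exists (p t0), (T0 t0 - p t0 * t0), 0, 1, (X1 t0); split.
  - by rewrite mulr1 mulr0 subr0 T0'.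
  - exact: X1n0.
  - move=> t Ut; rewrite mul0r add0r oner_neq0 divr1 expr1n divr1; split=> //.
      by rewrite -(lin _ _ dT' t Ut) addrC subrK.
    exact: X10.
pose b := v' t0 - k * t0; pose w t := k * t + b.
have w' t : U t -> v' t = w t.
  move=> Ut; have dk x : U x -> is_derive x 1 v' k by move=> Ux; rewrite -(k0 x Ux); exact: dv'.
  by rewrite /w /b -(lin _ _ dk t Ut) addrC subrK.
have kv t : U t -> 2 * k * v t = w t ^+ 2.
  by move=> Ut; rewrite -w' // -(k0 t Ut) /v' /v''; field.
have wn0 t : U t -> w t != 0.
  move=> Ut; have : w t ^+ 2 != 0 by rewrite -kv // mulf_neq0 ?vn0 // mulf_neq0 ?pnatr_eq0.
  by apply: contraNneq => ->; rewrite expr0n.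
have pw t : U t -> p t = 2 * k / w t ^+ 2.
  move=> Ut; rewrite -kv // invfM mulrA divff ?mul1r ?invrK //.
  by rewrite mulf_neq0 ?pnatr_eq0.
have hw t : U t -> h t = - (2 * k / w t).
  move=> Ut; have e1 := w' t Ut; have e2 := kv t Ut; have w0 := wn0 t Ut; have v0 := vn0 t Ut.
  apply: (mulIf v0); rewrite -[h t * _]opprK -mulNr -/(v' t) e1 mulNr; congr (- _).
  by rewrite mulrAC e2 expr2 mulfK.
have dw (t : K) : is_derive t 1 w k.
  apply: is_derive_eq (is_deriveD (is_deriveMK (is_derive_cst k t 1) (is_derive_id t 1)) (is_derive_cst b t 1)) _.
  by rewrite /cst /=; ring.
have dwV t : U t -> is_derive t 1 (fun t => (w t)^-1) (- k / w t ^+ 2).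
  by move=> Ut; exact: is_deriveVK (wn0 t Ut) (dw t).
have Tc t : U t -> T0 t + 2 * (w t)^-1 = T0 t0 + 2 * (w t0)^-1.
  apply: (cst0 (fun t => T0 t + 2 * (w t)^-1)) => x Ux.
  apply: is_derive_eq (is_deriveD (dT x Ux) (is_deriveMK (is_derive_cst (2 : K) x 1) (dwV x Ux))) _.
  by rewrite pw // /cst /=; have := wn0 x Ux => w0; field.
have Xc t : U t -> X1 t * w t ^+ s.+2 = X1 t0 * w t0 ^+ s.+2.
  apply: (cst0 (fun t => X1 t * w t ^+ s.+2)) => x Ux.
  apply: is_derive_eq (is_deriveMK (dX1 Ux) (is_deriveXK s.+2 (dw x))) _.
  rewrite X1_ode // hw // /lam [s.+2.-1]/= exprS; have := wn0 x Ux.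
  by move: (w x) (w x ^+ s.+1) (X1 x) (s.+2%:R : K) => y z a n y0; field.
set c0 := T0 t0 + _ in Tc.
(* T0 + 2 / w is the constant c0, so T0 = (c0 w - 2) / w with w = k t + b, of determinant 2 k. *)
exists (c0 * k), (c0 * b - 2), k, b, (X1 t0 * w t0 ^+ s.+2); split.
- have -> : c0 * k * b - (c0 * b - 2) * k = 2 * k by ring.
  by rewrite mulf_neq0 ?pnatr_eq0.
- by rewrite mulf_neq0 ?X1n0 // expf_neq0 // wn0.
- move=> t Ut; rewrite -/(w t); have w0 := wn0 t Ut; split=> //.
    by rewrite -[LHS](addrK (2 * (w t)^-1)) Tc // /w in w0 *; field.
  by rewrite -(Xc t Ut) mulfK // expf_neq0.
Qed.

End MoebiusSolve.

Lemma upto_local (K : numFieldType) (V W : normedModType K) n (A : set V) (f : V -> W) :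
  (forall z, A z -> exists B, B z /\ differentiable_upto n B f) ->
  differentiable_upto n A f.
Proof.
elim: n f => [//|n IH] f h /=; split=> [z /h [B [Bz [df _]]]|v]; first exact: df.
by apply: IH => z /h [B [Bz [_ Df]]]; exists B; split=> //; exact: Df.
Qed.

Lemma upto_section (K : numFieldType) n (A : set (K * K)) (B : set K) (f : K * K -> K) x :
  open A -> open B -> (forall t, B t -> A (t, x)) ->
  differentiable_upto n A f -> differentiable_upto n B (fun t => f (t, x)).
Proof.
move=> oA oB BA sf.
have L_lin : linear (fun t : K => (t, 0 : K)).
  by move=> k u v; rewrite -[RHS]/(k *: u + v, k *: 0 + 0) scaler0 addr0.
pose LM := GRing.isLinear.Build _ _ _ _ _ L_lin.
pose L : {linear K -> (K * K)%type} := HB.pack (fun t : K => (t, 0 : K)) LM.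
have Lc : continuous L.
  move=> z; have c1 := is_derive1_cvg (is_derive_id z (1 : K)).
  have c2 := is_derive1_cvg (is_derive_cst (0 : K) z (1 : K)).
  exact: cvg_pair c1 c2.
have E t : L t + (0, x) = (t, x) by rewrite -[LHS]/(t + 0, 0 + x) addr0 add0r.
have := @upto_affr K (K * K)%type K K n A B f L (0, x) oA oB Lc.
have BA' z : B z -> A (L z + (0, x)) by rewrite E; exact: BA.
move=> /(_ BA' sf); congr differentiable_upto.
by apply/funext => t; rewrite E.
Qed.

(** * Functions constant along the fibres of the domain *)

Section Fibres.
Variables (R : realType) (K : numFieldType) (io : {rmorphism R -> K}) (N : K -> R).
Hypothesis HN : real_norm io N.
Variable A : set (K * K).
Hypothesis lA : local_domain A.
Let oA : open A. Proof. by case: lA. Qed.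
Let U : set K := fst @` A.

Lemma fst_range t : U t <-> exists x, A (t, x).
Proof. by split=> [[[t' x] Ax <-]|[x Ax]]; [exists x|exists (t, x)]. Qed.

Lemma open_fst_range : open U.
Proof.
rewrite openE => t /fst_range[x Ax]; have := near_section_t oA Ax.
by apply: filterS => s As; apply/fst_range; exists x.
Qed.

Lemma connected_fst_range : connected U.
Proof.
apply: connected_continuous_connected; first by case: lA.
by apply: continuous_subspaceT => z; exact: cvg_fst.
Qed.

Lemma is_derive_section_x (f : K * K -> K) t x : smooth_on A f -> A (t, x) ->
  is_derive x 1 (fun y => f (t, y)) (pdx f (t, x)).
Proof.
move=> sf Ax; have [df _] := sf 1%N.
have := is_derive_curve (x := cst t) (y := id) (s := x) (df _ Ax)
  (is_derive_cst t x 1) (is_derive_id x 1).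
by rewrite pdxE mul0r add0r mul1r.
Qed.

Lemma is_derive_section_t (f : K * K -> K) t x : smooth_on A f -> A (t, x) ->
  is_derive t 1 (fun s => f (s, x)) (pdt f (t, x)).
Proof.
move=> sf Ax; have [df _] := sf 1%N.
have := is_derive_curve (x := id) (y := cst x) (s := t) (df _ Ax)
  (is_derive_id t 1) (is_derive_cst x t 1).
by rewrite pdtE mul0r addr0 mul1r.
Qed.

Lemma fibre_cst (f : K * K -> K) t x y : smooth_on A f ->
  (forall z, A z -> pdx f z = 0) -> A (t, x) -> A (t, y) -> f (t, x) = f (t, y).
Proof.
move=> sf f0 Ax Ay.
have oS : open [set x | A (t, x)].
  by rewrite openE => w Aw; exact: (near_section_x oA Aw).
have cS : connected [set x | A (t, x)] by case: lA.
apply: (cst_of_derive0 HN oS cS (f := fun y => f (t, y))) => // w Aw.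
by rewrite -(f0 _ Aw); exact: is_derive_section_x.
Qed.

(** f(s, x) = f(s, y) for all s near t, so [pdt f] takes the same value at (t, x) and (t, y). This
    replaces the symmetry of mixed derivatives. *)
Lemma fibre_cst_pdt (f : K * K -> K) : smooth_on A f ->
  (forall z, A z -> pdx f z = 0) -> forall z, A z -> pdx (pdt f) z = 0.
Proof.
move=> sf f0 [t x] Ax.
have spf : smooth_on A (pdt f) by exact: smooth_pdt.
apply: (is_derive_near_cst (c := pdt f (t, x)) _ (is_derive_section_x spf Ax)).
have := near_section_x oA Ax; apply: filterS => y Ay.
have [_ <-] := is_derive_section_t sf Ay; have [_ <-] := is_derive_section_t sf Ax.
apply: near_eq_derive; apply: filterS2 (near_section_t oA Ax) (near_section_t oA Ay).
by move=> s As As'; exact: fibre_cst.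
Qed.

(** The point [xi t] of each fibre is chosen without any regularity in t. Near t, however, the
    function coincides with s -> f(s, xi t), in which [xi t] is frozen, and this one is smooth. *)
Lemma fibre_cst_smooth (f : K * K -> K) : smooth_on A f ->
  (forall z, A z -> pdx f z = 0) ->
  exists2 F, smooth_on U F & forall t x, A (t, x) -> f (t, x) = F t.
Proof.
move=> sf f0.
have /choice [xi hxi] : forall t, exists x, U t -> A (t, x).
  move=> t; have [/fst_range[x Ax]|nU] := pselect (U t); first by exists x.
  by exists 0 => /nU.
have fE t x : A (t, x) -> f (t, x) = f (t, xi t).
  by move=> Ax; apply: fibre_cst => //; apply: hxi; apply/fst_range; exists x.
exists (fun t => f (t, xi t)) => // n; apply: upto_local => t Ut.
pose B := [set s | A (s, xi t)].
have oB : open B by rewrite openE => s As; exact: (near_section_t oA As).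
exists B; split; first exact: hxi.
apply: (upto_eq (f := fun s => f (s, xi t))) => // [s Bs|]; first exact: fE.
exact: upto_section (sf n).
Qed.

End Fibres.

(** * Affine form of transformations between linear equations *)

Section Necessity.
Variables (R : realType) (K : numFieldType) (io : {rmorphism R -> K}) (N : K -> R).
Hypothesis HN : real_norm io N.
Variables (s : nat) (tau : transformation K).
Local Notation r := s.+3.
Local Notation A := (tr_dom tau).
Local Notation T := (tr_t tau).
Local Notation X := (tr_x tau).
Local Notation P := (prolong T X).
Hypothesis ptau : point_transformation tau.
Hypothesis mtau : forall t x, A (t, x) -> exists (a : 'rV[K]_(r - 2)) b (a' : 'rV[K]_(r - 2)) b',
  forall u, u 0%N = x -> regular_jet tau t u ->
    lin_eq (s := s) u a b -> lin_eq (s := s) (fun k => P k t u) a' b'.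

Let lA := tr_domP tau.
Let oA : open A. Proof. by case: lA. Qed.
Let sT : smooth_on A T. Proof. by case: ptau. Qed.
Let sX : smooth_on A X. Proof. by case: ptau. Qed.
Let jac z : A z -> Defs.jacobian T X z != 0. Proof. by case: ptau => _ _; apply. Qed.

Lemma regular_jetE t u : regular_jet tau t u <-> jreg A T t u.
Proof.
have E : A (t, u 0%N) -> total_derivative 0 (lift_jet T) t u = jeval (jD T) t u.
  exact: (jD_near sT).
by split=> -[Au D0]; split=> //; [rewrite -E|rewrite E].
Qed.

Lemma maps_jets t x : A (t, x) -> exists (a : 'rV[K]_(r - 2)) b (a' : 'rV[K]_(r - 2)) b',
  forall u, u 0%N = x -> jreg A T t u ->
    lin_eq (s := s) u a b -> lin_eq (s := s) (fun k => jeval (jpro T X k) t u) a' b'.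
Proof.
move=> Az; have [a [b [a' [b' h]]]] := mtau Az; exists a, b, a', b' => u ux ru eu.
have := h u ux ((regular_jetE t u).2 ru) eu; rewrite /lin_eq (prolongE oA sT sX) //.
by under eq_bigr => k _ do rewrite (prolongE oA sT sX _ ru).
Qed.

Let U := t_range tau.

Lemma affine_data : exists T0 X1 X0 : K -> K,
  [/\ smooth_on U T0, smooth_on U X1, smooth_on U X0,
      (forall t x, A (t, x) -> T (t, x) = T0 t /\ X (t, x) = X1 t * x + X0 t) &
      forall t, U t -> derive1 T0 t != 0 /\ X1 t != 0].
Proof.
have Tx z : A z -> pdx T z = 0.
  by case: z => t x; exact: (vertical_T oA sT sX jac maps_jets).
have Ttx := fibre_cst_pdt HN lA sT Tx.
have Xxx z : A z -> pdx (pdx X) z = 0.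
  by case: z => t x; exact: (affine_X oA sT sX jac maps_jets Ttx).
have [T0 sT0 TE] := fibre_cst_smooth HN lA sT Tx.
have spX : smooth_on A (pdx X) by exact: smooth_pdx.
have [X1 sX1 X1E] := fibre_cst_smooth HN lA spX Xxx.
(* The candidate for X0: as X_xx = 0, the difference X - X_x x is constant along fibres. *)
pose g z := X z - pdx X z * z.2.
have s2 : smooth_on A (fun z : K * K => z.2).
  by move=> n; apply: upto_snd => //; exact: upto_idV.
have sg : smooth_on A g.
  by move=> n; apply: upto_add => //; apply: upto_opp => //; exact: upto_mul.
have gx z : A z -> pdx g z = 0.
  case: z => t x Ax; have [_ <-] := is_derive_section_x sg Ax.
  have d1 := is_derive_section_x sX Ax; have d2 := is_derive_section_x spX Ax.
  have d3 := is_deriveMK d2 (is_derive_id x (1 : K)).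
  have [_ ->] := is_deriveB d1 d3.
  by rewrite Xxx // mul0r add0r mulr1 subrr.
have [X0 sX0 X0E] := fibre_cst_smooth HN lA sg gx.
exists T0, X1, X0; split=> //.
  move=> t x Ax; split; first exact: TE.
  by rewrite -(X1E t x Ax) -(X0E t x Ax) /g /= addrC subrK.
move=> t /fst_range[x Ax]; have J := jac Ax.
have dT := is_derive_section_t sT Ax.
have T0E : derive1 T0 t = pdt T (t, x).
  have [_ <-] := dT; rewrite derive1E; apply: near_eq_derive.
  by apply: filterS (near_section_t oA Ax) => w Aw; rewrite -(TE _ _ Aw).
rewrite T0E -(X1E t x Ax); apply/andP; rewrite -negb_or -mulf_eq0.
move: J; rewrite /Defs.jacobian; move: (Tx _ Ax); rewrite !pdtE !pdxE => ->.
by rewrite mul0r subr0.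
Qed.

End Necessity.

Lemma upto_det (K : numFieldType) (V : normedModType K) n m (A : set V)
    (M : V -> 'M[K]_m) : open A ->
  (forall i j, differentiable_upto n A (fun z => M z i j)) ->
  differentiable_upto n A (fun z => \det (M z)).
Proof.
move=> oA sM; apply: upto_sum => // sg; apply: upto_mul => //; first exact: upto_cst.
exact: upto_prod.
Qed.

(** By the cofactor formula the entries of the inverse are polynomials in those of [M] divided by
    the determinant. *)
Lemma upto_invmx (K : numFieldType) (V : normedModType K) n m (A : set V)
    (M : V -> 'M[K]_m) i j : open A -> (forall z, A z -> M z \in unitmx) ->
  (forall i j, differentiable_upto n A (fun z => M z i j)) ->
  differentiable_upto n A (fun z => invmx (M z) i j).
Proof.
move=> oA uM sM.
apply: (upto_eq (f := fun z => (\det (M z))^-1 * ((-1) ^+ (j + i) * \det (row' j (col' i (M z)))))) => //.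
  by move=> z Az; rewrite /invmx uM // !mxE.
apply: upto_mul => //.
  apply: upto_inv => //; last exact: upto_det.
  by move=> z /uM; rewrite unitmxE unitfE.
apply: upto_mul => //; first exact: upto_cst.
by apply: upto_det => // k l; under eq_fun do rewrite !mxE; exact: sM.
Qed.

(** Along [v] the difference quotient is constant. This serves for the components of equivalence
    transformations, which are affine in the arbitrary elements. *)
Lemma derive_affine (K : numFieldType) (V W : normedModType K) (f : V -> W) z v L :
  (forall h : K, f (h *: v + z) = f z + h *: L) -> 'D_v f z = L.
Proof.
move=> fh; rewrite /derive; apply/cvg_lim => //.
have E : {near 0^', cst L =1 fun h : K => h^-1 *: ((f \o shift z) (h *: v) - f z)}.
  rewrite near_withinE; apply: filterE => h h0 /=.
  by rewrite fh addrAC subrr add0r scalerA mulVf // scale1r.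
apply: cvg_trans (near_eq_cvg E) _; exact: cvg_cst.
Qed.

(** * Closed form of the prolongation of Moebius transformations *)

Section MoebiusCoefficients.
Variables (K : numFieldType) (U : set K) (q : nat) (T0 X1 : K -> K).
Local Notation r := q.+1.
Variables (alpha beta gamma delta C : K).
Let w t := gamma * t + delta.
Let Delta := alpha * delta - beta * gamma.
Hypotheses (oU : open U) (Delta0 : Delta != 0) (C0 : C != 0)
  (w0 : forall t, U t -> w t != 0)
  (T0E : forall t, U t -> T0 t = (alpha * t + beta) / w t)
  (X1E : forall t, U t -> X1 t = C / w t ^+ q).
Local Notation pcoef := (pcoef T0 X1).

Lemma is_derive_affine (a b t : K) : is_derive t 1 (fun t => a * t + b) a.
Proof.
apply: is_derive_eq (is_deriveD (is_deriveMK (is_derive_cst a t 1) (is_derive_id t 1)) (is_derive_cst b t 1)) _.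
by rewrite /cst mul0r add0r mulr1 addr0.
Qed.

Lemma derive1_moebius t : U t -> derive1 T0 t = Delta / w t ^+ 2.
Proof.
move=> Ut; rewrite (derive1_on oU (g := fun t => (alpha * t + beta) * (w t)^-1)) //.
have := is_deriveMK (is_derive_affine alpha beta t) (is_deriveVK (w0 Ut) (is_derive_affine gamma delta t)).
move=> /derive1_val ->; have := w0 Ut; rewrite /Delta /w => wt0; by field.
Qed.

(* For [i.+1 = r] a factor of [fall j r] vanishes, which is why no intermediate
   derivatives appear in the transformed [u r]. *)
Let fall j k : K := \prod_(j <= i < k) (i.+1%:R - r%:R).

(** Numerical factor of [pcoef k j]; the recursion for [pcoef] becomes the recurrences [kapS0] and
    [kapS]. *)
Let kap k j : K := 'C(k, j)%:R * fall j k.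

Let kapS0 k : kap k.+1 0 = (k.+1%:R - r%:R) * kap k 0.
Proof. by rewrite /kap !bin0 !mul1r /fall big_nat_recr //= mulrC. Qed.

Let kapS k j : kap k.+1 j.+1 = ((k + j).+2%:R - r%:R) * kap k j.+1 + kap k j.
Proof.
rewrite /kap; have [jk|] := ltnP j k; last first.
  rewrite leq_eqVlt => /orP[/eqP <-|kj].
    by rewrite !binn bin_small // /fall !big_geq //; ring.
  by rewrite !bin_small //; [ring|exact: ltnW].
rewrite /fall [\prod_(j.+1 <= i < k.+1) _]big_nat_recr //= [\prod_(j <= i < k) _]big_ltn //.
set pi := \prod_(j.+1 <= i < k) _; set rr : K := r%:R.
have := mul_bin_left k j => /(congr1 (fun n => n%:R : K)); rewrite !natrM natrB ?(ltnW jk) //.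
rewrite binS natrD -!natr1 natrD => e.
have -> : (k%:R + j%:R + 1 + 1 - rr) * ('C(k, j.+1)%:R * pi) =
  (k%:R + 1 - rr) * 'C(k, j.+1)%:R * pi + ((j%:R + 1) * 'C(k, j.+1)%:R) * pi by ring.
rewrite e; ring.
Qed.

(** Differentiating w^(n+1-r) and dividing by T0' = Delta / w^2 raises the exponent of w by 1 and
    brings a factor (n + 1 - r) gamma / Delta, which dictates the shape of the formula. The power of
    w is written as a quotient to keep exponents natural. *)
Lemma pcoef_moebius k j t : U t -> pcoef k j t =
  C / Delta ^+ k * kap k j * gamma ^+ (k - j) * (w t ^+ (k + j).+1 / w t ^+ r).
Proof.
have dw n (t' : K) : U t' -> is_derive t' 1 (fun t => w t ^+ n.+1 * (w t ^+ r)^-1)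
    ((n.+1%:R - r%:R) * gamma * (w t' ^+ n * (w t' ^+ r)^-1)).
  move=> Ut'; have wt := w0 Ut'.
  have wr0 : w t' ^+ r != 0 by rewrite expf_neq0.
  have da := is_derive_affine gamma delta t'.
  have H := is_deriveMK (is_deriveXK n.+1 da)
    (@is_deriveVK K (fun t => w t ^+ r) t' _ wr0 (is_deriveXK r da)).
  apply: is_derive_eq H _; rewrite -/(w t') [n.+1.-1]/= [r.-1]/=.
  have : w t' ^+ q != 0 by rewrite expf_neq0.
  rewrite !exprS; move: wt (r%:R : K) (n.+1%:R : K).
  by move: (w t') (w t' ^+ n) (w t' ^+ q) => x y z x0 p p' z0; field; rewrite x0 z0.
have kge k' j' : (k' < j')%N -> kap k' j' = 0.
  by move=> h; rewrite /kap bin_small // mul0r.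
have dpc c n (t' : K) : U t' ->
    derive1 (fun t => c * (w t ^+ n.+1 / w t ^+ r)) t' =
    c * ((n.+1%:R - r%:R) * gamma * (w t' ^+ n / w t' ^+ r)).
  move=> Ut'; have := is_deriveMK (is_derive_cst c t' 1) (dw n t' Ut').
  by move=> /derive1_val ->; rewrite mul0r add0r.
elim: k j t => [|k IH] [|j] t Ut.
- rewrite /= X1E // /kap bin0 /fall big_geq // !expr0 expr1 divr1 !mulr1 exprS.
  have := w0 Ut; have : w t ^+ q != 0 by rewrite expf_neq0 // w0.
  by move: (w t) (w t ^+ q) => x y y0 x0; field; rewrite x0 y0.
- by rewrite kge // !(mulr0, mul0r).
- rewrite pcoefS0 addr0 derive1_moebius // (derive1_on oU Ut (IH 0%N)) dpc //.
  rewrite kapS0 !subn0 !addn0 [Delta ^+ k.+1]exprS [gamma ^+ k.+1]exprS.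
  rewrite [w t ^+ k.+2]exprS [w t ^+ k.+1]exprS [w t ^+ r]exprS.
  have := w0 Ut; have : w t ^+ q != 0 by rewrite expf_neq0 // w0.
  have : Delta ^+ k != 0 by rewrite expf_neq0.
  move: Delta0; rewrite expr2; move: (Delta ^+ k) Delta (w t ^+ k) (w t) (w t ^+ q) (gamma ^+ k).
  move: (k.+1%:R : K) (r%:R : K) (kap k 0) => a b c d' d x y z g d0 d'0 z0 y0.
  by field; rewrite d0 d'0 z0 y0.
- rewrite pcoefS derive1_moebius // (derive1_on oU Ut (IH j.+1)) dpc // IH //.
  have [kj|jk] := ltnP k j.
    by rewrite !kge ?(ltnW kj) // ?ltnS ?(ltnW kj) //; ring.
  (* For j = k the truncated exponents [k - j.+1] and [k - j] coincide, but then [kap k k.+1]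
     vanishes. *)
  have G : kap k j.+1 * gamma ^+ (k - j.+1) * gamma = kap k j.+1 * gamma ^+ (k - j).
    move: jk; rewrite leq_eqVlt => /orP[/eqP ->|jk]; first by rewrite kge // !mul0r.
    by rewrite -mulrA -exprSr subnSK.
  rewrite kapS subSS addSn !addnS; set a : K := (k + j).+2%:R - r%:R.
  transitivity (C / Delta ^+ k * (a * (kap k j.+1 * gamma ^+ (k - j.+1) * gamma) +
     kap k j * gamma ^+ (k - j)) * (w t ^+ (k + j).+1 / w t ^+ r) / (Delta / w t ^+ 2)).
    by ring.
  rewrite G [Delta ^+ k.+1]exprS [w t ^+ (k + j).+3]exprS [w t ^+ (k + j).+2]exprS.
  have := w0 Ut; have : w t ^+ r != 0 by rewrite expf_neq0 // w0.
  have : Delta ^+ k != 0 by rewrite expf_neq0.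
  move: Delta0; rewrite expr2.
  move: (Delta ^+ k) Delta (w t ^+ (k + j).+1) (w t) (w t ^+ r) (gamma ^+ (k - j)).
  move: (kap k j.+1) (kap k j) => b c d' d x y z g d0 d'0 z0 y0.
  by field; rewrite d0 d'0 z0 y0.
Qed.

Lemma pcoef_moebius_top j t : U t -> (j < r)%N -> pcoef r j t = 0.
Proof.
move=> Ut jr; rewrite pcoef_moebius // /kap /fall big_nat_recr //= subrr !mulr0.
by rewrite !(mulr0, mul0r).
Qed.

End MoebiusCoefficients.

(** X1 x + X0 = X1 (x + c psi), so the inhomogeneous part of P_k is its linear part evaluated at the
    derivatives of c psi. *)
Lemma pcst_derive1n (K : numFieldType) (U : set K) (T0 X1 X0 psi : K -> K) (c : K) k t :
  open U -> smooth_on U T0 -> smooth_on U X1 -> smooth_on U psi ->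
  (forall t, U t -> derive1 T0 t != 0) ->
  (forall t, U t -> X0 t = c * (X1 t * psi t)) -> U t ->
  pcst T0 X0 k t = c * \sum_(j < k.+1) pcoef T0 X1 k j t * derive1n j psi t.
Proof.
move=> oU sT0 sX1 spsi T0' X0E; elim: k t => [|k IH] t Ut.
  by rewrite big_ord_recl big_ord0 addr0 [pcst _ _ _ _]X0E.
rewrite [LHS]/=; rewrite (derive1_on oU Ut IH).
have sp j := smooth_pcoef oU sT0 sX1 T0' k j.
have dS := is_derive_sum (fun j : 'I_k.+1 => is_deriveM (smooth_is_derive (sp j) Ut)
  (smooth_derive1n_chain j spsi Ut)).
have [_ dE] := is_deriveM (is_derive_cst c t (1 : K)) dS.
rewrite derive1E [X in 'D_1 X t](_ : _ =
  cst c * \sum_(j < k.+1) (pcoef T0 X1 k j * derive1n j psi)); last first.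
  by apply/funext => u; rewrite !fctE fct_sumE.
rewrite dE scaler0 addr0 /GRing.scale /= -mulrA; congr (_ * _).
rewrite (eq_bigr (fun j : 'I_k.+2 => (derive1 (pcoef T0 X1 k j) t * derive1n j psi t) / derive1 T0 t +
    ((if j : nat is j'.+1 then pcoef T0 X1 k j' t else 0) * derive1n j psi t) / derive1 T0 t)); last first.
  by move=> j _ /=; rewrite mulrAC !mulrDl.
rewrite [in RHS]big_split /= -!mulr_suml -mulrDl big_split addrC /=.
rewrite [X in _ = (X + _) / _]big_ord_recl mul0r add0r [X in _ = (_ + X) / _]big_ord_recr /=.
rewrite [derive1 (pcoef T0 X1 k k.+1) t](derive1_eq0 oU Ut); last first.
  by move=> s Us; apply: (pcoef_gt _ _ oU).
rewrite mul0r addr0.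
by congr ((_ + _) / _); apply: eq_bigr => i _; rewrite mulrC.
Qed.

(** * Moebius transformations *)

Section MoebiusTransformation.
Variables (K : numFieldType) (s : nat) (tau : transformation K).
Local Notation r := s.+3.
Local Notation m := (r - 2)%N.
Variables (alpha beta gamma delta C : K) (X0 : K -> K).
Hypothesis mf : moebius_form r tau alpha beta gamma delta C X0.

Local Notation A := (tr_dom tau).
Local Notation T := (tr_t tau).
Local Notation X := (tr_x tau).
Local Notation P := (prolong T X).
Let U := t_range tau.
Let w t := gamma * t + delta.
Let Delta := alpha * delta - beta * gamma.
Let T0 t := (alpha * t + beta) / w t.
Let X1 t := C / w t ^+ s.+2.
Local Notation pcoef := (pcoef T0 X1).
Local Notation pcst := (pcst T0 X0).

Let lA := tr_domP tau.
Let oA : open A. Proof. by case: lA. Qed.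
Let oU : open U. Proof. exact: open_fst_range lA. Qed.
Let Delta0 : Delta != 0. Proof. by case: mf. Qed.
Let C0 : C != 0. Proof. by case: mf. Qed.
Let sX0 : smooth_on U X0. Proof. by case: mf. Qed.
Let w0 t : U t -> w t != 0.
Proof. by move=> /fst_range[x Ax]; case: mf => _ _ _ /(_ t x Ax) []. Qed.
Let TE t x : A (t, x) -> T (t, x) = T0 t.
Proof. by move=> Ax; case: mf => _ _ _ /(_ t x Ax) []. Qed.
Let XE t x : A (t, x) -> X (t, x) = X1 t * x + X0 t.
Proof. by move=> Ax; case: mf => _ _ _ /(_ t x Ax) []. Qed.

Let mr : (m < r)%N. Proof. by rewrite ltn_subrL. Qed.

Lemma smooth_affine (a b : K) (V : set K) : open V -> smooth_on V (fun t => a * t + b).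
Proof.
move=> oV n; apply: upto_add => //; last exact: upto_cst.
by apply: upto_mul => //; [exact: upto_cst|exact: upto_id].
Qed.

Let sT0 : smooth_on U T0.
Proof.
move=> n; apply: upto_mul => //; first exact: smooth_affine.
by apply: upto_inv => //; exact: smooth_affine.
Qed.

Let sX1 : smooth_on U X1.
Proof.
move=> n; apply: upto_mul => //; first exact: upto_cst.
apply: upto_inv => //; first by move=> z Uz; rewrite expf_neq0 // w0.
by apply: upto_exp => //; exact: smooth_affine.
Qed.

Let dT0 t : U t -> derive1 T0 t = Delta / w t ^+ 2.
Proof. exact: (derive1_moebius oU w0 (fun _ _ => erefl)). Qed.

Let T0' t : U t -> derive1 T0 t != 0.
Proof. by move=> Ut; rewrite dT0 // mulf_neq0 // invr_neq0 // expf_neq0 // w0. Qed.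

Let X10 t : U t -> X1 t != 0.
Proof. by move=> Ut; rewrite mulf_neq0 // invr_neq0 // expf_neq0 // w0. Qed.

Let AU t : U t <-> exists x, A (t, x). Proof. exact: fst_range. Qed.

Let range_AU t x : A (t, x) -> U t. Proof. by move=> Ax; apply/AU; exists x. Qed.

Let pcoef_top j t : U t -> (j < r)%N -> pcoef r j t = 0.
Proof. exact: (pcoef_moebius_top oU Delta0 w0 (fun _ _ => erefl) (fun _ _ => erefl)). Qed.

Lemma pcoef_diag_neq0 k t : U t -> pcoef k k t != 0.
Proof.
by move=> Ut; rewrite (pcoef_diag _ _ oU) // mulf_neq0 ?X10 // invr_neq0 // expf_neq0 // T0'.
Qed.

Let M t : 'M[K]_m := \matrix_(k, j) pcoef k j t.

Lemma M_unit t : U t -> M t \in unitmx.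
Proof.
move=> Ut; rewrite unitmxE det_trig; last first.
  by apply/is_trig_mxP => i j ij; rewrite mxE (pcoef_gt _ _ oU).
rewrite unitfE; apply/prodf_neq0 => i _; rewrite mxE; exact: pcoef_diag_neq0.
Qed.

(* The matrix [M] expresses the derivatives of order less than r - 2, so the
   coefficients [a'] of the target equation solve [a' *m M = pcoef r r *: a]. *)
Definition target_coef t (a : 'rV[K]_m) : 'rV[K]_m := pcoef r r t *: (a *m invmx (M t)).

Definition target_rhs t (a : 'rV[K]_m) (b : K) : K :=
  pcoef r r t * b + pcst r t + \sum_(k < m) target_coef t a 0 k * pcst k t.

Lemma target_coef_mulM t a : U t -> target_coef t a *m M t = pcoef r r t *: a.
Proof. by move=> Ut; rewrite /target_coef -scalemxAl mulmxKV // M_unit. Qed.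

Lemma target_coefP t a j : U t -> (j < r)%N ->
  \sum_(k < m) target_coef t a 0 k * pcoef k j t = pcoef r r t * row_coef a j.
Proof.
move=> Ut jr; have [jm|mj] := ltnP j m.
  have := congr1 (fun v : 'rV_m => v 0 (Ordinal jm)) (target_coef_mulM a Ut).
  rewrite [LHS]mxE [RHS]mxE -(row_coefE a (Ordinal jm)) /= => <-.
  by apply: eq_bigr => k _; congr (_ * _); rewrite mxE.
rewrite row_coef_ge // mulr0 big1 // => k _.
by rewrite (pcoef_gt _ _ oU) ?mulr0 // (leq_trans (ltn_ord k)).
Qed.

(** At all jets over the domain, not only on the equation, the target expression is a nonzero
    multiple of the source one; this yields both directions in [maps_equation]. *)
Lemma prolong_targetE t u a b : A (t, u 0%N) ->
  P r t u + \sum_(k < m) target_coef t a 0 k * P k t u - target_rhs t a b =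
  pcoef r r t * (u r + \sum_(k < m) a 0 k * u k - b).
Proof.
move=> Au; have Ut := range_AU Au.
(* [lhs_affine] is applied with its right-hand side equal to the source expression itself, so no
   equation is imposed on u. *)
rewrite (lhs_affine (a := a) oU sT0 sX1 sX0 T0' mr oA AU TE XE (target_coef t a) (target_rhs t a b) Au (erefl _)).
rewrite big1 ?add0r; last first.
  by move=> j _; rewrite pcoef_top // sub0r target_coefP // addNr mul0r.
by rewrite /target_rhs; ring.
Qed.

Lemma target_unique t (a a' : 'rV[K]_m) b b' : U t ->
  (forall u, A (t, u 0%N) -> u r + \sum_(k < m) a 0 k * u k = b ->
     P r t u + \sum_(k < m) a' 0 k * P k t u = b') ->
  a' = target_coef t a /\ b' = target_rhs t a b.
Proof.
move=> Ut h; have [h1 h2] := image_coefs oU sT0 sX1 sX0 T0' mr oA AU TE XE Ut h.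
have E : a' = target_coef t a.
  rewrite -[LHS](mulmxK (M_unit Ut)) /target_coef scalemxAl; congr (_ *m _).
  apply/rowP => j; rewrite !mxE.
  have jr : (j < r)%N by rewrite (ltn_trans (ltn_ord j)).
  have := h1 j jr; rewrite pcoef_top // sub0r addrC => /eqP.
  rewrite subr_eq0 row_coefE => /eqP <-.
  by apply: eq_bigr => k _; rewrite mxE.
by split=> //; rewrite -h2 E.
Qed.

Lemma smooth_invM k j : smooth_on U (fun t => invmx (M t) k j).
Proof.
move=> n; apply: upto_invmx => //; first exact: M_unit.
move=> i l; apply: (upto_eq (f := pcoef i l)) => // [z _|]; first by rewrite mxE.
exact: smooth_pcoef.
Qed.

Lemma pcst_X0 (V : set K) k t : open V -> V `<=` U -> (forall x, V x -> X0 x = 0) -> V t -> pcst k t = 0.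
Proof.
move=> oV VU h; elim: k t => [|k IH] t Vt /=; first exact: h.
by rewrite (derive1_eq0 oV Vt IH) mul0r.
Qed.

Lemma target_coef_coord t a j : target_coef t a 0 j =
  pcoef r r t * \sum_(i < m) a 0 i * invmx (M t) i j.
Proof. by rewrite !mxE. Qed.

Lemma upto_target_coef n (V : normedModType K) (B : set V) (f : V -> K) (a : V -> 'rV[K]_m) j :
  open B -> (forall z, B z -> U (f z)) -> differentiable_upto n B f ->
  differentiable_upto n B a ->
  differentiable_upto n B (fun z => target_coef (f z) (a z) 0 j).
Proof.
move=> oB BU sf sa; under eq_fun do rewrite target_coef_coord.
apply: upto_mul => //.
  by apply: (upto_comp1 oB oU BU sf); exact: smooth_pcoef.
apply: upto_sum => // i; apply: upto_mul => //; first exact: coord_linear_upto.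
by apply: (upto_comp1 (g := fun t => invmx (M t) i j) oB oU BU sf); exact: smooth_invM.
Qed.

Lemma upto_target_rhs n (V : normedModType K) (B : set V) (f : V -> K) (a : V -> 'rV[K]_m) (b : V -> K) :
  open B -> (forall z, B z -> U (f z)) -> differentiable_upto n B f ->
  differentiable_upto n B a -> differentiable_upto n B b ->
  differentiable_upto n B (fun z => target_rhs (f z) (a z) (b z)).
Proof.
move=> oB BU sf sa sb.
have sc k : differentiable_upto n B (fun z => pcst k (f z)).
  by apply: (upto_comp1 oB oU BU sf); exact: smooth_pcst.
rewrite /target_rhs; apply: upto_add => //.
  apply: upto_add => //; apply: upto_mul => //.
  by apply: (upto_comp1 oB oU BU sf); exact: smooth_pcoef.
by apply: upto_sum => // k; apply: upto_mul => //; exact: upto_target_coef.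
Qed.

Lemma regular_jet_moebius t u : regular_jet tau t u <-> A (t, u 0%N).
Proof.
split=> [[]//|Au]; split=> //.
by have Ut := range_AU Au; rewrite (total_derivative_T oA TE) // T0'.
Qed.

Lemma point_moebius : point_transformation tau.
Proof.
have s1 : smooth_on A (fun z : K * K => z.1).
  by move=> n; apply: upto_fst => //; exact: upto_idV.
have s2 : smooth_on A (fun z : K * K => z.2).
  by move=> n; apply: upto_snd => //; exact: upto_idV.
have U1 z : A z -> U z.1 by case: z => t x; exact: range_AU.
have sT : smooth_on A T.
  move=> n; apply: (upto_eq (f := fun z => T0 z.1)) => //; first by case=> t x /TE.
  exact: upto_comp1 oA oU U1 (s1 n) (sT0 n).
have sX : smooth_on A X.
  move=> n; apply: (upto_eq (f := fun z => X1 z.1 * z.2 + X0 z.1)) => //.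
    by case=> t x /XE.
  apply: upto_add => //; last exact: upto_comp1 oA oU U1 (s1 n) (sX0 n).
  by apply: upto_mul => //; exact: upto_comp1 oA oU U1 (s1 n) (sX1 n).
split=> // -[t x] Ax; rewrite /Defs.jacobian.
suff : pdt T (t, x) * pdx X (t, x) - pdx T (t, x) * pdt X (t, x) != 0.
  by rewrite !pdtE !pdxE.
have Ut := range_AU Ax.
have -> : pdx T (t, x) = 0.
  apply: (is_derive_near_cst (c := T0 t) _ (is_derive_section_x sT Ax)).
  by apply: filterS (near_section_x oA Ax) => y /TE.
have -> : pdx X (t, x) = X1 t.
  have [_ <-] := is_derive_section_x sX Ax.
  rewrite (near_eq_derive (g := fun y => X1 t * y + X0 t)); last first.
    by apply: filterS (near_section_x oA Ax) => y /XE.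
  by have [_ ->] := is_derive_affine (X1 t) (X0 t) x.
have -> : pdt T (t, x) = derive1 T0 t.
  have [_ <-] := is_derive_section_t sT Ax; rewrite derive1E; apply: near_eq_derive.
  by apply: filterS (near_section_t oA Ax) => y /TE.
by rewrite mul0r subr0 mulf_neq0 ?T0' ?X10.
Qed.

Let imoebius y := (delta * y - beta) / (alpha - gamma * y).

Lemma imoebius_den t : U t -> alpha - gamma * T0 t = Delta / w t.
Proof. by move=> Ut; have := w0 Ut; rewrite /T0 /Delta /w => wt; field. Qed.

Lemma imoebiusK t : U t -> imoebius (T0 t) = t.
Proof.
move=> Ut; have := w0 Ut; have := Delta0; rewrite /imoebius imoebius_den // /T0.
rewrite /Delta /w => D0 wt; field.
by rewrite wt.
Qed.

(** T0 is injective on U with inverse [imoebius], so coefficients computed at t become functions of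
    T0 t. They are smooth on the open set [W], which contains the image of [V]. *)
Lemma target_equation (V : set K) (a : K -> 'rV[K]_m) (b : K -> K) :
  open V -> V `<=` U -> smooth_on V a -> smooth_on V b ->
  exists E' : equation ('rV[K]_m * K)%type, forall t, V t ->
    eq_dom E' (T0 t) /\ eq_par E' (T0 t) = (target_coef t (a t), target_rhs t (a t) (b t)).
Proof.
move=> oV VU sa sb.
pose den y := - gamma * y + alpha.
have denE y : den y = alpha - gamma * y by rewrite /den; ring.
pose B := [set y | den y != 0].
have sden := smooth_affine (- gamma) alpha.
have oB : open B.
  apply: (@open_comp _ _ den [set y | y != 0]) => [y _|]; last exact: open_neq0.
  exact: (smooth_continuous (sden _ openT)).
have si n : differentiable_upto n B imoebius.
  apply: (upto_eq (f := fun y => (delta * y + - beta) / den y)) => //.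
    by move=> y _; rewrite denE.
  by apply: upto_mul => //; [exact: smooth_affine|apply: upto_inv => //; exact: sden].
pose W := B `&` imoebius @^-1` V.
have oW : open W.
  rewrite openE => y [By Vy]; apply: filterI; first exact: (open_nbhs_nbhs (conj oB By)).
  have c : {for y, continuous imoebius} by apply: (smooth_continuous si By).
  exact: c _ (open_nbhs_nbhs (conj oV Vy)).
have WV y : W y -> V (imoebius y) by case.
have WU y : W y -> U (imoebius y) by move=> /WV /VU.
have siW n : differentiable_upto n W imoebius by apply: upto_sub (si n) => y [].
have sa' n : differentiable_upto n W (fun y => a (imoebius y)).
  apply: upto_row => // j.
  apply: (upto_comp1 (g := fun t => a t 0 j) oW oV WV (siW n)).
  exact: coord_linear_upto.
have sp : smooth_on W (fun y => (target_coef (imoebius y) (a (imoebius y)),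
    target_rhs (imoebius y) (a (imoebius y)) (b (imoebius y)))).
  move=> n; apply: upto_pair => //; first by apply: upto_row => // j; exact: upto_target_coef.
  by apply: upto_target_rhs => //; exact: (upto_comp1 oW oV WV (siW n)).
exists (Equation oW sp) => t Vt; have Ut := VU _ Vt; rewrite /= imoebiusK //; split=> //.
split; last by rewrite /= imoebiusK.
by rewrite /B /= denE imoebius_den // mulf_neq0 // invr_neq0 // w0.
Qed.

Local Notation LF := (@laguerre_forsyth K r).
Local Notation LFhom := (@laguerre_forsyth_hom K r).

Lemma maps_inhP (E E' : equation ('rV[K]_m * K)%type) : maps_equation LF tau E E' <->
  forall t, U t -> eq_dom E t -> eq_dom E' (T0 t) /\
    eq_par E' (T0 t) = (target_coef t (eq_par E t).1, target_rhs t (eq_par E t).1 (eq_par E t).2).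
Proof.
split=> [h t Ut Et|h t u Et /regular_jet_moebius Au]; last first.
  have Ut := range_AU Au; have [d e] := h t Ut Et; rewrite TE //; split=> //.
  rewrite e /laguerre_forsyth /laguerre_forsyth_hom prolong_targetE //; split=> [->|/eqP].
    by rewrite mulr0.
  by rewrite mulf_eq0 (negbTE (pcoef_diag_neq0 _ Ut)) => /eqP.
have hh u : A (t, u 0%N) -> u r + \sum_(k < m) (eq_par E t).1 0 k * u k = (eq_par E t).2 ->
     P r t u + \sum_(k < m) (eq_par E' (T0 t)).1 0 k * P k t u = (eq_par E' (T0 t)).2.
  move=> Au e; have [_] := h t u Et ((regular_jet_moebius _ _).2 Au); rewrite TE //.
  rewrite /laguerre_forsyth /laguerre_forsyth_hom e subrr => -[/(_ erefl) /eqP + _].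
  by rewrite subr_eq0 => /eqP.
have [x Ax] := (AU t).1 Ut.
(* Any jet over t shows that T0 t lies in the domain of [E']; the constant sequence is one. *)
have [+ _] := h t (fun=> x) Et ((regular_jet_moebius _ _).2 Ax); rewrite TE //.
have [e1 e2] := target_unique Ut hh; split=> //.
by rewrite [LHS]surjective_pairing e1 e2.
Qed.

Lemma maps_homP (E E' : equation 'rV[K]_m) : maps_equation LFhom tau E E' <->
  forall t, U t -> eq_dom E t -> [/\ eq_dom E' (T0 t),
    eq_par E' (T0 t) = target_coef t (eq_par E t) & target_rhs t (eq_par E t) 0 = 0].
Proof.
split=> [h t Ut Et|h t u Et /regular_jet_moebius Au]; last first.
  have Ut := range_AU Au; have [d e b0] := h t Ut Et; rewrite TE //; split=> //.
  rewrite e /laguerre_forsyth_hom -[X in _ <-> X = 0]subr0 -[X in _ - X]b0 prolong_targetE // subr0.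
  split=> [->|/eqP]; first by rewrite mulr0.
  by rewrite mulf_eq0 (negbTE (pcoef_diag_neq0 _ Ut)) => /eqP.
have hh u : A (t, u 0%N) -> u r + \sum_(k < m) (eq_par E t) 0 k * u k = 0 ->
     P r t u + \sum_(k < m) (eq_par E' (T0 t)) 0 k * P k t u = 0.
  move=> Au e; have [_] := h t u Et ((regular_jet_moebius _ _).2 Au); rewrite TE //.
  by rewrite /laguerre_forsyth_hom e => -[/(_ erefl)].
have [x Ax] := (AU t).1 Ut.
have [+ _] := h t (fun=> x) Et ((regular_jet_moebius _ _).2 Ax); rewrite TE //.
by have [e1 e2] := target_unique Ut hh; split.
Qed.

(** The shape f(h v + z) = f z + h L is the one that [derive_affine] asks for. *)
Lemma target_coefD t (a a' : 'rV[K]_m) (h : K) : target_coef t (h *: a + a') = target_coef t a' + h *: target_coef t a.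
Proof.
rewrite /target_coef mulmxDl -scalemxAl scalerDr addrC; congr (_ + _).
by rewrite !scalerA; congr (_ *: _); exact: mulrC.
Qed.

Lemma target_rhsD t (a a' : 'rV[K]_m) (b b' h : K) : target_rhs t (h *: a + a') (h * b + b') =
  target_rhs t a' b' + h * (pcoef r r t * b + \sum_(k < m) target_coef t a 0 k * pcst k t).
Proof.
rewrite /target_rhs target_coefD; move: (target_coef t a') (target_coef t a) => x y.
have -> : \sum_(k < m) (x + h *: y) 0 k * pcst k t =
    \sum_(k < m) x 0 k * pcst k t + h * \sum_(k < m) y 0 k * pcst k t.
  rewrite mulr_sumr -big_split; apply: eq_bigr => k _ /=.
  by rewrite !mxE mulrDl mulrA.
ring.
Qed.

Lemma target_coef_inj0 t (a : 'rV[K]_m) : U t -> target_coef t a = 0 -> a = 0.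
Proof.
move=> Ut a0; have := target_coef_mulM a Ut; rewrite a0 mul0mx => /esym/eqP.
by rewrite scaler_eq0 (negbTE (pcoef_diag_neq0 _ Ut)) => /eqP.
Qed.

Lemma joint_pointE (W : normedModType K) (z : joint W r) :
  z = joint_point r z.1.1 (fun i => z.1.2 0 (inord i)) z.2.
Proof.
case: z => [[t u] p]; rewrite /joint_point /=; congr (_, _, _).
by apply/rowP => i; rewrite mxE inord_val.
Qed.

Lemma joint_domainE (W : normedModType K) (z : joint W r) :
  joint_domain tau z <-> A (z.1.1, z.1.2 0 ord0).
Proof.
rewrite /joint_domain /= regular_jet_moebius.
by rewrite (_ : inord 0 = ord0) //; apply: val_inj; rewrite /= inordK.
Qed.

Lemma joint_point_domain (W : normedModType K) t u (p : W) :
  regular_jet tau t u -> joint_domain tau (joint_point r t u p).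
Proof. by rewrite joint_domainE regular_jet_moebius /= mxE. Qed.

Lemma open_joint_domain (W : normedModType K) : open (joint_domain tau : set (joint W r)).
Proof.
pose f (z : joint W r) := (z.1.1, z.1.2 0 ord0).
have sf : differentiable_upto 1 setT f.
  have s0 := upto_idV 1 (setT : set (joint W r)); have oT := @openT (joint W r).
  have s1 := upto_fst oT s0.
  apply: upto_pair => //; first exact: upto_fst.
  by apply: coord_linear_upto => //; exact: upto_snd.
rewrite (_ : joint_domain tau = f @^-1` A).
  apply: open_comp => // z _; apply: differentiable_continuous; by case: sf => + _; apply.
by apply/seteqP; split=> z /joint_domainE.
Qed.

Lemma joint_U (W : normedModType K) (z : joint W r) : joint_domain tau z -> U z.1.1.
Proof. by move=> /joint_domainE /range_AU. Qed.

(* [X0 = X1 * (psi / C)]: the transformation is the shift by [psi / C] followed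
   by the one with [X0 = 0]. *)
Let psi t := w t ^+ s.+2 * X0 t.

Lemma smooth_psi : smooth_on U psi.
Proof.
move=> n; apply: upto_mul => //.
by apply: upto_exp => //; exact: smooth_affine.
Qed.

(** By [pcst_derive1n] each [pcst k] is the linear part of P_k applied to psi / C, and [target_coef]
    carries the source operator to the target operator. So a homogeneous equation has a homogeneous
    target exactly when psi solves it. *)
Lemma target_rhs_psi t a : U t ->
  target_rhs t a 0 = C^-1 * pcoef r r t * LFhom (fun k => derive1n k psi t) a.
Proof.
move=> Ut; rewrite /target_rhs mulr0 add0r.
have X0E (t' : K) : U t' -> X0 t' = C^-1 * (X1 t' * psi t').
  move=> Ut'; have := w0 Ut'; have := C0; rewrite /X1 /psi; move: (X0 t') => x C0' wt.
  by move: (expf_neq0 s.+2 wt); move: (w t' ^+ s.+2) => y y0; field; rewrite y0 C0'.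
have pE k := pcst_derive1n k oU sT0 sX1 smooth_psi T0' X0E Ut.
rewrite (pE r) big_ord_recr [X in _ * (X + _)]big1 ?add0r => [|j _]; last first.
  by rewrite pcoef_top ?mul0r //; exact: (ltn_ord j).
rewrite (eq_bigr (fun k : 'I_m => C^-1 * \sum_(j < r) target_coef t a 0 k * pcoef k j t * derive1n j psi t)).
  rewrite -mulr_sumr exchange_big.
  rewrite (eq_bigr (fun j : 'I_r => pcoef r r t * (row_coef a j * derive1n j psi t))).
    rewrite -mulr_sumr -(sum_row_coef mr a (fun j => derive1n j psi t)).
    rewrite -mulrDr -mulrDr mulrA.
    by congr (_ * (_ + _)).
  by move=> j _; rewrite -mulr_suml target_coefP // mulrA.
move=> k _; have kr : (k < r)%N by rewrite (ltn_trans (ltn_ord k)).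
rewrite (pE k) (sum_pcoef _ _ oU (fun j => derive1n j psi t) kr Ut) mulrCA; congr (_ * _).
by rewrite mulr_sumr; apply: eq_bigr => j _; rewrite mulrA.
Qed.

Lemma equivalence_inh : @equivalence_transformation K ('rV[K]_m * K)%type r LF tau
  (fun z => (target_coef z.1.1 z.2.1, target_rhs z.1.1 z.2.1 z.2.2)).
Proof.
split; first exact: point_moebius.
- move=> n; have oJ := @open_joint_domain ('rV[K]_m * K)%type.
  have s0 := upto_idV n (joint_domain tau : set (joint ('rV[K]_m * K)%type r)).
  have s1 := upto_fst oJ (upto_fst oJ s0); have s2 := upto_snd oJ s0.
  have s21 := upto_fst oJ s2; have s22 := upto_snd oJ s2.
  apply: upto_pair => //.
    by apply: upto_row => // j; apply: upto_target_coef => // z; exact: joint_U.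
  by apply: upto_target_rhs => // z; exact: joint_U.
- move=> z /joint_U Uz v v0.
  (* Both components are affine in (a, b). The linear part vanishes only at v = 0, by injectivity of
     [target_coef] and nonvanishing of [pcoef r r]. *)
  rewrite (derive_affine (L := (target_coef z.1.1 v.1, pcoef r r z.1.1 * v.2 +
     \sum_(k < m) target_coef z.1.1 v.1 0 k * pcst k z.1.1))); last first.
    move=> h /=; rewrite scaler0 add0r target_coefD.
    by rewrite [X in (_, X)](target_rhsD z.1.1 v.1 z.2.1 v.2 z.2.2 h).
  apply: contra v0 => /eqP [a0 b0]; have v10 := target_coef_inj0 Uz a0.
  move: b0; rewrite a0 big1 ?addr0 => [b0|k _]; last by rewrite mxE mul0r.
  have v20 : v.2 = 0 by apply: (mulfI (pcoef_diag_neq0 r Uz)); rewrite mulr0.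
  by apply/eqP; rewrite [v]surjective_pairing v10 v20.
- move=> E; have oE : open (eq_dom E) by apply: eq_dom_open.
  have sE := @eq_par_smooth _ _ E.
  have oV : open (eq_dom E `&` U) by exact: openI.
  have sV : smooth_on (eq_dom E `&` U) (eq_par E).
    by move=> n; apply: upto_sub (sE n) => t [].
  have sa : smooth_on (eq_dom E `&` U) (fun t => (eq_par E t).1).
    by move=> n; apply: upto_fst.
  have sb : smooth_on (eq_dom E `&` U) (fun t => (eq_par E t).2).
    by move=> n; apply: upto_snd.
  have [E' hE'] := target_equation oV (@subIsetr _ _ _) sa sb.
  exists E'; split; first by apply/maps_inhP => t Ut Et; exact: hE'.
  move=> t u Et /regular_jet_moebius Au; rewrite TE //.
  by have [] := hE' t (conj Et (range_AU Au)).
Qed.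

(** The target is built as an inhomogeneous equation; its right-hand side vanishes over the range by
    hypothesis, so dropping it changes nothing there. *)
Lemma hom_target (E : equation 'rV[K]_m) :
  (forall t, U t -> eq_dom E t -> target_rhs t (eq_par E t) 0 = 0) ->
  exists E' : equation 'rV[K]_m, maps_equation LFhom tau E E'.
Proof.
move=> b0; have oE : open (eq_dom E) by apply: eq_dom_open.
  have sE := @eq_par_smooth _ _ E.
have oV : open (eq_dom E `&` U) by exact: openI.
have sV : smooth_on (eq_dom E `&` U) (eq_par E).
  by move=> n; apply: upto_sub (sE n) => t [].
have sb : smooth_on (eq_dom E `&` U) (fun=> 0 : K) by move=> n; exact: upto_cst.
have [E' hE'] := target_equation oV (@subIsetr _ _ _) sV sb.
have sE' : smooth_on (eq_dom E') (fun t => (eq_par E' t).1).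
  by move=> n; apply: upto_fst; [apply: eq_dom_open|apply: eq_par_smooth].
exists (Equation (@eq_dom_open _ _ E') sE'); apply/maps_homP => t Ut Et.
by have [d e] := hE' t (conj Et Ut); split=> //=; [rewrite e|exact: b0].
Qed.

Lemma equivalence_hom (B : joint 'rV[K]_m r -> 'rV[K]_m) :
  (forall t, U t -> X0 t = 0) ->
  (forall z, joint_domain tau z -> B z = target_coef z.1.1 z.2) ->
  equivalence_transformation LFhom tau B.
Proof.
move=> X00 BE; have oJ := @open_joint_domain 'rV[K]_m.
split; first exact: point_moebius.
- move=> n; apply: (upto_eq (f := fun z : joint 'rV[K]_m r => target_coef z.1.1 z.2)) => //.
    by move=> z /BE.
  have s0 := upto_idV n (joint_domain tau : set (joint 'rV[K]_m r)).
  have s1 := upto_fst oJ (upto_fst oJ s0); have s2 := upto_snd oJ s0.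
  by apply: upto_row => // j; apply: upto_target_coef => // z; exact: joint_U.
- move=> z Jz v; have Uz := joint_U Jz; apply: contra => /eqP d0; apply/eqP.
  apply: (target_coef_inj0 Uz); rewrite -d0.
  rewrite (near_eq_derive (g := fun z : joint 'rV[K]_m r => target_coef z.1.1 z.2)); last first.
    exact: near_open oJ Jz BE.
  symmetry; apply: derive_affine => h /=; by rewrite scaler0 add0r target_coefD.
- move=> E; have [|E' hE'] := @hom_target E.
    move=> t Ut _; rewrite /target_rhs mulr0 add0r big1 ?addr0 => [|k _].
      exact: (pcst_X0 _ oU).
    by rewrite (pcst_X0 _ oU) ?mulr0.
  exists E'; split=> // t u Et /[dup] ru /regular_jet_moebius Au.
  have Ut := range_AU Au; have [d e _] := (maps_homP E E').1 hE' t Ut Et.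
  by rewrite TE // e BE //; exact: joint_point_domain.
Qed.

(** A test equation, defined for all t: since an equivalence transformation must map it for every
    [p], its components are determined pointwise. *)
Definition cst_equation (W : normedModType K) (p : W) : equation W :=
  Equation (@openT K) (fun n => upto_cst n setT p).

Lemma equivalence_inh_unique B t u p : @equivalence_transformation K ('rV[K]_m * K)%type r LF tau B ->
  regular_jet tau t u ->
  B (joint_point r t u p) = (target_coef t p.1, target_rhs t p.1 p.2).
Proof.
move=> [_ _ _ /(_ (cst_equation p)) [E' [hE' BE]]] ru.
have Au := (regular_jet_moebius _ _).1 ru.
have [_ /= <-] := (maps_inhP _ _).1 hE' t (range_AU Au) I.
by rewrite -(TE Au) BE.
Qed.

(** Testing on constant equations yields, besides the component for [a], that [target_rhs] vanishes
    for every [a]; X0 = 0 is deduced from this in [hom_equivalences]. *)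
Lemma equivalence_hom_unique B t u a : equivalence_transformation (r := r) LFhom tau B ->
  regular_jet tau t u ->
  B (joint_point r t u a) = target_coef t a /\ target_rhs t a 0 = 0.
Proof.
move=> [_ _ _ /(_ (cst_equation a)) [E' [hE' BE]]] ru.
have Au := (regular_jet_moebius _ _).1 ru.
have [_ /= <- ->] := (maps_homP _ _).1 hE' t (range_AU Au) I.
by rewrite -(TE Au) BE.
Qed.

End MoebiusTransformation.

(** * Equivalence groups and equivalence groupoid *)

Section Groupoid.
Variables (R : realType) (K : numFieldType) (io : {rmorphism R -> K}) (N : K -> R).
Hypothesis HN : real_norm io N.
Variable s : nat.
Local Notation r := s.+3.
Local Notation m := (r - 2)%N.
Local Notation LF := (@laguerre_forsyth K r).
Local Notation LFhom := (@laguerre_forsyth_hom K r).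

(** Stated so as to serve both classes: the homogeneous one is the case b = b' = 0. *)
Lemma moebius_necessary (tau : transformation K) (a a' : K -> 'rV[K]_m) (b b' : K -> K) :
  point_transformation tau ->
  (forall t u, regular_jet tau t u -> lin_eq (s := s) u (a t) (b t) ->
     lin_eq (s := s) (fun k => prolong (tr_t tau) (tr_x tau) k t u)
       (a' (tr_t tau (t, u 0%N))) (b' (tr_t tau (t, u 0%N)))) ->
  exists alpha beta gamma delta C X0, moebius_form r tau alpha beta gamma delta C X0.
Proof.
move=> ptau h; have lA := tr_domP tau.
have [|T0 [X1 [X0 [sT0 sX1 sX0 TXE nz]]]] := @affine_data _ _ _ _ HN s tau ptau.
  move=> t x Ax; exists (a t), (b t), (a' (tr_t tau (t, x))), (b' (tr_t tau (t, x))).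
  by move=> u <-; exact: h.
set U := t_range tau in sT0 sX1 sX0 nz.
have oA : open (tr_dom tau) by case: lA.
have oU : open U by exact: open_fst_range lA.
have cU : connected U by exact: connected_fst_range lA.
have AU t : U t <-> exists x, tr_dom tau (t, x) by exact: fst_range.
have TE t x : tr_dom tau (t, x) -> tr_t tau (t, x) = T0 t by move=> /TXE [].
have XE t x : tr_dom tau (t, x) -> tr_x tau (t, x) = X1 t * x + X0 t by move=> /TXE [].
have T0' t : U t -> derive1 T0 t != 0 by move=> /nz [].
have X10 t : U t -> X1 t != 0 by move=> /nz [].
have mr : (m < r)%N by rewrite ltn_subrL.
(* At the indices r - 2 and r - 1 neither the source coefficients nor the P_k with k < r - 2
   contribute, so the coefficients of P_r itself vanish. *)
have top t j : U t -> (m <= j < r)%N -> pcoef T0 X1 r j t = 0.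
  move=> Ut /andP[mj jr].
  have hh u : tr_dom tau (t, u 0%N) -> u r + \sum_(k < m) (a t) 0 k * u k = b t ->
      prolong (tr_t tau) (tr_x tau) r t u +
      \sum_(k < m) (a' (T0 t)) 0 k * prolong (tr_t tau) (tr_x tau) k t u = b' (T0 t).
    move=> Au e; have ru : regular_jet tau t u.
      by split=> //; rewrite (total_derivative_T oA TE) // T0'.
    by have := h t u ru e; rewrite TE.
  have [/(_ j jr) + _] := image_coefs oU sT0 sX1 sX0 T0' mr oA AU TE XE Ut hh.
  rewrite row_coef_ge // mulr0 subr0 big1 ?addr0 // => k _.
  by rewrite (pcoef_gt _ _ oU) ?mulr0 // (leq_trans (ltn_ord k)).
have [[t0 x0] A0] : tr_dom tau !=set0 by case: lA.
have Ut0 : U t0 by apply/AU; exists x0.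
have c1 t : U t -> pcoef T0 X1 r s.+2 t = 0.
  by move=> Ut; apply: top => //; rewrite leq_subLR /= ltnSn andbT; exact: leqnSn.
have c2 t : U t -> pcoef T0 X1 r s.+1 t = 0.
  by move=> Ut; apply: top => //; rewrite leq_subLR /=; apply/andP; split=> //; exact: leqW.
have [alpha [beta [gamma [delta [C [D0 C0 mE]]]]]] :=
  moebius_solve HN oU cU Ut0 sT0 sX1 T0' X10 c1 c2.
exists alpha, beta, gamma, delta, C, X0; split=> // t x Ax.
have [w0 T0E X1E] : _ := mE t ((AU t).2 (ex_intro _ x Ax)).
by rewrite TE // XE // X1E.
Qed.

Lemma inh_projections (tau : transformation K) :
  (exists B, @equivalence_transformation K ('rV[K]_m * K)%type r LF tau B) <->
  exists alpha beta gamma delta C X0, moebius_form r tau alpha beta gamma delta C X0.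
Proof.
split=> [[B [ptau _ _ h]]|[alpha [beta [gamma [delta [C [X0 mf]]]]]]]; last first.
  by eexists; exact: equivalence_inh mf.
have [E' [hE' _]] := h (cst_equation (0, 0)).
apply: (@moebius_necessary tau (fun=> 0) (fun y => (eq_par E' y).1) (fun=> 0)
  (fun y => (eq_par E' y).2) ptau) => t u ru e.
have [_ [+ _]] := hE' t u I ru; rewrite /laguerre_forsyth /laguerre_forsyth_hom /= subr0.
by move=> /(_ e) /eqP; rewrite subr_eq0 => /eqP.
Qed.

Lemma hom_projections (tau : transformation K) (E E' : equation 'rV[K]_m) :
  point_transformation tau -> over_domain tau E -> maps_equation LFhom tau E E' ->
  exists alpha beta gamma delta C X0, moebius_form r tau alpha beta gamma delta C X0.
Proof.
move=> ptau oE h; apply: (@moebius_necessary tau (eq_par E) (eq_par E') (fun=> 0)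
  (fun=> 0) ptau) => t u ru e.
have Et : eq_dom E t by apply: oE; apply/fst_range; exists (u 0%N); case: ru.
by have [_ [+ _]] := h t u Et ru; apply.
Qed.

Lemma target_rhs0_psi (tau : transformation K) alpha beta gamma delta C X0 :
  moebius_form r tau alpha beta gamma delta C X0 -> forall t a, t_range tau t ->
  target_rhs alpha beta gamma delta C X0 t a 0 = 0 <->
  LFhom (fun k => derive1n k (fun t => (gamma * t + delta) ^+ s.+2 * X0 t) t) a = 0.
Proof.
move=> mf t a Ut; rewrite (target_rhs_psi mf a Ut).
have C0 : C^-1 != 0 by rewrite invr_neq0 //; case: mf.
have c0 := pcoef_diag_neq0 mf r Ut; split=> [e|->]; last by rewrite mulr0.
by apply: (mulfI (mulf_neq0 C0 c0)); rewrite mulr0.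
Qed.

Lemma hom_equivalences (tau : transformation K) (A : joint 'rV[K]_m r -> 'rV[K]_m) :
  equivalence_transformation LFhom tau A <->
  (exists B,
     [/\ @equivalence_transformation K ('rV[K]_m * K)%type r LF tau B,
         exists alpha beta gamma delta C,
           moebius_form r tau alpha beta gamma delta C (fun=> 0) &
         forall t u (a : 'rV[K]_m) (b : K), regular_jet tau t u ->
           A (joint_point r t u a) = (B (joint_point r t u (a, b))).1]).
Proof.
split=> [eA|[B [eB [alpha [beta [gamma [delta [C mf]]]]] AB]]]; last first.
  apply: (equivalence_hom mf) => // z Jz; rewrite [in LHS](joint_pointE z).
  by rewrite (AB _ _ _ 0 Jz) (equivalence_inh_unique mf).
have [ptau _ _ h] := eA; have [E' [hE' _]] := h (cst_equation 0).
have [alpha [beta [gamma [delta [C [X0 mf]]]]]] :=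
  @hom_projections tau (cst_equation 0) E' ptau (fun _ _ => I) hE'.
have X00 t : t_range tau t -> X0 t = 0.
  move=> Ut; have /fst_range[x Ax] := Ut.
  have ru := (regular_jet_moebius mf t (fun=> x)).2 Ax.
  have e a := (target_rhs0_psi mf a Ut).1 (equivalence_hom_unique mf a eA ru).2.
  have m0 : (0 < m)%N by [].
  (* psi satisfies every constant-coefficient equation of the class at t; comparing x^(r) = 0 with
     x^(r) + x = 0 gives psi = 0, hence X0 = 0. *)
  have e0 := e 0; have e1 := e (delta_mx 0 (Ordinal m0)).
  have w0 : (gamma * t + delta) ^+ s.+2 != 0.
    by rewrite expf_neq0 //; case: mf => _ _ _ /(_ t x Ax) [].
  apply: (mulfI w0); rewrite mulr0; move: e0 e1; rewrite /laguerre_forsyth_hom.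
  rewrite big1 ?addr0 => [->|k _]; last by rewrite mxE mul0r.
  rewrite add0r (bigD1 (Ordinal m0)) //= big1 ?addr0 => [|k k0].
    by rewrite mxE !eqxx mul1r.
  by rewrite mxE (negbTE k0) andbF mul0r.
have mf0 : moebius_form r tau alpha beta gamma delta C (fun=> 0).
  case: mf => D0 C0 _ hx; split=> // [n|t x Ax]; first exact: upto_cst.
  by have [w0 -> ->] := hx t x Ax; rewrite X00 //; apply/fst_range; exists x.
eexists; split; first exact: equivalence_inh mf0.
  by exists alpha, beta, gamma, delta, C.
by move=> t u a b ru /=; rewrite (equivalence_hom_unique mf0 a eA ru).1.
Qed.

Lemma admissible_moebius (E E' : equation 'rV[K]_m) (tau : transformation K) :
  admissible LFhom E E' tau ->
  exists alpha beta gamma delta C X0,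
    moebius_form r tau alpha beta gamma delta C X0 /\
    solution LFhom E (t_range tau) (fun t => (gamma * t + delta) ^+ s.+2 * X0 t).
Proof.
move=> [ptau oE h].
have [alpha [beta [gamma [delta [C [X0 mf]]]]]] := hom_projections ptau oE h.
exists alpha, beta, gamma, delta, C, X0; split=> //; split; first exact: smooth_psi mf.
move=> t Ut; apply/(target_rhs0_psi mf _ Ut).
by have [] := (maps_homP mf E E').1 h t Ut (oE _ Ut).
Qed.

Lemma hom_groupoid (E : equation 'rV[K]_m) (tau : transformation K) :
  over_domain tau E ->
  ((exists E', admissible LFhom E E' tau) <->
   (exists alpha beta gamma delta C X0,
      moebius_form r tau alpha beta gamma delta C X0 /\
      solution LFhom E (t_range tau) (fun t => (gamma * t + delta) ^+ s.+2 * X0 t))) /\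
  (forall E1 E2, admissible LFhom E E1 tau -> admissible LFhom E E2 tau ->
     forall z, tr_dom tau z -> eq_par E1 (tr_t tau z) = eq_par E2 (tr_t tau z)).
Proof.
move=> oE; split; first split.
- by move=> [E' /admissible_moebius].
- move=> [alpha [beta [gamma [delta [C [X0 [mf [_ sol]]]]]]]].
  have [|E' hE'] := @hom_target _ _ _ _ _ _ _ _ _ mf E.
    by move=> t Ut _; apply/(target_rhs0_psi mf _ Ut); exact: sol.
  by exists E'; split=> //; exact: point_moebius mf.
move=> E1 E2 ad1 [_ _ h2] [t x] Ax.
have [alpha [beta [gamma [delta [C [X0 [mf _]]]]]]] := admissible_moebius ad1.
have [_ _ h1] := ad1; have Ut : t_range tau t by apply/fst_range; exists x.
have [_ e1 _] := (maps_homP mf E E1).1 h1 t Ut (oE _ Ut).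
have [_ e2 _] := (maps_homP mf E E2).1 h2 t Ut (oE _ Ut).
by case: mf => _ _ _ /(_ t x Ax) [_ -> _]; rewrite e1 e2.
Qed.

Lemma solution_scale (E : equation 'rV[K]_m) (U : set K) (psi : K -> K) c : open U ->
  solution LFhom E U psi -> solution LFhom E U (fun t => c * psi t).
Proof.
move=> oU [spsi sol]; split=> [n|t Ut].
  by apply: upto_mul => //; exact: upto_cst.
have dE k : derive1n k (fun t => c * psi t) t = c * derive1n k psi t.
  apply: (@derive1n_chain _ U k (fun k t => c * derive1n k psi t)) => // j z _ Uz.
  have := is_deriveMK (is_derive_cst c z (1 : K)) (smooth_derive1n_chain j spsi Uz).
  by move=> H; apply: is_derive_eq H _; rewrite mul0r add0r.
have /(congr1 ( *%R c)) := sol t Ut; rewrite mulr0 /laguerre_forsyth_hom mulrDr => e; rewrite -[RHS]e.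
rewrite dE mulr_sumr; congr (_ + _); apply: eq_bigr => k _.
by rewrite dE mulrCA.
Qed.

(** The image under the shift is the preimage under the opposite shift, which gives openness; the
    sections are merely translated. *)
Lemma superposition_domain (A : set (K * K)) (phi : K -> K) : local_domain A ->
  smooth_on (fst @` A) phi -> local_domain (superposition phi @` A).
Proof.
move=> lA sphi; have [A0 oA cA sA] := lA; have oU := open_fst_range lA.
have cont (f : K -> K) (z : K * K) : smooth_on (fst @` A) f -> (fst @` A) z.1 ->
    {for z, continuous (superposition f)}.
  move=> sf Uz; have c1 : w.1 @[w --> z] --> z.1 by exact: cvg_fst.
  have c2 : w.2 @[w --> z] --> z.2 by exact: cvg_snd.
  have c3 : f w.1 @[w --> z] --> f z.1.
    exact: (@cvg_comp _ _ _ fst f _ _ _ c1 (smooth_continuous sf Uz)).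
  exact: cvg_pair c1 (cvgD c2 c3).
have sN : smooth_on (fst @` A) (fun t => - phi t) by move=> n; exact: upto_opp.
have E : superposition phi @` A = superposition (fun t => - phi t) @^-1` A.
  apply/seteqP; split=> [z [[t x] Ax <-]|[t x] Ax] /=.
    by rewrite /superposition /= addrK.
  by exists (t, x - phi t) => //; rewrite /superposition /= subrK.
have imA t : (fun x => x + phi t) @` [set x | A (t, x)] =
    [set x | (superposition phi @` A) (t, x)].
  rewrite E; apply/seteqP; split=> [z [x Ax <-]|x Ax] /=.
    by rewrite /superposition /= addrK.
  by exists (x - phi t) => //; rewrite subrK.
split.
- by have [z Az] := A0; exists (superposition phi z), z.
- rewrite E openE => -[t x] Ax; apply: (cont _ _ sN); first by apply/fst_range; exists (x - phi t).
  by apply: open_nbhs_nbhs; split.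
- apply: connected_continuous_connected => //; apply: continuous_in_subspaceT => z.
  by rewrite inE => Az; apply: cont => //; exists z.
- move=> t; rewrite -imA; apply: connected_continuous_connected; first exact: sA.
  apply: continuous_subspaceT => x; exact: is_derive1_cvg (is_deriveD (is_derive_id x (1 : K)) (is_derive_cst (phi t) x (1 : K))).
Qed.

Lemma hom_semi_normalized : semi_normalized r LFhom.
Proof.
move=> E E' tau ad; have lA := tr_domP tau.
have [alpha [beta [gamma [delta [C [X0 [mf sol]]]]]]] := admissible_moebius ad.
(* X0 = X1 phi for phi = psi / C, so shifting by phi first leaves a transformation [sigma] with X0 =
   0, defined on the shifted domain. *)
have sphi := solution_scale C^-1 (open_fst_range lA) sol.
set phi := (fun t => _) in sphi.
have lD := superposition_domain lA sphi.1.
pose sigma := @Transformation K _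
  (fun z => (alpha * z.1 + beta) / (gamma * z.1 + delta))
  (fun z => C / (gamma * z.1 + delta) ^+ s.+2 * z.2) lD.
have mf' : moebius_form r sigma alpha beta gamma delta C (fun=> 0).
  case: mf => D0 C0 _ hx; split=> // [n|t x [[t' x'] Ax [<- _]]]; first exact: upto_cst.
  by have [w0 _ _] := hx _ _ Ax; rewrite addr0.
exists phi, sigma, (fun z => target_coef alpha beta gamma delta C z.1.1 z.2); split=> //.
  exact: (equivalence_hom mf').
move=> [t x] Ax; case: mf => _ C0 _ /(_ t x Ax) [w0 TE XE].
split; [by exists (t, x)|by rewrite TE|rewrite XE /= mulrDr; congr (_ + _)].
have := expf_neq0 s.+2 w0; rewrite /phi; move: (_ ^+ s.+2) => y y0.
by field; rewrite C0 y0.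
Qed.

End Groupoid.

Theorem corollary13 (R : realType) (K : numFieldType)
    (hK : real_or_complex R K) (r : nat) (hr : (3 <= r)%N) :
  [/\ (* the projections of the elements of G2 are the transformations ( * ) *)
      forall tau : transformation K,
        (exists B, @equivalence_transformation K _ r
                     (@laguerre_forsyth K r) tau B) <->
        (exists alpha beta gamma delta C X0,
           moebius_form r tau alpha beta gamma delta C X0),
      (* hat G2 is obtained from G2 by X0 = 0 and neglecting b *)
      forall (tau : transformation K)
             (A : joint ('rV[K]_(r - 2)) r -> 'rV[K]_(r - 2)),
        equivalence_transformation (@laguerre_forsyth_hom K r) tau A <->
        (exists B,
           [/\ @equivalence_transformation K _ r
                 (@laguerre_forsyth K r) tau B,
               exists alpha beta gamma delta C,
                 moebius_form r tau alpha beta gamma delta C (fun=> 0) &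
               forall t u (a : 'rV[K]_(r - 2)) (b : K),
                 regular_jet tau t u ->
                 A (joint_point r t u a) = (B (joint_point r t u (a, b))).1]),
      uniformly_semi_normalized r (@laguerre_forsyth_hom K r) &
      (* the equivalence groupoid *)
      forall (E : equation ('rV[K]_(r - 2))) (tau : transformation K),
        over_domain tau E ->
        ((exists E', admissible (@laguerre_forsyth_hom K r) E E' tau) <->
         (exists alpha beta gamma delta C X0,
            moebius_form r tau alpha beta gamma delta C X0 /\
            solution (@laguerre_forsyth_hom K r) E (t_range tau)
              (fun t => (gamma * t + delta) ^+ r.-1 * X0 t))) /\
        (forall E1 E2,
           admissible (@laguerre_forsyth_hom K r) E E1 tau ->
           admissible (@laguerre_forsyth_hom K r) E E2 tau ->
           forall z, tr_dom tau z ->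
             eq_par E1 (tr_t tau z) = eq_par E2 (tr_t tau z))].
Proof.
have [io [N HN]] := real_norm_of hK.
case: r hr => [|[|[|s]]] // hr; split.
- exact: inh_projections HN s.
- exact: hom_equivalences HN s.
- by split; [exact: hom_semi_normalized HN s|exact: (superposition_groups HN)].
- exact: hom_groupoid HN s.
Qed.
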